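(* Let $3\le n\le 10$. For every irreducible character $\chi$ of the Drinfel'd double $D(S_n)$ of the symmetric group $S_n$ (over $\mathbb{C}$) and every integer $m\ge 1$, the $m$-th Frobenius-Schur indicator $\nu_m(\chi)$ is a non-negative integer.
   Context: For a finite group $G$, the Drinfel'd double $D(G)$ is the semisimple Hopf algebra over $\mathbb{C}$ with basis $\{p_g\bowtie x : g,x\in G\}$, multiplication $(p_k\bowtie z)(p_h\bowtie y)=\delta_{k,zhz^{-1}}\,p_k\bowtie zy$, unit $\sum_{g\in G}p_g\bowtie 1$, comultiplication $\Delta(p_g\bowtie x)=\sum_{h\in G}(p_h\bowtie x)\otimes(p_{h^{-1}g}\bowtie x)$, counit $\epsilon(p_g\bowtie x)=\delta_{g,1}$ and antipode $S(p_g\bowtie x)=p_{x^{-1}g^{-1}x}\bowtie x^{-1}$. Its normalized integral is $\Lambda=\frac1{|G|}\sum_{g\in G}p_1\bowtie g$. For $m\ge 1$, $\Lambda^{[m]}=\sum\Lambda_1\Lambda_2\cdots\Lambda_m$ is the result of applying the $m$-fold multiplication to the iterated comultiplication $\Delta^{m-1}(\Lambda)\in D(G)^{\otimes m}$ (with $\Lambda^{[1]}=\Lambda$). An irreducible character $\chi$ of $D(G)$ is the trace function of a simple $D(G)$-module, and its $m$-th Frobenius-Schur indicator is $\nu_m(\chi)=\chi(\Lambda^{[m]})$. *)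

(* Defs.v *)
From HB Require Import structures.
From mathcomp Require Import all_boot all_order all_algebra all_fingroup.
From mathcomp Require Export reals.
From mathcomp Require Export complex.

Set Implicit Arguments.
Unset Strict Implicit.
Unset Printing Implicit Defensive.

Import GRing.Theory.
Local Open Scope ring_scope.

(* The free F-module on a finite type I is {ffun I -> F^o}; its tensor product
   with the one on J is the free module on I * J, and its tensor powers are the
   free modules on the tuples over I. *)
Section FreeModule.
Variables (F : fieldType) (I : finType).

Definition basis_vec (i : I) : {ffun I -> F^o} := [ffun j => (j == i)%:R].

Definition lin_ext (V : lmodType F) (f : I -> V) (u : {ffun I -> F^o}) : V :=
  \sum_i u i *: f i.

Lemma lin_ext_is_linear (V : lmodType F) (f : I -> V) : linear (lin_ext f).
Proof.
move=> a u v; rewrite /lin_ext scaler_sumr -big_split /=; apply: eq_bigr => i _.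
by rewrite !ffunE scalerDl scalerA.
Qed.

HB.instance Definition _ (V : lmodType F) (f : I -> V) :=
  GRing.isLinear.Build F {ffun I -> F^o} V _ (lin_ext f) (lin_ext_is_linear f).

Lemma lin_ext_basis (V : lmodType F) (f : I -> V) i :
  lin_ext f (basis_vec i) = f i.
Proof.
rewrite /lin_ext (bigD1 i) //= ffunE eqxx scale1r big1 ?addr0 // => j.
by rewrite ffunE => /negPf ->; rewrite scale0r.
Qed.

Lemma basis_vecE (u : {ffun I -> F^o}) : u = \sum_i u i *: basis_vec i.
Proof.
apply/ffunP => j; rewrite sum_ffunE (bigD1 j) //= big1 => [|i /negPf ij].
  by rewrite !ffunE eqxx addr0 /GRing.scale /= mulr1.
by rewrite !ffunE eq_sym ij scaler0.
Qed.

End FreeModule.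

(* D(G), with the pair (g, x) as index of the basis element p_g |><| x. *)
Definition drinfeld_double (F : fieldType) (gT : finGroupType) : Type :=
  {ffun gT * gT -> F^o}.

HB.instance Definition _ (F : fieldType) (gT : finGroupType) :=
  GRing.Lmodule.copy (drinfeld_double F gT) {ffun gT * gT -> F^o}.

Section Double.
Variables (F : fieldType) (gT : finGroupType).
Local Notation D := (drinfeld_double F gT).
Implicit Types (u v w : D) (b c d : gT * gT).

Definition dbl (g x : gT) : D := basis_vec F (g, x).

Definition dbl_mul_basis b c : D :=
  if b.1 == (b.2 * c.1 * b.2^-1)%g then dbl b.1 (b.2 * c.2)%g else 0.

Definition dbl_mul u v : D :=
  lin_ext (fun b => lin_ext (fun c => dbl_mul_basis b c) v) u.

Definition dbl_one : D := \sum_g dbl g 1%g.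

Lemma dblE u : u = \sum_b u b *: dbl b.1 b.2.
Proof. by rewrite [LHS]basis_vecE; apply: eq_bigr => -[]. Qed.

Lemma dbl_mulDl : left_distributive dbl_mul +%R.
Proof. by move=> u v w; rewrite /dbl_mul linearD. Qed.

Lemma dbl_mulDr : right_distributive dbl_mul +%R.
Proof.
move=> u v w; rewrite /dbl_mul /lin_ext -big_split /=; apply: eq_bigr => b _.
rewrite -scalerDr -big_split; congr (_ *: _); apply: eq_bigr => c _ /=.
by rewrite ffunE scalerDl.
Qed.

Lemma dbl_mulZl (a : F) u v : dbl_mul (a *: u) v = a *: dbl_mul u v.
Proof. by rewrite /dbl_mul linearZ. Qed.

Lemma dbl_mulZr (a : F) u v : dbl_mul u (a *: v) = a *: dbl_mul u v.
Proof.
rewrite /dbl_mul {1 3}/lin_ext scaler_sumr; apply: eq_bigr => b _.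
by rewrite linearZ /= !scalerA mulrC.
Qed.

Lemma dbl_mul0l v : dbl_mul 0 v = 0.
Proof. by rewrite -[0](scale0r 0) dbl_mulZl !scale0r. Qed.

Lemma dbl_mul0r u : dbl_mul u 0 = 0.
Proof. by rewrite -[0](scale0r 0) dbl_mulZr !scale0r. Qed.

Lemma dbl_mul_suml (I : finType) (f : I -> D) v :
  dbl_mul (\sum_i f i) v = \sum_i dbl_mul (f i) v.
Proof.
apply: (big_morph (fun u => dbl_mul u v)); last exact: dbl_mul0l.
by move=> u w; exact: dbl_mulDl.
Qed.

Lemma dbl_mul_sumr (I : finType) (f : I -> D) u :
  dbl_mul u (\sum_i f i) = \sum_i dbl_mul u (f i).
Proof.
apply: (big_morph (dbl_mul u)); last exact: dbl_mul0r.
by move=> v w; exact: dbl_mulDr.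
Qed.

Lemma dbl_mulE k z h y : dbl_mul (dbl k z) (dbl h y) =
  if k == (z * h * z^-1)%g then dbl k (z * y)%g else 0.
Proof. by rewrite /dbl_mul !lin_ext_basis. Qed.

Lemma dbl_mulA_basis k z h y l x :
  dbl_mul (dbl k z) (dbl_mul (dbl h y) (dbl l x)) =
  dbl_mul (dbl_mul (dbl k z) (dbl h y)) (dbl l x).
Proof.
rewrite !dbl_mulE [LHS]fun_if [RHS](fun_if (dbl_mul^~ _)).
rewrite dbl_mul0l dbl_mul0r !dbl_mulE mulgA.
have [->|nk] := eqVneq k (z * h * z^-1)%g; last by case: ifP.
congr (if _ then _ else _).
rewrite invMg !mulgA (inj_eq (mulIg _)) -!mulgA (inj_eq (mulgI _)) !mulgA.
by [].
Qed.

Lemma dbl_mulA : associative dbl_mul.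
Proof.
move=> u v w; rewrite (dblE u) (dbl_mul_suml _ (dbl_mul v w)).
rewrite (dbl_mul_suml _ v) (dbl_mul_suml _ w); apply: eq_bigr => b _.
rewrite dbl_mulZl (dbl_mulZl _ _ v) (dbl_mulZl _ _ w); congr (_ *: _).
rewrite (dblE v) (dbl_mul_suml _ w) (dbl_mul_sumr _ (dbl b.1 b.2)).
rewrite (dbl_mul_sumr _ (dbl b.1 b.2)) (dbl_mul_suml _ w).
apply: eq_bigr => c _.
rewrite (dbl_mulZl _ _ w) !(dbl_mulZr _ (dbl b.1 b.2)) (dbl_mulZl _ _ w).
congr (_ *: _); rewrite (dblE w) (dbl_mul_sumr _ (dbl c.1 c.2)).
rewrite (dbl_mul_sumr _ (dbl b.1 b.2)) (dbl_mul_sumr _ (dbl_mul _ _)).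
apply: eq_bigr => d _.
by rewrite !dbl_mulZr dbl_mulA_basis.
Qed.

Lemma dbl_mul1l : left_id dbl_one dbl_mul.
Proof.
move=> u; rewrite [RHS]dblE {1}(dblE u) dbl_mul_sumr; apply: eq_bigr => -[h y] _.
rewrite dbl_mulZr; congr (_ *: _); rewrite dbl_mul_suml (bigD1 h) //= big1.
  by rewrite dbl_mulE invg1 mulg1 !mul1g eqxx addr0.
by move=> g /negPf gh; rewrite dbl_mulE invg1 mulg1 mul1g gh.
Qed.

Lemma dbl_mul1r : right_id dbl_one dbl_mul.
Proof.
move=> u; rewrite [RHS]dblE {1}(dblE u) dbl_mul_suml; apply: eq_bigr => -[k z] _.
rewrite dbl_mulZl; congr (_ *: _); rewrite dbl_mul_sumr (bigD1 (k ^ z)%g) //= big1.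
  by rewrite dbl_mulE conjgE !mulgA mulgV mul1g mulgK eqxx mulg1 addr0.
move=> g ng; rewrite dbl_mulE; case: eqP => // ek.
by case/eqP: ng; rewrite ek conjgE !mulgA mulVg mul1g mulgKV.
Qed.

Lemma dbl_one_neq0 : dbl_one != 0.
Proof.
apply/eqP => /ffunP /(_ (1%g, 1%g)); rewrite sum_ffunE (bigD1 1%g) //= big1.
  by move/eqP; rewrite !ffunE eqxx addr0 oner_eq0.
by move=> g /negPf; rewrite ffunE xpair_eqE eq_sym => ->.
Qed.

HB.instance Definition _ := GRing.Zmodule_isNzRing.Build D
  dbl_mulA dbl_mul1l dbl_mul1r dbl_mulDl dbl_mulDr dbl_one_neq0.

Lemma dbl_scaleAl (a : F) u v : a *: (u * v) = a *: u * v.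
Proof. exact: esym (dbl_mulZl a u v). Qed.

HB.instance Definition _ := GRing.Lmodule_isLalgebra.Build F D dbl_scaleAl.

Lemma dbl_scaleAr (a : F) u v : a *: (u * v) = u * (a *: v).
Proof. exact: esym (dbl_mulZr a u v). Qed.

HB.instance Definition _ := GRing.Lalgebra_isAlgebra.Build F D dbl_scaleAr.

Lemma dblM k z h y : dbl k z * dbl h y =
  if k == (z * h * z^-1)%g then dbl k (z * y)%g else 0.
Proof. exact: dbl_mulE. Qed.

Lemma dbl1 : 1 = \sum_g dbl g 1%g.
Proof. by []. Qed.

Definition dbl_tensor (m : nat) : Type := {ffun m.-tuple (gT * gT) -> F^o}.

HB.instance Definition _ (m : nat) :=
  GRing.Lmodule.copy (dbl_tensor m) {ffun m.-tuple (gT * gT) -> F^o}.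

Definition counit : D -> F^o := lin_ext (fun b => (b.1 == 1%g)%:R).

Definition comul : D -> {ffun (gT * gT) * (gT * gT) -> F^o} :=
  lin_ext (fun b =>
    \sum_h basis_vec F ((h, b.2), ((h^-1 * b.1)%g, b.2))).

(* Delta (x) id (x) ... (x) id on D^{(x) m+1} *)
Definition comul_head (m : nat) : dbl_tensor m.+1 -> dbl_tensor m.+2 :=
  lin_ext (fun t : m.+1.-tuple (gT * gT) =>
    lin_ext (fun p => basis_vec F [tuple of p.1 :: p.2 :: behead_tuple t])
            (comul (basis_vec F (thead t)))).

(* Delta^m : D -> D^{(x) m+1} *)
Fixpoint iter_comul (m : nat) : D -> dbl_tensor m.+1 :=
  if m is k.+1 then comul_head (m := k) \o iter_comul k
  else lin_ext (fun b => basis_vec F [tuple b]).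

Definition iter_mul (m : nat) : dbl_tensor m -> D :=
  lin_ext (fun t : m.-tuple (gT * gT) => \prod_(b <- t) dbl b.1 b.2).

(* u^[m] = u_1 u_2 ... u_m, meaningful for 0 < m *)
Definition sweedler_power (m : nat) (u : D) : D :=
  iter_mul (iter_comul m.-1 u).

Definition integral : D := (#|gT|%:R^-1 : F) *: \sum_g dbl 1%g g.

Lemma mul_integral u : u * integral = counit u *: integral.
Proof.
rewrite {1}(dblE u) /counit /lin_ext mulr_suml scaler_suml.
apply: eq_bigr => -[g x] _ /=; rewrite -scalerA -scalerAl; congr (_ *: _).
rewrite /integral -scalerAr [RHS]scalerA mulrC -scalerA; congr (_ *: _).
rewrite mulr_sumr; have [->|ng] := eqVneq g 1%g; last first.
  rewrite scale0r big1 // => h _.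
  by rewrite dblM mulg1 mulgV (negPf ng).
rewrite scale1r [RHS](reindex_inj (mulgI x)) /=; apply: eq_bigr => h _.
by rewrite dblM mulg1 mulgV eqxx.
Qed.

(* Left D(G)-modules are finite-dimensional spaces V with an algebra morphism
   D(G) -> End(V), where products in End(V) are compositions. *)
Definition is_module (V : vectType F) (rho : {linear D -> 'End(V)}) : Prop :=
  rho 1 = \1%VF /\ forall u v, rho (u * v) = (rho u \o rho v)%VF.

Definition is_simple_module (V : vectType F) (rho : {linear D -> 'End(V)}) :
    Prop :=
  [/\ is_module rho, {:V}%VS != 0%VS &
      forall U : {vspace V}, (forall u, (rho u @: U <= U)%VS) ->
        U = 0%VS \/ U = {:V}%VS].

Definition end_trace (V : vectType F) (f : 'End(V)) : F :=
  \tr (passmx.mxof (vbasis {:V}) (vbasis {:V}) f).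

Definition irreducible_character (chi : D -> F) : Prop :=
  exists (V : vectType F) (rho : {linear D -> 'End(V)}),
    is_simple_module rho /\ forall u, chi u = end_trace (rho u).

Definition FS_indicator (m : nat) (chi : D -> F) : F :=
  chi (sweedler_power m integral).

End Double.

(* Main.v *)
Require Import Defs.
From HB Require Import structures.
From mathcomp Require Import all_boot all_order all_algebra all_fingroup.
From mathcomp Require Import cyclic separable cyclotomic.
From Stdlib Require BinNat.
Set Implicit Arguments. Unset Strict Implicit. Unset Printing Implicit Defensive.
Import GRing.Theory Num.Theory.

(** Write [b] for the product [a * u], that is, first [a] and then [u].  From the
    formulas for the comultiplication and the product,
      [Lambda^[m] = |G|^-1 sum of p_u |><| a^-m],
    over the pairs [(u, a)] with [a^m = b^m] ([sweedler_integral]).  So the [m]-th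
    indicator of a module is [|G|^-1] times the sum, over the commuting pairs
    [(u, x)], of [N(u, x) tr (p_u |><| x^-1)], where [N(u, x)] is the number of [a]
    with [a^m = b^m = x].

    Suppose that each torsion pair, one with [a^m = b^m = 1], carries a linear
    character [L_(u,a)] of the common centralizer of [u] and [a], compatibly with
    conjugation, such that for all commuting [u] and [x]
      (1)   the sum of [L_(u,a)(x)] over the torsion pairs with [a] in [C(x)] is [N(u, x)].
    For a fixed pair, the average of [L_(u,a)(x) p_u |><| x^-1] over the common
    centralizer is an idempotent of the double, so its trace on a module is a rank.
    By (1) the indicator is the sum of these ranks over the conjugacy classes of
    torsion pairs, hence a natural number ([indicator_natural]).  In other words,
    (1) writes [N(u, .)] as a sum of characters of [C(u)] induced from the [L_(u,a)].

    For permutations of at most ten points, let [L_(u,a)(x)] be [w^e] with [w] a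
    primitive root of unity of order [2520 = lcm (1, ..., 10)] and [e] a total
    rotation number.  An [x] commuting with [a] permutes the cycles of [a]; once each
    cycle of length [d] is identified with [Z/d], it also turns them, and the sum of
    these turns is a homomorphism to [Q/Z] that does not depend on the
    identifications: it is a transfer ([rotationM], [rotation_indep]).  The rotation
    of [a] satisfies (1) except for some orbits of the group generated by [u] and [a]
    that have size 4, 8 or 9.  On these orbits [verdict] uses other characters built
    in the same way: rotations of a part of the cycles of [a] or [b], and the sign of
    the permutation induced by [x] on the cycles of [u].

    Identity (1) is local.  Both sides are sums over [a] of products over the points,
    and the factor at a point depends only on the action of [u], [a] and [x] on the
    orbit of that point.  Splitting off the orbit of a point ([peel], [eq_total]) reduces (1) to
    the permutations [a] for which [u], [a] and [x] are transitive on a set [K].  Then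
    [x] has cycles of one length [l] on [K], since the points of its cycles of a given
    length form a stable set.
    - If [x] is trivial on [K], both sides count the torsion pairs.
    - If [x] is a product of an odd number of transpositions, multiplying [a] by [x]
      on [K] changes the sign of [L_(u,a)(x)] for even [m], and exchanges the torsion
      pairs with the pairs counted on the right for odd [m] ([odd_connected]).
    - There remain fourteen cycle types of [x] in degree at most ten.  There [K] is
      identified with a standard set carrying a standard [x], [u] is taken up to
      conjugacy, [m] modulo a small period, and (1) is checked by enumeration
      ([cases_checked], [checked_connected]): a multiset of roots of unity of order
      [l] has the required integer sum because of linear relations between its
      multiplicities ([balanced_sum]). *)

(** * Cycle lengths, rotations and the local rule *)

Section Local.
Variables (T : Type) (e : T -> T -> bool).
Implicit Types (f u a x p : T -> T) (y z : T) (Z : seq T).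

(** On at most ten points, ten steps along a permutation visit a whole cycle.  The
    definitions below use iteration and a boolean equality only, no finite types and
    no inverses, so that they can be evaluated on an enumerated type and transported
    along an injection. *)
Definition iterates f y := traject f y 10.
Definition hit (P : pred T) f y := find P (iterates f y).
Definition len f y := (hit (e y) f (f y)).+1.
(** The preimage of [z] under a permutation [f], reached by going forward. *)
Definition prev f z := last z (traject f (f z) (len f z).-1).

(** Depth-first search: [n] bounds the depth and [v] lists the visited points. *)
Fixpoint reach (g : T -> seq T) n (v : seq T) y :=
  if has (e y) v then v else
  if n is n'.+1 then foldl (reach g n') (y :: v) (g y) else v.
Definition component (gs : seq (T -> T)) y := reach (fun z => [seq f z | f <- gs]) 10 [::] y.

(** Whether [p] fixes the [u]-preimage of every point of the [p]-cycle of [y]. *)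
Definition fixed_before u p y := all (fun z => let w := prev u z in e (p w) w) (iterates p y).

(** On orbits of size 4 and 8, the rotation of [a] needs a correction only when the
    2-part of [m] is 2 or 4; the value 1 stands for all other cases. *)
Definition two_part m := if m %% 8 == 4 then 4 else if m %% 4 == 2 then 2 else 1.
Definition three_part m := if (m %% 9 == 3) || (m %% 9 == 6) then 3 else 1.

(** Which cycles of a permutation contribute their rotation. *)
Variant selector := NoCycle | AllCycles | LengthIs of nat | EvenLength | FixedBefore.
Definition selected u p c y := match c with
  | NoCycle => false
  | AllCycles => true
  | LengthIs d => len p y == d
  | EvenLength => ~~ odd (len p y)
  | FixedBefore => fixed_before u p y
  end.

(** The cycles of [p] to be used when [p] is not semiregular of order [d] but the
    other one of [a] and [b] is; the boolean tells whether to add the sign on the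
    cycles of [u].  [None] leaves the choice that is made without correction. *)
Definition select2 d p Z : option selector * bool :=
  let h k := has (fun z => len p z == k) Z in
  if [&& h 4, h 2 & h 1] then (Some (LengthIs 4), true)
  else if h 6 && h 2 then (if d == 2 then Some (LengthIs 6) else None, true)
  else if [&& d == 4, count (fun z => len p z == 1) Z == 4
            & all (fun z => len p z <= 2) Z] then (Some FixedBefore, false)
  else (None, false).

Definition select3 p Z : option selector :=
  if has (fun z => ~~ odd (len p z)) Z then Some EvenLength
  else if all (fun z => (len p z == 1) || (len p z == 3)) Z then Some FixedBefore
  else None.

(** On an orbit [Z] of the group generated by [u] and [a]: the cycles of [a] and those
    of [b] whose rotations are summed, and whether the sign of the permutation of the
    cycles of [u] is added.  Outside the listed cases it is the rotation of [a].  The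
    listed cases have sizes 4, 8 and 9, with [a] or [b] semiregular of order the 2-part
    or 3-part of [m]: the other permutation then may have fixed points or shorter
    cycles, and [a^m = b^m = x] has solutions that the rotation of [a] alone does not
    account for. *)
Definition verdict m u a Z : selector * selector * bool :=
  let b z := u (a z) in
  let full p d := all (fun z => len p z == d) Z in
  let plain := (AllCycles, NoCycle, false) in
  if (size Z == 4) || (size Z == 8) then
    let d := two_part m in
    if d == 1 then plain
    else if full a d && full b d then
      (AllCycles, NoCycle, ~~ ((d == 4) && all (fun z => e (u (a z)) (a (u z))) Z))
    else if full b d then
      let s := select2 d a Z in (odflt AllCycles s.1, NoCycle, s.2)
    else if full a d then
      let s := select2 d b Z in (AllCycles, odflt NoCycle s.1, s.2)
    else plain
  else if size Z == 9 then
    if three_part m == 1 then plain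
    else if full b 3 then (odflt AllCycles (select3 a Z), NoCycle, false)
    else if full a 3 then (AllCycles, odflt NoCycle (select3 b Z), false)
    else plain
  else plain.

Variable rk : T -> nat.
(** A rank [rk] singles out one point in each cycle. *)
Definition first f y := all (fun z => rk y <= rk z) (iterates f y).
(** When [u] and [x] commute, this singles out one point for each [x]-orbit of cycles
    of [u]. *)
Definition orbit_first u x y := all (fun w => all (fun z =>
  rk y <= rk z) (iterates u w)) (iterates x y).

(** A full turn is [2520 = lcm (1, ..., 10)], so that a step in a cycle of length [d]
    is the integer [2520 / d]. *)
Definition fractions : seq BinNums.N :=
  Eval vm_compute in [seq bin_of_nat (2520 %/ d) | d <- iota 0 11].
Definition frac (d : nat) : BinNums.N := nth BinNums.N0 fractions d.

(** The turn by [x] of the cycle whose base point is [y]: the position of [x y] in the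
    cycle that it reaches, counted backwards from the base point of that cycle. *)
Definition rot_at p x y : BinNums.N :=
  if first p y then BinNat.N.mul (bin_of_nat (hit (first p) p (x y))) (frac (len p y)) else
    BinNums.N0.
(** Summed over a set, these are half a turn for each cycle of [u] and half a turn for
    each [x]-orbit of such cycles, which is the sign of the permutation induced by [x]
    on the cycles of [u]. *)
Definition swap_at u x y : BinNums.N :=
  BinNat.N.add (if first u y then (frac 2) else BinNums.N0) (if orbit_first u x y then (frac 2)
    else BinNums.N0).

Definition exponent_at m u a x y : BinNums.N :=
  let b z := u (a z) in
  let: (ca, cb, s) := verdict m u a (component [:: u; a] y) in
  BinNat.N.add (if selected u a ca y then rot_at a x y else BinNums.N0)
  (BinNat.N.add (if selected u b cb y then rot_at b x y else BinNums.N0)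
         (if s then swap_at u x y else BinNums.N0)).

(** Divisibility of [m] by the lengths of the cycles through [y] expresses
    [a^m y = b^m y = y], and similarly for [a^m y = b^m y = x y] in [root_at]. *)
Definition torsion_at m u a y : bool :=
  (m %% len a y == 0) && (m %% len (fun z => u (a z)) y == 0).
Definition root_at m u a x y : bool :=
  let b z := u (a z) in
  (m %% len a y == hit (e (x y)) a y) && (m %% len b y == hit (e (x y)) b y).
End Local.

Section Transport.
Variables (T T' : Type) (e : T -> T -> bool) (e' : T' -> T' -> bool).
Variables (rk : T -> nat) (rk' : T' -> nat) (s : T -> T') (K : pred T).
Hypothesis eE : forall y z, K y -> K z -> e' (s y) (s z) = e y z.
Hypothesis rkE : forall y z, K y -> K z -> (rk' (s y) <= rk' (s z)) = (rk y <= rk z).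

(** All the functions above commute with an injection [s] of a set [K] stable under
    the permutations.  Three uses are made of this: conjugation, restriction to a
    stable set ([s] is the identity), and labelings by a standard set. *)
Definition carries (f : T -> T) (f' : T' -> T') :=
  forall y, K y -> K (f y) /\ f' (s y) = s (f y).

Lemma carries_comp u u' a a' : carries u u' -> carries a a' ->
  carries (fun z => u (a z)) (fun z => u' (a' z)).
Proof. by move=> uu aa y Ky; have [Ka ->] := aa y Ky; have [] := uu _ Ka. Qed.

Lemma traject_carries f f' n y : carries f f' -> K y ->
  traject f' (s y) n = map s (traject f y n) /\ all K (traject f y n).
Proof.
move=> ff; elim: n y => [//|n IHn] y Ky /=; have [Kfy ->] := ff y Ky.
by have [-> ->] := IHn _ Kfy; rewrite Ky.
Qed.

Lemma all_carries (P : pred T) (P' : pred T') Z :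
  (forall z, K z -> P' (s z) = P z) -> all K Z -> all P' (map s Z) = all P Z.
Proof. by move=> PE; elim: Z => //= z Z IH /andP[Kz /IH->]; rewrite PE. Qed.
Lemma has_carries (P : pred T) (P' : pred T') Z :
  (forall z, K z -> P' (s z) = P z) -> all K Z -> has P' (map s Z) = has P Z.
Proof. by move=> PE; elim: Z => //= z Z IH /andP[Kz /IH->]; rewrite PE. Qed.
Lemma count_carries (P : pred T) (P' : pred T') Z :
  (forall z, K z -> P' (s z) = P z) -> all K Z -> count P' (map s Z) = count P Z.
Proof. by move=> PE; elim: Z => //= z Z IH /andP[Kz /IH->]; rewrite PE. Qed.
Lemma find_carries (P : pred T) (P' : pred T') Z :
  (forall z, K z -> P' (s z) = P z) -> all K Z -> find P' (map s Z) = find P Z.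
Proof. by move=> PE; elim: Z => //= z Z IH /andP[Kz /IH->]; rewrite PE. Qed.

Lemma hit_carries f f' (P : pred T) (P' : pred T') y : carries f f' ->
  (forall z, K z -> P' (s z) = P z) -> K y -> hit P' f' (s y) = hit P f y.
Proof.
move=> ff PE Ky; rewrite /hit /iterates; have [-> Kt] := traject_carries 10 ff Ky.
exact: find_carries.
Qed.

Lemma len_carries f f' y : carries f f' -> K y -> len e' f' (s y) = len e f y.
Proof.
move=> ff Ky; rewrite /len; have [Kf ->] := ff y Ky.
by congr _.+1; apply: (hit_carries ff) => // z Kz; exact: eE.
Qed.

Lemma prev_carries f f' y : carries f f' -> K y ->
  K (prev e f y) /\ prev e' f' (s y) = s (prev e f y).
Proof.
move=> ff Ky; rewrite /prev (len_carries ff Ky); have [Kf ->] := ff y Ky.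
have [-> Kt] := traject_carries (len e f y).-1 ff Kf.
rewrite last_map; split=> //.
by move: Kt; case/lastP: (traject _ _ _) => //= t z; rewrite all_rcons last_rcons => /andP[].
Qed.

Lemma reach_carries (g : T -> seq T) g' n v y :
  (forall z, K z -> g' (s z) = map s (g z) /\ all K (g z)) ->
  all K v -> K y ->
  reach e' g' n (map s v) (s y) = map s (reach e g n v y) /\ all K (reach e g n v y).
Proof.
move=> gg; elim: n v y => [|n IHn] v y Kv Ky /=;
  rewrite (@has_carries (e y)) => // [|z Kz]; try exact: eE; case: ifP => // _.
have [-> Kg] := gg y Ky.
have Kyv: all K (y :: v) by rewrite /= Ky.
rewrite -map_cons; elim: (g y) (y :: v) Kyv Kg => //= z Z IHZ w Kw /andP[Kz KZ].
by have [-> Kr] := IHn _ _ Kw Kz; exact: IHZ.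
Qed.

Lemma component_carries gs gs' y : size gs = size gs' ->
  (forall i, i < size gs -> carries (nth id gs i) (nth id gs' i)) -> K y ->
  component e' gs' (s y) = map s (component e gs y) /\ all K (component e gs y).
Proof.
move=> sz gg Ky; apply: (@reach_carries _ _ 10 [::]) => // z Kz.
elim: gs gs' sz gg => [|f gs IH] [|f' gs'] //= [sz] gg.
have /= [Kf ->] := gg 0 isT z Kz; rewrite Kf /=.
by have [i|-> ->] := IH gs' sz; first exact: (gg i.+1).
Qed.

Lemma fixed_before_carries u u' p p' y : carries u u' -> carries p p' -> K y ->
  fixed_before e' u' p' (s y) = fixed_before e u p y.
Proof.
move=> uu pp Ky; rewrite /fixed_before /iterates; have [-> Kt] := traject_carries 10 pp Ky.
apply: all_carries => // z Kz /=; have [Kp ->] := prev_carries uu Kz.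
by have [Kpp ->] := pp _ Kp; exact: eE.
Qed.

Lemma selected_carries u u' p p' c y : carries u u' -> carries p p' -> K y ->
  selected e' u' p' c (s y) = selected e u p c y.
Proof.
move=> uu pp Ky; case: c => [||d||]; rewrite /selected ?(len_carries pp) //.
exact: fixed_before_carries.
Qed.

Lemma select2_carries p p' d Z : carries p p' -> all K Z ->
  select2 e' d p' (map s Z) = select2 e d p Z.
Proof.
move=> pp KZ; have lE z : K z -> len e' p' (s z) = len e p z by exact: len_carries.
have hE k : has (fun z => len e' p' z == k) (map s Z) = has (fun z => len e p z == k) Z.
  by apply: has_carries => // z /lE->.
rewrite /select2 !hE.
rewrite (@count_carries (fun z => len e p z == 1)) //; last by move=> z /lE->.
by rewrite (@all_carries (fun z => len e p z <= 2)) // => z /lE->.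
Qed.

Lemma select3_carries p p' Z : carries p p' -> all K Z ->
  select3 e' p' (map s Z) = select3 e p Z.
Proof.
move=> pp KZ; have lE z : K z -> len e' p' (s z) = len e p z by exact: len_carries.
rewrite /select3 (@has_carries (fun z => ~~ odd (len e p z))) //; last by move=> z /lE->.
rewrite (@all_carries (fun z => (len e p z == 1) || (len e p z == 3))) //.
by move=> z /lE->.
Qed.

Lemma verdict_carries m u u' a a' Z : carries u u' -> carries a a' -> all K Z ->
  verdict e' m u' a' (map s Z) = verdict e m u a Z.
Proof.
move=> uu aa KZ; have bb := carries_comp uu aa.
have fE p p' d : carries p p' ->
  all (fun z => len e' p' z == d) (map s Z) = all (fun z => len e p z == d) Z.
  by move=> pp; apply: all_carries => // z Kz; rewrite (len_carries pp).
rewrite /verdict size_map !(fE _ _ _ aa) !(fE _ _ _ bb).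
rewrite !(select2_carries _ aa) // !(select2_carries _ bb) //.
rewrite !(select3_carries aa) // !(select3_carries bb) //.
rewrite (@all_carries (fun z => e (u (a z)) (a (u z)))) // => z Kz.
have [Ka ->] := aa _ Kz; have [Ku ->] := uu _ Kz.
by have [Kua ->] := uu _ Ka; have [Kau ->] := aa _ Ku; exact: eE.
Qed.

Lemma first_carries f f' y : carries f f' -> K y -> first rk' f' (s y) = first rk f y.
Proof.
move=> ff Ky; rewrite /first /iterates; have [-> Kt] := traject_carries 10 ff Ky.
by apply: all_carries => // z Kz; exact: rkE.
Qed.

Lemma orbit_first_carries u u' x x' y : carries u u' -> carries x x' -> K y ->
  orbit_first rk' u' x' (s y) = orbit_first rk u x y.
Proof.
move=> uu xx Ky; rewrite /orbit_first /iterates; have [-> Kt] := traject_carries 10 xx Ky.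
apply: all_carries => // w Kw; have [-> Kt'] := traject_carries 10 uu Kw.
by apply: all_carries => // z Kz; exact: rkE.
Qed.

Lemma rot_at_carries p p' x x' y : carries p p' -> carries x x' -> K y ->
  rot_at e' rk' p' x' (s y) = rot_at e rk p x y.
Proof.
move=> pp xx Ky; rewrite /rot_at (first_carries pp) // (len_carries pp) //.
have [Kx ->] := xx _ Ky; rewrite (@hit_carries _ _ (first rk p) _ _ pp) // => z Kz.
exact: first_carries.
Qed.

Lemma exponent_at_carries m u u' a a' x x' y :
  carries u u' -> carries a a' -> carries x x' -> K y ->
  exponent_at e' rk' m u' a' x' (s y) = exponent_at e rk m u a x y.
Proof.
move=> uu aa xx Ky; have bb := carries_comp uu aa.
rewrite /exponent_at; have [|i|-> KZ] := @component_carries [:: u; a] [:: u'; a'] y _ _ Ky => //.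
  by case: i => [|[|i]].
rewrite (verdict_carries m uu aa) //; case: (verdict _ _ _ _ _) => [[ca cb] t].
rewrite (selected_carries _ uu aa) // (selected_carries _ uu bb) //.
rewrite (rot_at_carries aa xx) // (rot_at_carries bb xx) //.
by rewrite /swap_at (first_carries uu) // (orbit_first_carries uu xx).
Qed.

Lemma torsion_at_carries m u u' a a' y : carries u u' -> carries a a' -> K y ->
  torsion_at e' m u' a' (s y) = torsion_at e m u a y.
Proof.
move=> uu aa Ky; have bb := carries_comp uu aa.
by rewrite /torsion_at (len_carries aa) // (len_carries bb).
Qed.

Lemma root_at_carries m u u' a a' x x' y :
  carries u u' -> carries a a' -> carries x x' -> K y ->
  root_at e' m u' a' x' (s y) = root_at e m u a x y.
Proof.
move=> uu aa xx Ky; have bb := carries_comp uu aa.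
rewrite /root_at (len_carries aa) // (len_carries bb) //; have [Kx ->] := xx _ Ky.
have hE : forall z, K z -> e' (s (x y)) (s z) = e (x y) z by move=> z; exact: eE.
by rewrite (hit_carries aa hE) // (hit_carries bb hE).
Qed.
End Transport.

(** * The local functions on permutations of a small set *)

Section Cycles.
Variables (T : finType) (T10 : #|T| <= 10).
Implicit Types (f : {perm T}) (y z : T).
Local Notation len := (@len T eq_op).

Lemma has_eq_op y (s : seq T) : has (eq_op y) s = (y \in s).
Proof. by rewrite -has_pred1; apply: eq_has => z /=; rewrite eq_sym. Qed.

(** The search for the first return to [y] ends within the ten steps. *)
Lemma len_porbit f y : len f y = #|porbit f y|.
Proof.
case E: #|porbit f y| => [|n]; first by have := card_porbit_neq0 f y; rewrite E.
congr _.+1; rewrite /hit /iterates.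
have n10 : n.+1 <= 10 by rewrite -E (leq_trans (max_card _)).
have := uniq_traject_porbit f y; have := iter_porbit f y; rewrite E => fn U.
rewrite (_ : 10 = n + (10 - n.+1).+1); last by rewrite addnS -addSn subnKC.
rewrite trajectD find_cat /= -iterSr fn eqxx.
case: ifP => [|_]; last by rewrite size_traject addn0.
by move: U => /= /andP[]; rewrite has_eq_op => /negPf->.
Qed.

Lemma len_gt0 f y : 0 < len f y. Proof. by []. Qed.
Lemma len_le10 f y : len f y <= 10.
Proof. by rewrite len_porbit (leq_trans (max_card _)). Qed.

Lemma iter_len f y : iter (len f y) f y = y.
Proof. by rewrite len_porbit iter_porbit. Qed.

Lemma iter_mod_len f y i : iter (i %% len f y) f y = iter i f y.
Proof.
have E k : iter (k * len f y) f y = y.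
  by elim: k => // k IHk; rewrite mulSn iterD IHk iter_len.
by rewrite {2}(divn_eq i (len f y)) addnC iterD E.
Qed.

Lemma iter_eq f y i j :
  (iter i f y == iter j f y) = (i == j %[mod len f y]).
Proof.
rewrite -(iter_mod_len f y i) -(iter_mod_len f y j).
have U := uniq_traject_porbit f y; rewrite -len_porbit in U.
by rewrite -2?(nth_traject f (ltn_pmod _ (len_gt0 f y))) nth_uniq // size_traject ltn_pmod.
Qed.

Lemma mem_iterates f y z : (z \in iterates f y) = (z \in porbit f y).
Proof.
apply/idP/idP => [/trajectP[i _ ->]|]; first by rewrite -permX mem_porbit.
rewrite porbit_traject -len_porbit => /trajectP[i il ->]; apply/trajectP.
by exists i => //; apply: leq_trans il (len_le10 f y).
Qed.

Lemma hit_eq (P : pred T) f y i : i < 10 -> P (iter i f y) ->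
  (forall j, j < i -> ~~ P (iter j f y)) -> hit P f y = i.
Proof.
move=> i10 Pi Pj; rewrite /hit /iterates (_ : 10 = i + (10 - i.+1).+1); last first.
  by rewrite addnS -addSn subnKC.
rewrite trajectD find_cat /= Pi size_traject addn0; case: ifP => //.
by case/hasP=> _ /trajectP[j ji ->]; rewrite (negPf (Pj j ji)).
Qed.

Lemma hitP (P : pred T) f y z : z \in porbit f y -> P z ->
  [/\ hit P f y < len f y, P (iter (hit P f y) f y) &
      forall j, j < hit P f y -> ~~ P (iter j f y)].
Proof.
rewrite porbit_traject -len_porbit => /trajectP[i il ->] Pi.
pose k := find (fun j => P (iter j f y)) (iota 0 (len f y)).
have hk : has (fun j => P (iter j f y)) (iota 0 (len f y)).
  by apply/hasP; exists i; rewrite ?mem_iota.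
have kl : k < len f y by rewrite -[X in _ < X](size_iota 0) -has_find.
have Pk : P (iter k f y) by have := nth_find 0 hk; rewrite nth_iota.
have nP j : j < k -> ~~ P (iter j f y).
  move=> jk; have := before_find 0 jk; rewrite nth_iota ?(ltn_trans jk) // => ->.
  by [].
by rewrite (hit_eq (leq_trans kl (len_le10 f y)) Pk nP).
Qed.

Lemma len_stable f (g : {perm T}) y : commute f g -> len f (g y) = len f y.
Proof.
move=> fg; rewrite !len_porbit -[RHS](card_imset _ (@perm_inj _ g)).
congr #|pred_of_set _|; apply/setP=> z; apply/porbitP/imsetP => [[i ->]|[w /porbitP[i ->] ->]].
  exists ((f ^+ i)%g y); first exact: mem_porbit.
  by rewrite -!permM (commuteX2 1 i (commute_sym fg)).
by exists i; rewrite -!permM (commuteX2 1 i (commute_sym fg)).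
Qed.

Lemma len_porbit_mem f y z : z \in porbit f y -> len f z = len f y.
Proof. by rewrite !len_porbit -eq_porbit_mem => /eqP->. Qed.

Lemma eq_carries (g h : T -> T) : g =1 h -> carries id predT g h.
Proof. by move=> gh y _; split=> //; rewrite gh. Qed.

Lemma len_mul (u a : {perm T}) y : len (fun z => u (a z)) y = len (a * u)%g y.
Proof.
by apply: (@len_carries _ _ _ _ id predT) => //; apply: eq_carries => z; rewrite permM.
Qed.

Lemma torsion_atP m (u a : {perm T}) y :
  torsion_at eq_op m u a y = (((a ^+ m)%g y == y) && (((a * u) ^+ m)%g y == y)).
Proof.
have E (f : {perm T}) : (m %% len f y == 0) = ((f ^+ m)%g y == y).
  by rewrite permX -[X in _ = (_ == X)]/(iter 0 f y) iter_eq mod0n.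
by rewrite /torsion_at len_mul !E.
Qed.

Lemma root_atP m (u a x : {perm T}) y :
  root_at eq_op m u a x y = (((a ^+ m)%g y == x y) && (((a * u) ^+ m)%g y == x y)).
Proof.
have E (f : {perm T}) : (m %% len f y == hit (eq_op (x y)) f y) = ((f ^+ m)%g y == x y).
  rewrite permX; have [xf | nxf] := boolP (x y \in porbit f y).
    have [hl /eqP hx _] := hitP xf (eqxx (x y)).
    rewrite {2}hx iter_eq [X in _ = (_ == X)]modn_small //.
  have -> : (iter m f y == x y) = false.
    by apply: contraNF nxf => /eqP <-; rewrite -permX mem_porbit.
  apply/eqP => h; case/negP: nxf; move: (ltn_pmod m (len_gt0 f y)); rewrite h => hl.
  have : has (eq_op (x y)) (iterates f y).
    rewrite has_find size_traject; exact: leq_trans hl (len_le10 f y).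
  by rewrite has_eq_op mem_iterates.
have hb : hit (eq_op (x y)) (fun z => u (a z)) y = hit (eq_op (x y)) (a * u)%g y.
  apply/esym/(@hit_carries _ _ id predT) => //; apply: eq_carries => z; by rewrite permM.
by rewrite /root_at len_mul hb !E.
Qed.

(** [reach] is the depth-first search that decides [connect]. *)
Lemma component_connect (gs : seq (T -> T)) y z :
  (z \in component eq_op gs y) = connect (grel (fun w => [seq h w | h <- gs])) y z.
Proof.
set g := fun w => [seq h w | h <- gs].
have reachE n v w : reach eq_op g n v w = dfs g n v w.
  elim: n v w => [|n IHn] v w /=; rewrite has_eq_op //; case: ifP => // _.
  by elim: (g w) (w :: v) => //= t s IHs r; rewrite IHn IHs.
rewrite /component -/g reachE; apply/dfs_pathP/connectP => //; first by rewrite card0.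
  by case=> p gp -> _; exists p.
by case=> p gp ->; exists p; rewrite // disjoint_sym disjoint0.
Qed.

Lemma component_uniq (gs : seq (T -> T)) y : uniq (component eq_op gs y).
Proof.
rewrite /component; set g := fun w => _.
suff: forall n v w, uniq v -> uniq (reach eq_op g n v w) by apply.
elim=> [|n IHn] v w Uv /=; rewrite has_eq_op; case: ifP => // nwv.
have: uniq (w :: v) by rewrite /= nwv.
by elim: (g w) (w :: v) => //= t s IHs r Ur; apply: IHs; apply: IHn.
Qed.
End Cycles.

(** * Transversals and rotation numbers *)

Local Open Scope ring_scope.

Section Transfer.
Variables (T : finType) (V : zmodType) (p : {perm T}) (E : pred T).
Hypothesis pE : forall y, E (p y) = E y.

(** Rotation numbers are defined on a set [E] stable under [p], with [B] a choice of
    one base point in each cycle of [p]. *)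
Definition transversal (B : pred T) :=
  (forall y, E y -> exists2 z, z \in porbit p y & B z) /\
  (forall y z, E y -> B y -> B z -> z \in porbit p y -> y = z).

Definition rep (B : pred T) y := odflt y [pick z in porbit p y | B z].

Lemma rep_porbit B y : rep B y \in porbit p y.
Proof. by rewrite /rep; case: pickP => [z /andP[]|] //= _; exact: porbit_id. Qed.

Lemma E_porbit y z : z \in porbit p y -> E z = E y.
Proof.
case/porbitP=> i ->; rewrite permX; elim: i => //= i <-; exact: pE.
Qed.

Lemma repP B y : transversal B -> E y -> B (rep B y).
Proof.
case=> ex _ Ey; rewrite /rep; case: pickP => [z /andP[]|nz] //=.
by have [z yz Bz] := ex y Ey; have := nz z; rewrite yz Bz.
Qed.

Lemma rep_uniq B y z : transversal B -> E y -> B z -> z \in porbit p y -> rep B y = z.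
Proof.
move=> tB Ey Bz yz; have [_ un] := tB; apply: un => //; last 1 first.
- by rewrite -eq_porbit_mem in yz;
    rewrite -eq_porbit_mem (eqP yz) eq_sym eq_porbit_mem rep_porbit.
- by rewrite (E_porbit (rep_porbit B y)).
exact: repP.
Qed.

(** A function constant on the cycles has the same sum over all choices of base
    points. *)
Lemma sum_transversal B B' (h : T -> V) : transversal B -> transversal B' ->
  (forall y, E y -> h (p y) = h y) ->
  \sum_(y | E y && B y) h y = \sum_(y | E y && B' y) h y.
Proof.
move=> tB tB' hp.
have h_porbit y z : E y -> z \in porbit p y -> h z = h y.
  move=> Ey /porbitP[i ->]; rewrite permX; elim: i => //= i IHi.
  by rewrite hp // -permX (E_porbit (mem_porbit p i y)).
rewrite (reindex_onto (rep B) (rep B')) /=; last first.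
  move=> y /andP[Ey By]; apply: rep_uniq => //.
    by rewrite (E_porbit (rep_porbit _ _)).
  by rewrite porbit_sym rep_porbit.
apply: eq_big => [y | y /andP[/andP[Ey _] _]].
  rewrite (E_porbit (rep_porbit B y)); have [Ey|] := boolP (E y); rewrite ?andbF //=.
  rewrite repP //=.
  have E1 : E (rep B y) by rewrite (E_porbit (rep_porbit B y)).
  apply/eqP/idP => [<-|B'y]; first exact: repP.
  by apply: rep_uniq => //; rewrite porbit_sym rep_porbit.
rewrite (E_porbit (rep_porbit B y)) in Ey.
exact: h_porbit (rep_porbit _ _).
Qed.

Lemma transversal_shift (x : {perm T}) B : commute p x -> (forall y, E (x y) = E y) ->
  transversal B -> transversal (fun y => B (x^-1%g y)).
Proof.
move=> px xE [ex un].
have xVE y : E (x^-1%g y) = E y by rewrite -(xE (x^-1%g y)) permKV.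
have shift y z : z \in porbit p y -> x z \in porbit p (x y).
  case/porbitP=> i ->; apply/porbitP; exists i.
  by rewrite -!permM (commuteX2 i 1 px).
split=> [y Ey | y z Ey By Bz yz].
  have Exy : E (x^-1%g y) by rewrite xVE.
  have [z yz Bz] := ex _ Exy.
  by exists (x z); rewrite ?permK // -[y](permKV x) shift.
apply: (@perm_inj _ x^-1%g); apply: un => //; first by rewrite xVE.
case/porbitP: yz => i ->; apply/porbitP; exists i; rewrite -!permM.
by rewrite (commuteX2 i 1 (commuteV px)).
Qed.

Lemma sum_shift (x : {perm T}) B (h : T -> V) : commute p x ->
  (forall y, E (x y) = E y) -> transversal B -> (forall y, E y -> h (p y) = h y) ->
  \sum_(y | E y && B y) h (x y) = \sum_(y | E y && B y) h y.
Proof.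
move=> px xE tB hp; rewrite [RHS](sum_transversal tB (transversal_shift px xE tB)) //.
rewrite [RHS](reindex_inj (@perm_inj _ x)) /=; apply: eq_bigl => y.
by rewrite xE permK.
Qed.

Section Sections.
Variables (c : T -> V).

(** [k] measures the way from a point along its cycle to the base point, where the step
    from [y] has length [c y]. *)
Definition is_section (k : T -> V) := forall y, E y -> k (p y) = k y - c y.
Definition rotation (k : T -> V) (x : {perm T}) (B : pred T) :=
  \sum_(y | E y && B y) (k (x y) - k y).

(** As [x] commutes with [p] and respects the units, it displaces all points of a cycle
    by the same amount. *)
Lemma displacement_inv k (x : {perm T}) : is_section k -> commute p x ->
  (forall y, E (x y) = E y) -> (forall y, c (x y) = c y) ->
  forall y, E y -> k (x (p y)) - k (p y) = k (x y) - k y.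
Proof.
move=> ks px xE xc y Ey; rewrite -permM px permM !ks ?xE // xc.
by rewrite opprB addrA subrK.
Qed.

(** The displacement of [y] by [x * x'] is that of [y] by [x] plus that of [x y] by
    [x'].  The latter depends only on the cycle of [x y], and [x] permutes the
    cycles. *)
Lemma rotationM k (x x' : {perm T}) B : is_section k -> transversal B ->
  commute p x -> commute p x' -> (forall y, E (x y) = E y) -> (forall y, E (x' y) = E y) ->
  (forall y, c (x' y) = c y) ->
  rotation k (x * x')%g B = rotation k x B + rotation k x' B.
Proof.
move=> ks tB px px' xE xE' xc'.
rewrite /rotation -(@sum_shift x B (fun y => k (x' y) - k y)) //; last exact: displacement_inv.
by rewrite -big_split /=; apply: eq_bigr => y _; rewrite permM addrC subrKA.
Qed.

(** Two sections differ by a function that is constant on the cycles, and [x] permutes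
    the cycles, so that the differences cancel in the sum. *)
Lemma rotation_indep k k' (x : {perm T}) B B' : is_section k -> is_section k' ->
  transversal B -> transversal B' -> commute p x -> (forall y, E (x y) = E y) ->
  (forall y, c (x y) = c y) -> rotation k x B = rotation k' x B'.
Proof.
move=> ks ks' tB tB' px xE xc.
pose d y := k' y - k y.
have dp y : E y -> d (p y) = d y by move=> Ey; rewrite /d ks // ks' // opprB addrA subrK.
have := sum_shift px xE tB' dp => Ed.
rewrite /rotation (sum_transversal tB tB'); last exact: displacement_inv.
apply/eqP; rewrite -subr_eq0 -sumrB; apply/eqP.
transitivity (\sum_(y | E y && B' y) (d y - d (x y))).
  apply: eq_bigr => y _; rewrite /d.
  by rewrite !opprB [LHS]addrACA [RHS]addrACA [k (x y) + _]addrC.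
by rewrite sumrB Ed subrr.
Qed.
End Sections.
End Transfer.

Local Close Scope ring_scope.

(** * Rotation numbers are homomorphisms *)

Lemma nat_of_bin_add (a b : BinNums.N) : BinNat.N.add a b = a + b :> nat.
Proof. by case: a b => [|p] [|q] //=; rewrite ?addn0 // nat_of_add_pos. Qed.

Lemma nat_of_bin_mul (a b : BinNums.N) : BinNat.N.mul a b = a * b :> nat.
Proof. by case: a b => [|p] [|q] //=; rewrite ?muln0 // nat_of_mul_pos. Qed.

Lemma frac_len d : 0 < d <= 10 -> d * nat_of_bin (frac d) = 2520.
Proof. by move: d; do 11?[case=> //]. Qed.

Section Minima.
Variables (T : finType) (T10 : #|T| <= 10).
Local Notation len := (@len T eq_op).
Variables (rk : T -> nat) (E : pred T).
Hypothesis rkI : {in E &, injective rk}.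

Lemma firstP (p : {perm T}) y :
  reflect (forall z, z \in porbit p y -> rk y <= rk z) (first rk p y).
Proof.
by apply: (iffP allP) => H z zy; apply: H; rewrite mem_iterates in zy *.
Qed.

Lemma first_transversal (p : {perm T}) : (forall y, E (p y) = E y) ->
  transversal p E (first rk p).
Proof.
move=> pE; split=> [y Ey | y z Ey /firstP fy /firstP fz yz].
  have [z yz zmin] := @arg_minnP _ y (fun z => z \in porbit p y) rk (porbit_id p y).
  exists z => //; apply/firstP => w zw; apply: zmin.
  by rewrite -eq_porbit_mem in yz; rewrite -(eqP yz).
apply: rkI => //; first by rewrite unfold_in (E_porbit pE yz).
by apply/eqP; rewrite eqn_leq fy // fz // porbit_sym.
Qed.

Lemma orbit_firstP (u x : {perm T}) y :
  reflect (forall i z, z \in porbit u ((x ^+ i)%g y) -> rk y <= rk z) (orbit_first rk u x y).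
Proof.
apply: (iffP allP) => H => [i z zu | w].
  have /H/allP : (x ^+ i)%g y \in iterates x y by rewrite mem_iterates // mem_porbit.
  by apply; rewrite mem_iterates.
rewrite mem_iterates // => /porbitP[i ->]; apply/allP => z; rewrite mem_iterates //; exact: H.
Qed.
End Minima.

(** In this section and below, the number [N] of steps in a turn is a variable with an
    equation, which protects the unary numeral from being unfolded. *)
Section Rotation.
Variables (T : finType) (T10 : #|T| <= 10) (N : nat).
Hypothesis NE : N = 2520.
Local Notation len := (@len T eq_op).
Local Open Scope ring_scope.

Lemma natr_modN (m n : nat) : (m%:R == n%:R :> 'Z_N) = (m == n %[mod N])%N.
Proof. by rewrite -val_eqE /= !val_Zp_nat ?NE. Qed.

Definition unit_step (p : {perm T}) y : 'Z_N := (nat_of_bin (frac (len p y)))%:R.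
Definition position rk (p : {perm T}) y : 'Z_N :=
  (hit (first rk p) p y * nat_of_bin (frac (len p y)))%:R.

(** One step along the cycle brings the base point one step closer, and stepping from
    the base point itself the number of remaining steps jumps from 0 to the length
    less one, which is -1 modulo a turn. *)
Lemma position_section rk (p : {perm T}) (E : pred T) : {in E &, injective rk} ->
  (forall y, E (p y) = E y) -> is_section p E (unit_step p) (position rk p).
Proof.
move=> rkI pE y Ey.
have [ex un] := first_transversal T10 rkI pE.
have lenp : len p (p y) = len p y by apply: len_porbit_mem => //; exact: (mem_porbit p 1 y).
have [z yz fz] := ex y Ey; have [hl fh nf] := hitP T10 yz fz.
rewrite /position /unit_step lenp; set d := len p y in hl *.
have d10 : (d <= 10)%N by exact: len_le10.
case Et: (hit (first rk p) p y) fh nf hl => [|t] fh nf hl.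
  rewrite (@hit_eq _ _ p (p y) d.-1) //.
  - rewrite mul0n sub0r; apply/eqP; rewrite -addr_eq0 -natrD; apply/eqP.
    rewrite -{2}[nat_of_bin _]mul1n -mulnDl addn1 prednK //.
    apply/eqP; rewrite -[0]/(0%:R) natr_modN frac_len ?NE //.
  - by rewrite -iterSr prednK // iter_len.
  move=> j jd; apply/negP => fj; have := un _ _ Ey fh.
  rewrite -iterSr in fj => /(_ _ fj); rewrite -permX mem_porbit => /(_ isT) /esym/eqP.
  rewrite permX -[X in _ == X]/(iter 0 p y) iter_eq // mod0n modn_small // -/d.
rewrite (@hit_eq _ _ p (p y) t) //.
- by rewrite mulSn natrD addrAC subrr add0r.
- exact: leq_trans (ltnW hl) d10.
- by rewrite -iterSr.
by move=> j jt; rewrite -iterSr; exact: nf.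
Qed.

Lemma sum_rot_at rk (p x : {perm T}) (E : pred T) : {in E &, injective rk} ->
  commute p x ->
  \sum_(y | E y) (nat_of_bin (rot_at eq_op rk p x y))%:R =
  rotation E (position rk p) x (first rk p).
Proof.
move=> rkI px; rewrite /rotation big_mkcondr; apply: eq_bigr => y Ey.
rewrite /rot_at; case: ifP => // fy.
rewrite nat_of_bin_mul bin_of_natK /position len_stable //.
rewrite [X in _ = _ - X](_ : _ = 0) ?subr0 //.
by rewrite (@hit_eq _ (first rk p) p y 0) ?mul0n.
Qed.

Lemma sum_rot_atM rk (p x x' : {perm T}) (E : pred T) : {in E &, injective rk} ->
  commute p x -> commute p x' ->
  (forall y, E (p y) = E y) -> (forall y, E (x y) = E y) -> (forall y, E (x' y) = E y) ->
  \sum_(y | E y) (nat_of_bin (rot_at eq_op rk p (x * x')%g y))%:R =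
  \sum_(y | E y) (nat_of_bin (rot_at eq_op rk p x y))%:R +
  \sum_(y | E y) (nat_of_bin (rot_at eq_op rk p x' y))%:R :> 'Z_N.
Proof.
move=> rkI px px' pE xE xE'; rewrite [LHS](sum_rot_at rkI (commuteM px px')).
rewrite [X in _ = X + _](sum_rot_at rkI px) [X in _ = _ + X](sum_rot_at rkI px').
apply: (rotationM pE (position_section rkI pE)) => //.
  exact: first_transversal.
by move=> y; rewrite /unit_step len_stable.
Qed.

Lemma sum_rot_at_rk rk rk' (p x : {perm T}) (E : pred T) :
  {in E &, injective rk} -> {in E &, injective rk'} ->
  commute p x -> (forall y, E (p y) = E y) -> (forall y, E (x y) = E y) ->
  \sum_(y | E y) (nat_of_bin (rot_at eq_op rk p x y))%:R =
  \sum_(y | E y) (nat_of_bin (rot_at eq_op rk' p x y))%:R :> 'Z_N.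
Proof.
move=> rkI rkI' px pE xE; rewrite [LHS](sum_rot_at rkI px) [RHS](sum_rot_at rkI' px).
apply: (rotation_indep pE (position_section rkI pE) (position_section rkI' pE)) => //.
- exact: first_transversal.
- exact: first_transversal.
by move=> y; rewrite /unit_step len_stable.
Qed.
End Rotation.

(** * The sign of a permutation of cycles *)

Section Swap.
Variables (T : finType) (T10 : #|T| <= 10) (u : {perm T}) (E : pred T).
Hypothesis uE : forall y, E (u y) = E y.

Section Rank.
Variables (rk : T -> nat).
Hypothesis rkI : {in E &, injective rk}.

Let R y := E y && first rk u y.

Lemma porbit_shift (x : {perm T}) y z : commute u x ->
  z \in porbit u y -> x z \in porbit u (x y).
Proof.
move=> ux /porbitP[i ->]; apply/porbitP; exists i.
by rewrite -!permM (commuteX2 i 1 ux).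
Qed.

Lemma E_pow (x : {perm T}) i y : (forall y, E (x y) = E y) -> E ((x ^+ i)%g y) = E y.
Proof. by move=> xE; rewrite permX; elim: i => //= i <-; exact: xE. Qed.

Section OneElement.
Variable x : {perm T}.
Hypotheses (ux : commute u x) (xE : forall y, E (x y) = E y).

Let tB := first_transversal T10 rkI uE.

(** The permutation of the cycles of [u] induced by [x], realized on the base points
    and extended by the identity. *)
Definition cycle_move y := if R y then rep u (first rk u) (x y) else y.

Lemma rep_R y : E y -> R (rep u (first rk u) y).
Proof.
by move=> Ey; rewrite /R (repP tB) // (E_porbit uE (rep_porbit u (first rk u) y)) Ey.
Qed.

Lemma cycle_move_inj : injective cycle_move.
Proof.
move=> y z; rewrite /cycle_move; case: ifPn => Ry; case: ifPn => Rz //; last 2 first.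
- by move=> E1; case/negP: Rz; rewrite -E1 rep_R // xE; case/andP: Ry.
- by move=> E1; case/negP: Ry; rewrite E1 rep_R // xE; case/andP: Rz.
move=> E1; have /andP[Ey fy] := Ry; have /andP[Ez fz] := Rz.
apply: (tB.2) => //.
have : x z \in porbit u (x y).
  have := rep_porbit u (first rk u) (x z); rewrite -E1 -!eq_porbit_mem => /eqP <-.
  by rewrite eq_porbit_mem rep_porbit.
move/(porbit_shift (commuteV ux)); rewrite !permK; exact.
Qed.

Definition cycle_perm := perm cycle_move_inj.

Lemma cycle_permX i y : R y ->
  (cycle_perm ^+ i)%g y = rep u (first rk u) ((x ^+ i)%g y).
Proof.
move=> Ry; have /andP[Ey fy] := Ry; elim: i => [|i IHi].
  by rewrite !expg0 !perm1 (@rep_uniq _ u E uE _ y y) // porbit_id.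
have Ei : E ((x ^+ i)%g y) by rewrite E_pow.
rewrite expgSr permM IHi permE /cycle_move rep_R // expgSr permM.
apply: (rep_uniq uE tB); rewrite ?xE //.
- by rewrite (E_porbit uE (rep_porbit _ _ _)).
- by apply: (repP tB); rewrite xE.
have := porbit_shift ux (rep_porbit u (first rk u) ((x ^+ i)%g y)).
rewrite -eq_porbit_mem => /eqP ->; exact: rep_porbit.
Qed.

Let W y := ~~ R y || orbit_first rk u x y.

Lemma orbit_first_first y : orbit_first rk u x y -> first rk u y.
Proof.
move/(orbit_firstP T10) => H; apply/(firstP T10) => z zy; apply: (H 0).
by rewrite expg0 perm1.
Qed.

(** The orbits of [cycle_perm] are the singletons of the points that are not base
    points, and one orbit for each [x]-orbit of cycles of [u]. *)
Lemma card_porbits_cycle_perm : #|porbits cycle_perm| = #|W|.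
Proof.
have fix_nR y : ~~ R y -> forall i, (cycle_perm ^+ i)%g y = y.
  move=> nRy; elim=> [|i IHi]; first by rewrite expg0 perm1.
  by rewrite expgSr permM IHi permE /cycle_move (negPf nRy).
have R_orb y z : R y -> z \in porbit cycle_perm y ->
    R z /\ exists i, z \in porbit u ((x ^+ i)%g y).
  move=> Ry /porbitP[i ->]; rewrite cycle_permX //; split.
    by apply: rep_R; rewrite E_pow //; case/andP: Ry.
  by exists i; exact: rep_porbit.
rewrite /porbits -[RHS](@card_in_imset _ _ (porbit cycle_perm) (mem W)); last first.
  move=> y z Wy Wz /eqP; rewrite eq_porbit_mem => yz.
  have [Rz | nRz] := boolP (R z); last by case/porbitP: yz => i ->; rewrite fix_nR.
  have [Ry [i yi]] := R_orb _ _ Rz yz.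
  rewrite porbit_sym in yz; have [_ [j zj]] := R_orb _ _ Ry yz.
  move: Wy Wz; rewrite !unfold_in /W Ry Rz /= => /(orbit_firstP T10) Hy /(orbit_firstP T10) Hz.
  have /andP[Ey _] := Ry; have /andP[Ez _] := Rz.
  apply: rkI => //; apply/eqP; rewrite eqn_leq (Hy j) // (Hz i) //.
apply: eq_card => A; apply/imsetP/imsetP => [] [y _ ->]; last by exists y.
have [Ry | nRy] := boolP (R y); last by exists y; rewrite // unfold_in /W nRy.
have /andP[Ey fy] := Ry.
pose O z := [exists i : 'I_#|[set: {perm T}]|.+1, z \in porbit u ((x ^+ i)%g y)].
have Oy : O y by apply/existsP; exists ord0; rewrite expg0 perm1 porbit_id.
have OP z : reflect (exists i, z \in porbit u ((x ^+ i)%g y)) (O z).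
  apply: (iffP existsP) => [[i iz]|[i iz]]; first by exists i.
  have lt : i %% #[x]%g < #|[set: {perm T}]|.+1.
    by rewrite ltnS ltnW // (leq_trans (ltn_pmod _ (order_gt0 x))) // subset_leq_card // subsetT.
  by exists (Ordinal lt); rewrite /= expg_mod_order.
have [z /OP[i zi] zmin] := @arg_minnP _ y O rk Oy.
have f2z : orbit_first rk u x z.
  apply/(orbit_firstP T10) => j w wj; apply: zmin; apply/OP; exists (i + j).
  have := porbit_shift (commuteX j ux) zi; rewrite -permM -expgD -eq_porbit_mem => /eqP <-.
  by [].
have Ez : E z by rewrite (E_porbit uE zi) E_pow.
exists z; first by rewrite unfold_in /W f2z orbT.
apply/eqP; rewrite eq_sym eq_porbit_mem; apply/porbitP; exists i.
rewrite cycle_permX //; apply/esym/(rep_uniq uE tB) => //; first by rewrite E_pow.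
exact: orbit_first_first.
Qed.

(** The parity of a permutation is that of the number of points minus the number of
    orbits. *)
Lemma odd_cycle_perm : odd_perm cycle_perm =
  odd #|[pred y | E y && first rk u y]| (+) odd #|[pred y | E y && orbit_first rk u x y]|.
Proof.
rewrite /odd_perm card_porbits_cycle_perm.
have -> : #|W| = #|[predC R]| + #|[pred y | E y && orbit_first rk u x y]|.
  rewrite -cardUI [#|predI _ _|]eq_card0 ?addn0.
    apply: eq_card => y; rewrite !inE /= !unfold_in /W /R; move: (@orbit_first_first y).
    by case: (E y); case: (first _ _ _); case: (orbit_first _ _ _ _) => // /(_ isT).
  move=> y; rewrite !inE /= !unfold_in /R; move: (@orbit_first_first y).
  by case: (E y); case: (first _ _ _); case: (orbit_first _ _ _ _) => // /(_ isT).
rewrite -(cardC (mem [pred y | E y && first rk u y])) !oddD.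
rewrite -[#|[predC R]|]/#|[predC [pred y | E y && first rk u y]]|.
set a := odd _; set b := odd _; set c := odd _.
by rewrite addbA -[(a (+) b) (+) b]addbA addbb addbF.
Qed.
End OneElement.

Lemma odd_swapM (x x' : {perm T}) : commute u x -> commute u x' ->
  (forall y, E (x y) = E y) -> (forall y, E (x' y) = E y) ->
  odd #|[pred y | E y && first rk u y]| (+) odd #|[pred y | E y && orbit_first rk u (x * x')%g
    y]| =
  (odd #|[pred y | E y && first rk u y]| (+) odd #|[pred y | E y && orbit_first rk u x y]|) (+)
  (odd #|[pred y | E y && first rk u y]| (+) odd #|[pred y | E y && orbit_first rk u x' y]|).
Proof.
move=> ux ux' xE xE'.
have xxE y : E ((x * x')%g y) = E y by rewrite permM xE' xE.
rewrite -(odd_cycle_perm (commuteM ux ux') xxE) -(odd_cycle_perm ux xE) -(odd_cycle_perm ux' xE').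
rewrite -odd_permM; congr (odd_perm _); apply/permP => y; rewrite permM !permE /cycle_move.
have tB := first_transversal T10 rkI uE.
case Ry: (R y); last by rewrite Ry.
have /andP[Ey fy] := Ry; rewrite rep_R ?xE // permM.
apply: (rep_uniq uE tB); rewrite ?xE' ?xE //.
  by apply: (repP tB); rewrite xE' (E_porbit uE (rep_porbit _ _ _)) xE.
have := porbit_shift ux' (rep_porbit u (first rk u) (x y)).
rewrite -eq_porbit_mem => /eqP <-; exact: rep_porbit.
Qed.
End Rank.

(** The points counted correspond to the orbits of the group generated by [u] and [x],
    whichever rank is used. *)
Lemma card_orbit_first_rk rk rk' (x : {perm T}) : {in E &, injective rk} ->
  {in E &, injective rk'} -> commute u x -> (forall y, E (x y) = E y) ->
  #|[pred y | E y && orbit_first rk u x y]| = #|[pred y | E y && orbit_first rk' u x y]|.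
Proof.
move=> rkI rkI' ux xE.
pose O (y : T) := [set z | [exists i : 'I_#|[set: {perm T}]|.+1, z \in porbit u ((x ^+ i)%g y)]].
have OP y z : reflect (exists i, z \in porbit u ((x ^+ i)%g y)) (z \in O y).
  rewrite inE; apply: (iffP existsP) => [[i iz]|[i iz]]; first by exists i.
  have lt : i %% #[x]%g < #|[set: {perm T}]|.+1.
    by rewrite ltnS ltnW // (leq_trans (ltn_pmod _ (order_gt0 x))) // subset_leq_card // subsetT.
  by exists (Ordinal lt); rewrite /= expg_mod_order.
have OE y z : z \in O y -> E z = E y by case/OP=> i /(E_porbit uE) ->; exact: E_pow.
have Oyy y : y \in O y by apply/OP; exists 0; rewrite expg0 perm1 porbit_id.
have Otrans y z w : z \in O y -> w \in O z -> w \in O y.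
  case/OP=> i zi /OP[j wj]; apply/OP; exists (i + j).
  have := porbit_shift (commuteX j ux) zi; rewrite -permM -expgD -eq_porbit_mem => /eqP <-.
  by [].
have Osym y z : z \in O y -> y \in O z.
  case/OP=> i zi; apply/OP; exists (#[x]%g * i - i).
  have := porbit_shift (commuteX (#[x]%g * i - i) ux) zi.
  rewrite -permM -expgD subnKC ?leq_pmull // expgM expg_order expg1n perm1.
  by rewrite porbit_sym.
suff cardO r : {in E &, injective r} -> #|[pred y | E y && orbit_first r u x y]| = #|O @: E|.
  by rewrite !cardO.
move=> rI; rewrite -(@card_in_imset _ _ O [pred y | E y && orbit_first r u x y]); last first.
  move=> y z /andP[Ey /(orbit_firstP T10) fy] /andP[Ez /(orbit_firstP T10) fz] yz.
  apply: rI => //; apply/eqP; rewrite eqn_leq.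
  have /OP[i yi] : y \in O z by rewrite -yz.
  have /OP[j zj] : z \in O y by rewrite yz.
  by rewrite (fy j) // (fz i).
apply: eq_card => A; apply/imsetP/imsetP => [] [y].
  by move=> /andP[Ey _] ->; exists y.
move=> Ey ->; have [z zy zmin] := @arg_minnP _ y (fun z => z \in O y) r (Oyy y).
exists z.
  have Ez : E z by rewrite (OE y).
  rewrite inE /=; apply/andP; split=> //; apply/(orbit_firstP T10) => j w wj.
  by apply: zmin; apply: Otrans zy _; apply/OP; exists j.
apply/setP=> w; apply/idP/idP => [wy | wz]; last exact: Otrans zy wz.
exact: Otrans (Osym _ _ zy) wy.
Qed.

Lemma card_first_rk rk rk' : {in E &, injective rk} -> {in E &, injective rk'} ->
  #|[pred y | E y && first rk u y]| = #|[pred y | E y && first rk' u y]|.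
Proof.
move=> rI rI'; have F r : [pred y | E y && first r u y] =i [pred y | E y && orbit_first r u
  (1%g : {perm T}) y].
  move=> y; rewrite !inE; congr (_ && _); apply/(firstP T10)/(orbit_firstP T10) => H.
    by move=> i z; rewrite expg1n perm1; exact: H.
  by move=> z zy; apply: (H 0); rewrite expg1n perm1.
rewrite !(eq_card (F _)); apply: card_orbit_first_rk => //; first exact: commute1.
by move=> y; rewrite perm1.
Qed.
End Swap.

(** * The character attached to a pair of permutations *)

Section Verdict.
Variables (T : finType) (T10 : #|T| <= 10).
Implicit Types (u a x p : {perm T}) (y z : T).
Local Notation "[ 'comp' u , a , y ]" := (component eq_op [:: u : T -> T; a : T -> T] y).

Lemma perm_verdict m (u a : T -> T) Z Z' : perm_eq Z Z' ->
  verdict eq_op m u a Z = verdict eq_op m u a Z'.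
Proof.
move=> ZZ; have hE P : has P Z = has P Z' by exact: perm_has.
have aE P : all P Z = all P Z' by exact: perm_all.
have cE P : count P Z = count P Z' by apply/seq.permP.
by rewrite /verdict /select2 /select3 (perm_size ZZ) !aE !hE !cE.
Qed.

Lemma connect_iter (e : rel T) (p : T -> T) i y : (forall z, e z (p z)) ->
  connect e y (iter i p y).
Proof.
move=> ep; elim: i => [|i IHi] //=.
exact: connect_trans IHi (connect1 (ep _)).
Qed.

Lemma perm_component u a y (f : {perm T}) : f = u \/ f = a ->
  perm_eq [comp u, a, f y] [comp u, a, y].
Proof.
move=> fua; apply: uniq_perm => [||z]; rewrite ?component_uniq ?component_connect //.
set e : rel T := grel _; have ef w : e w (f w).
  by rewrite /e /= !inE; case: fua => ->; rewrite eqxx ?orbT.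
apply/idP/idP => [fyz|yz]; first by apply: (@connect_trans _ e (f y)) fyz; apply: connect1;
  exact: ef.
apply: connect_trans yz; have := @connect_iter e f (len eq_op f y).-1 (f y) ef.
by rewrite -iterSr iter_len.
Qed.

Lemma carries_perm x p : commute x p -> carries x predT p p.
Proof. by move=> xp y _; split=> //; rewrite -!permM xp. Qed.

Lemma perm_eqE x y z : (x y == x z) = (y == z).
Proof. exact: inj_eq (@perm_inj _ x) y z. Qed.

(** The group generated by [u] and [a], and its centralizer, preserve the choice made
    by [verdict]. *)
Lemma verdict_component m u a (f : {perm T}) y :
  f = u \/ f = a \/ (commute f u /\ commute f a) ->
  verdict eq_op m u a [comp u, a, f y] = verdict eq_op m u a [comp u, a, y].
Proof.
case=> [fu|[fa|[fu fa]]].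
- by apply: perm_verdict; apply: perm_component; left.
- by apply: perm_verdict; apply: perm_component; right.
have eE : forall y z, predT y -> predT z -> (f y == f z) = (y == z).
  by move=> ? ? _ _; exact: perm_eqE.
have cu := carries_perm fu; have ca := carries_perm fa.
have [//|i|E _] := @component_carries _ _ _ _ f predT eE [:: u : T -> T;
  a : T -> T] [:: u : T -> T; a : T -> T] y _ _ isT.
  by case: i => [|[|i]].
by rewrite E (verdict_carries eE m cu ca) //; apply/allP.
Qed.

Lemma all_iterates_perm (P : pred T) p y : all P (iterates p (p y)) = all P (iterates p y).
Proof.
apply: eq_all_r => z; rewrite !mem_iterates //.
by have := mem_porbit p 1 y; rewrite expg1 -eq_porbit_mem => /eqP ->.
Qed.

Lemma selected_perm (u : T -> T) p c y : selected eq_op u p c (p y) = selected eq_op u p c y.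
Proof.
have lp : len eq_op p (p y) = len eq_op p y.
  by apply: len_porbit_mem => //; exact: (mem_porbit p 1 y).
by case: c => [||d||]; rewrite /selected ?lp // /fixed_before all_iterates_perm.
Qed.

Lemma selected_commute u p c x y : commute x u -> commute x p ->
  selected eq_op u p c (x y) = selected eq_op u p c y.
Proof.
move=> xu xp; apply: (@selected_carries _ _ _ _ x predT) => //.
- by move=> ? ? _ _; exact: perm_eqE.
- exact: carries_perm.
exact: carries_perm.
Qed.

Lemma selected_ext (u p p' : T -> T) c y : p =1 p' ->
  selected eq_op u p c y = selected eq_op u p' c y.
Proof.
move=> pp; apply/esym/(@selected_carries _ _ _ _ id predT) => //; exact: eq_carries.
Qed.

Lemma rot_at_ext rk (p p' x : T -> T) y : p =1 p' ->
  rot_at eq_op rk p x y = rot_at eq_op rk p' x y.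
Proof.
move=> pp; apply/esym/(@rot_at_carries _ _ _ _ _ _ id predT) => //; exact: eq_carries.
Qed.
End Verdict.

Section Lambda.
Variables (T : finType) (T10 : #|T| <= 10) (N H : nat).
Hypotheses (NE : N = 2520) (HE : H = nat_of_bin (frac 2)).
Implicit Types (D : {set T}) (u a x : {perm T}) (rk : T -> nat).

Definition total_exponent m D rk (u a x : T -> T) : nat :=
  \sum_(y in D) nat_of_bin (exponent_at eq_op rk m u a x y).

Definition stable D (f : T -> T) := forall y, (f y \in D) = (y \in D).

Lemma half_turnN : H * 2 = N.
Proof. by rewrite HE NE mulnC frac_len. Qed.

Lemma half_turn_odd k l : odd k = odd l -> H * k = H * l %[mod N].
Proof.
move=> kl; rewrite -(odd_double_half k) -(odd_double_half l) kl !mulnDr -!muln2.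
rewrite !(mulnCA H _ 2) half_turnN [in LHS]addnC [in RHS]addnC.
by rewrite !modnMDl.
Qed.

(** The three sets of points on which [total_exponent] sums are stable under the relevant
    permutation and under the common centralizer, so that the homomorphism properties
    of rotations and signs apply to each part. *)
Section Fixed.
Variables (m : nat) (D : {set T}) (u a : {perm T}).
Hypotheses (Du : stable D u) (Da : stable D a).

Let V y := verdict eq_op m u a (component eq_op [:: u : T -> T; a : T -> T] y).
Let Ea y := (y \in D) && selected eq_op u a (V y).1.1 y.
Let Eb y := (y \in D) && selected eq_op u (a * u)%g (V y).1.2 y.
Let Es y := (y \in D) && (V y).2.

Let Vf (f : {perm T}) y : f = u \/ f = a \/ (commute f u /\ commute f a) -> V (f y) = V y.
Proof. exact: verdict_component. Qed.

Let Eaa y : Ea (a y) = Ea y.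
Proof.
have Va : V (a y) = V y by apply: Vf; right; left.
by rewrite /Ea Da Va; congr (_ && _); exact: selected_perm.
Qed.
Let Ebb y : Eb ((a * u)%g y) = Eb y.
Proof.
have Vb : V ((a * u)%g y) = V y.
  by rewrite permM (Vf (f := u)) ?(Vf (f := a)) //; [right; left | left].
by rewrite /Eb Vb permM Du Da -permM; congr (_ && _); exact: selected_perm.
Qed.
Let Esu y : Es (u y) = Es y.
Proof. by rewrite /Es Du Vf //; left. Qed.

Let Eax x y : stable D x -> commute x u -> commute x a -> Ea (x y) = Ea y.
Proof. by move=> Dx xu xa; rewrite /Ea Dx Vf ?selected_commute //; right; right. Qed.
Let Ebx x y : stable D x -> commute x u -> commute x a -> Eb (x y) = Eb y.
Proof.
move=> Dx xu xa; rewrite /Eb Dx Vf ?selected_commute //; last by right; right.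
exact: commuteM.
Qed.
Let Esx x y : stable D x -> commute x u -> commute x a -> Es (x y) = Es y.
Proof. by move=> Dx xu xa; rewrite /Es Dx Vf //; right; right. Qed.

Let sub_inj rk (E : pred T) : {in D &, injective rk} -> (forall y, E y -> y \in D) ->
  {in E &, injective rk}.
Proof. by move=> rI ED y z /ED Dy /ED Dz; exact: rI. Qed.
Let EaD y : Ea y -> y \in D. Proof. by case/andP. Qed.
Let EbD y : Eb y -> y \in D. Proof. by case/andP. Qed.
Let EsD y : Es y -> y \in D. Proof. by case/andP. Qed.

(** Here [H] is half a turn. *)
Lemma exponentE rk x : total_exponent m D rk u a x =
  \sum_(y | Ea y) nat_of_bin (rot_at eq_op rk a x y) +
  \sum_(y | Eb y) nat_of_bin (rot_at eq_op rk (a * u)%g x y) +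
  H * (#|[pred y | Es y && first rk u y]| + #|[pred y | Es y && orbit_first rk u x y]|).
Proof.
have sE (Q : pred T) : H * #|[pred y | Es y && Q y]| =
    \sum_(y in D) (if (V y).2 && Q y then nat_of_bin (frac 2) else 0).
  rewrite HE -sum1_card big_distrr /= -big_mkcondr /=; apply: eq_big => [y|y _];
    last exact: muln1.
  by rewrite !inE /Es andbA.
have cE (Q : pred T) (F : T -> nat) :
    \sum_(y | (y \in D) && Q y) F y = \sum_(y in D) (if Q y then F y else 0).
  by rewrite big_mkcondr.
rewrite mulnDr !sE /Ea /Eb !cE -!big_split /=; apply: eq_bigr => y _;
  rewrite /exponent_at -/(V y).
case: (V y) => [[ca cb] s] /=; rewrite !nat_of_bin_add.
have abE : (fun z => u (a z)) =1 (a * u)%g by move=> z; rewrite permM.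
rewrite (selected_ext _ _ _ abE) (rot_at_ext _ _ _ abE).
rewrite -addnA; congr (_ + (_ + _)); try by case: ifP.
case: s => //=; rewrite /swap_at nat_of_bin_add; congr (_ + _); case: ifP => //.
Qed.

Lemma exponentM rk x x' : {in D &, injective rk} ->
  stable D x -> commute x u -> commute x a ->
  stable D x' -> commute x' u -> commute x' a ->
  total_exponent m D rk u a (x * x')%g =
    total_exponent m D rk u a x + total_exponent m D rk u a x' %[mod N].
Proof.
move=> rkI Dx xu xa Dx' xu' xa'.
have xb : commute (a * u)%g x by apply/commute_sym/commuteM.
have xb' : commute (a * u)%g x' by apply/commute_sym/commuteM.
rewrite !exponentE [in RHS]addnACA [X in _ = X + _ %[mod _]]addnACA -mulnDr.
rewrite -modnDm -[in RHS]modnDm; congr ((_ + _) %% _)%N; last first.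
  apply: half_turn_odd; rewrite !oddD.
  exact: (odd_swapM T10 Esu (sub_inj rkI EsD) (commute_sym xu) (commute_sym xu')
    (fun y => Esx y Dx xu xa) (fun y => Esx y Dx' xu' xa')).
have M (p : {perm T}) (E : pred T) : commute p x -> commute p x' ->
    (forall y, E y -> y \in D) ->
    (forall y, E (p y) = E y) -> (forall y, E (x y) = E y) -> (forall y, E (x' y) = E y) ->
    \sum_(y | E y) nat_of_bin (rot_at eq_op rk p (x * x')%g y) =
    \sum_(y | E y) nat_of_bin (rot_at eq_op rk p x y) +
    \sum_(y | E y) nat_of_bin (rot_at eq_op rk p x' y) %[mod N].
  move=> px px' ED pE xE xE'.
  apply/eqP.
  rewrite -(natr_modN NE).
  rewrite [X in _ == X]natrD [X in X == _]natr_sum.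
  rewrite [X in (_ == X + _)%R]natr_sum [X in (_ == _ + X)%R]natr_sum; apply/eqP.
  exact: (sum_rot_atM T10 NE (sub_inj rkI ED) px px' pE xE xE').
rewrite -modnDm M ?(commute_sym xa) ?(commute_sym xa') //; last 2 first.
- by move=> y; exact: Eax.
- by move=> y; exact: Eax.
rewrite (M (a * u)%g) ?modnDm //.
- by move=> y; exact: Ebx.
by move=> y; exact: Ebx.
Qed.

Lemma exponent_rk rk rk' x : {in D &, injective rk} -> {in D &, injective rk'} ->
  stable D x -> commute x u -> commute x a ->
  total_exponent m D rk u a x = total_exponent m D rk' u a x %[mod N].
Proof.
move=> rkI rkI' Dx xu xa.
have xb : commute (a * u)%g x by apply/commute_sym/commuteM.
have ux := commute_sym xu; have ax := commute_sym xa.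
have I := sub_inj rkI; have I' := sub_inj rkI'.
have M (p : {perm T}) (E : pred T) : commute p x -> (forall y, E y -> y \in D) ->
    (forall y, E (p y) = E y) -> (forall y, E (x y) = E y) ->
    \sum_(y | E y) nat_of_bin (rot_at eq_op rk p x y) =
    \sum_(y | E y) nat_of_bin (rot_at eq_op rk' p x y) %[mod N].
  move=> px ED pE xE.
  apply/eqP.
  rewrite -(natr_modN NE).
  rewrite [X in X == _]natr_sum [X in _ == X]natr_sum; apply/eqP.
  exact: (sum_rot_at_rk T10 NE (I _ ED) (I' _ ED) px pE xE).
rewrite !exponentE (card_first_rk T10 Esu (I _ EsD) (I' _ EsD)).
rewrite (card_orbit_first_rk T10 Esu (I _ EsD) (I' _ EsD) ux); last by move=> y; exact: Esx.
rewrite -modnDml -[in RHS]modnDml; congr ((_ + _) %% _)%N.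
rewrite -modnDm M // ?(M (a * u)%g) ?modnDm //; first by move=> y; exact: Ebx.
by move=> y; exact: Eax.
Qed.
End Fixed.

Lemma exponent1 m D rk (u a : {perm T}) : {in D &, injective rk} -> stable D u -> stable D a ->
  total_exponent m D rk u a (1%g : {perm T}) = 0 %[mod N].
Proof.
move=> rkI Du Da; have D1 : stable D (1%g : {perm T}) by move=> y; rewrite perm1.
have c1 b : commute (1%g : {perm T}) b by exact/commute_sym/commute1.
have /eqP := exponentM m Du Da rkI D1 (c1 u) (c1 a) D1 (c1 u) (c1 a).
by rewrite mulg1 -[X in X == _ %[mod _]]addn0 eqn_modDl eq_sym => /eqP.
Qed.

(** The rank is transported too; it can be changed back by [exponent_rk]. *)
Lemma exponent_conj m D rk (u a x g : {perm T}) :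
  total_exponent m (g @: D) (rk \o g^-1%g) (u ^ g)%g (a ^ g)%g (x ^ g)%g =
    total_exponent m D rk u a x.
Proof.
rewrite /total_exponent big_imset /=; last by move=> y z _ _; exact: perm_inj.
apply: eq_bigr => y _; congr nat_of_bin.
have cg (p : {perm T}) : carries g predT p (p ^ g)%g by move=> z _; rewrite permJ.
apply: (@exponent_at_carries _ _ _ _ _ _ g predT) => //; try exact: cg.
- by move=> ? ? _ _; exact: perm_eqE.
by move=> ? ? _ _ /=; rewrite !permK.
Qed.
End Lambda.

(** * Splitting sums along orbits *)

Local Open Scope ring_scope.

Section Orbits.
Variables (T : finType) (T10 : (#|T| <= 10)%N).
Implicit Types (y z : T) (gs : seq {perm T}).
Let E gs : rel T := grel (fun w => [seq (f : {perm T}) w | f <- gs]).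

Definition orbit_of gs y : {set T} := [set z | connect (E gs) y z].

Lemma orbit_of_step gs (f : {perm T}) y : f \in gs -> f y \in orbit_of gs y.
Proof. by move=> fgs; rewrite inE connect1 //; apply: map_f. Qed.

(** On a finite set, inverses are iterates. *)
Lemma orbit_of_connect_sym gs : connect_sym (E gs).
Proof.
suff back y z : connect (E gs) y z -> connect (E gs) z y.
  by move=> y z; apply/idP/idP; exact: back.
case/connectP=> p; elim: p y => [|w p IHp] y /=; first by move=> _ ->.
case/andP=> /mapP[f fgs ->] /IHp {}IHp /IHp zf; apply: connect_trans zf _.
have ef v : E gs v (f v) by exact: map_f.
by have := connect_iter (len eq_op f y).-1 (f y) ef; rewrite -iterSr iter_len.
Qed.

Lemma orbit_of_refl gs y : y \in orbit_of gs y. Proof. by rewrite inE. Qed.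

Lemma orbit_of_eq gs y z : z \in orbit_of gs y -> orbit_of gs z = orbit_of gs y.
Proof.
rewrite inE => yz; apply/setP=> w; rewrite !inE.
by apply/esym/(same_connect (@orbit_of_connect_sym gs)).
Qed.

Lemma orbit_of_stable gs (f : {perm T}) y : f \in gs -> stable (orbit_of gs y) f.
Proof.
move=> fgs z; apply/idP/idP => Hz; rewrite -(orbit_of_eq Hz); last exact: orbit_of_step.
by rewrite inE orbit_of_connect_sym -[connect _ _ _]inE; have := orbit_of_step z fgs; rewrite inE.
Qed.

Lemma orbit_of_min (gs : seq {perm T}) y (D : {set T}) : y \in D ->
  (forall f : {perm T}, f \in gs -> stable D f) ->
  orbit_of gs y \subset D.
Proof.
move=> yD Df; apply/subsetP=> z; rewrite inE => /connectP[p].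
elim: p y yD => [|w p IHp] y yD /=; first by move=> _ ->.
by case/andP=> /mapP[f fgs ->]; apply: IHp; rewrite Df.
Qed.
End Orbits.

Section Peel.
Variables (T : finType) (T10 : (#|T| <= 10)%N) (R : comNzRingType) (u x : {perm T}).
Implicit Types (a : {perm T}) (y : T) (D K : {set T}).

(** The values of [phi a] on a set stable under [u], [x] and [a] depend on the values
    of [a] on this set only. *)
Definition local (phi : {perm T} -> T -> R) := forall K a a',
  stable K u -> stable K x -> stable K a -> {in K, a =1 a'} -> {in K, phi a =1 phi a'}.

Definition total (phi : {perm T} -> T -> R) D : R :=
  \sum_(a | perm_on D a && (a \in 'C[x])%g) \prod_(y in D) phi a y.
(** The part of [total phi K] from the [a] that are transitive on [K] together with [u]
    and [x]; [y] is a point of [K]. *)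
Definition connected_total (phi : {perm T} -> T -> R) K y : R :=
  \sum_(a | [&& perm_on K a, (a \in 'C[x])%g & orbit_of [:: u; a; x] y == K])
     \prod_(z in K) phi a z.

Definition stableb D (f : {perm T}) := [forall y, (f y \in D) == (y \in D)].
Lemma stableP D (f : {perm T}) : reflect (stable D f) (stableb D f).
Proof. exact: (iffP 'forall_eqP). Qed.

Lemma perm_on_stable D K a : perm_on D a -> D \subset K -> stable K a.
Proof.
move=> Da DK y; have Ka : perm_on K a by apply: subset_trans DK.
exact: perm_closed.
Qed.

Lemma perm_on_stableD D K a : perm_on D a -> stable K a -> stable (D :\: K) a.
Proof. by move=> Da Ka y; rewrite !inE Ka (perm_closed _ Da). Qed.

Lemma stable_astabs K a : stable K a -> a \in 'N(K | 'P)%g.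
Proof. by move=> Ka; rewrite !inE; apply/subsetP => y yK; rewrite !inE /= apermE Ka. Qed.

Lemma restr_permC K a : stable K x -> stable K a -> (a \in 'C[x])%g ->
  (restr_perm K a \in 'C[x])%g.
Proof.
move=> Kx /stable_astabs Ka /cent1P ax; apply/cent1P/permP=> y; rewrite !permM.
have [yK | nyK] := boolP (y \in K).
  by rewrite !restr_permE ?Kx // -!permM ax.
by rewrite !(out_perm (restr_perm_on K a)) ?Kx.
Qed.

Lemma orbit_of_ext y a a' : {in orbit_of [:: u; a; x] y, a =1 a'} ->
  orbit_of [:: u; a'; x] y = orbit_of [:: u; a; x] y.
Proof.
set K := orbit_of _ y => aa.
have Kf (f : {perm T}) : f \in [:: u; a; x] -> stable K f by exact: orbit_of_stable.
apply/eqP; rewrite eqEsubset; apply/andP; split.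
  apply: orbit_of_min; first exact: orbit_of_refl.
  move=> f; rewrite !inE => /or3P[] /eqP->; try by apply: Kf; rewrite !inE eqxx ?orbT.
  have Ka : stable K a by apply: Kf; rewrite !inE eqxx ?orbT.
  have aK' z : z \in K -> a' z \in K by move=> zK; rewrite -aa // Ka.
  move=> z; apply/idP/idP => [azK|]; last exact: aK'.
  have : a^-1%g (a' z) \in K by rewrite -Ka permKV.
  by move/[dup]=> wK /aa; rewrite permKV => /perm_inj ->.
set K' := orbit_of _ y.
suff: K \subset K :&: K' by rewrite subsetI => /andP[].
apply: orbit_of_min; first by rewrite inE !orbit_of_refl.
have K'f (f : {perm T}) : f \in [:: u; a'; x] -> stable K' f by exact: orbit_of_stable.
move=> f fgs z; rewrite !in_setI Kf //; case zK: (z \in K) => //=.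
have /or3P[] : [|| f == u, f == a | f == x] by move: fgs; rewrite !inE.
- by move/eqP->; rewrite K'f ?inE ?eqxx.
- by move/eqP->; rewrite aa // K'f ?inE ?eqxx ?orbT.
by move/eqP->; rewrite K'f ?inE ?eqxx ?orbT.
Qed.

(** Let [K] be the orbit of [y] under [u], [a] and [x]: then [a] is the product of its
    restrictions to [K] and to the complement of [K], which are independent of each
    other. *)
Lemma peel phi D y : local phi -> stable D u -> stable D x -> y \in D ->
  total phi D = \sum_(K : {set T} | [&& K \subset D, stableb K u, stableb K x & y \in K])
     connected_total phi K y * total phi (D :\: K).
Proof.
move=> phiL Du Dx yD; rewrite /total.
rewrite (partition_big (fun a => orbit_of [:: u; a; x] y)
  (fun K => [&& K \subset D, stableb K u, stableb K x & y \in K])) /=; last first.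
  move=> a /andP[Da _]; rewrite orbit_of_refl andbT; apply/and3P; split.
  - apply: orbit_of_min => // f; rewrite !inE => /or3P[] /eqP-> //.
    try exact: perm_on_stable Da (subxx D).
  - by apply/stableP/orbit_of_stable; rewrite ?inE ?eqxx.
  by apply/stableP/orbit_of_stable; rewrite ?inE ?eqxx ?orbT.
apply: eq_bigr => K /and4P[KD /stableP Ku /stableP Kx yK].
rewrite /connected_total big_distrl /=.
under [RHS]eq_bigr do rewrite big_distrr /=.
rewrite pair_big /=.
rewrite (reindex_onto (fun p : {perm T} * {perm T} => (p.1 * p.2)%g)
   (fun a => (restr_perm K a, restr_perm (D :\: K) a))) /=; last first.
  move=> a /andP[/andP[Da ax] /eqP aK]; apply/permP=> z; rewrite permM.
  have Ka : stable K a by rewrite -aK; apply: orbit_of_stable; rewrite ?inE ?eqxx ?orbT.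
  have Na := stable_astabs Ka; have Nb := stable_astabs (perm_on_stableD Da Ka).
  have [zK | nzK] := boolP (z \in K).
    rewrite (restr_permE Na) // (out_perm (restr_perm_on _ _)) //.
    by rewrite !inE Ka zK.
  rewrite (out_perm (restr_perm_on K a)) //.
  have [zD | nzD] := boolP (z \in D); first by rewrite (restr_permE Nb) // !inE nzK.
  by rewrite (out_perm (restr_perm_on _ _)) ?(out_perm Da) // !inE (negPf nzD) andbF.
have split_on a1 a2 : perm_on K a1 -> perm_on (D :\: K) a2 ->
    {in K, a1 =1 (a1 * a2)%g} /\ {in D :\: K, a2 =1 (a1 * a2)%g}.
  move=> K1 K2; split=> z zK; rewrite permM.
    by rewrite (out_perm K2) // !inE (perm_closed _ K1) zK.
  by rewrite (out_perm K1) //; move: zK; rewrite !inE => /andP[].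
apply: eq_big => [[a1 a2]|[a1 a2]] /=.
  apply/andP/andP => [[/andP[/andP[Da ax] /eqP aK] /eqP[e1 e2]]|].
    have Ka : stable K (a1 * a2)%g by rewrite -aK; apply: orbit_of_stable;
      rewrite ?inE ?eqxx ?orbT.
    have P1 : perm_on K a1 by rewrite -e1 restr_perm_on.
    have P2 : perm_on (D :\: K) a2 by rewrite -e2 restr_perm_on.
    have [E1 _] := split_on _ _ P1 P2.
    split; last first.
      rewrite P2 -e2 restr_permC //; last exact: perm_on_stableD.
      by move=> z; rewrite !inE Kx Dx.
    rewrite P1 -e1 restr_permC //= e1; apply/eqP; rewrite -[RHS]aK; apply: orbit_of_ext.
    by rewrite aK => z /E1 ->.
  case=> /and3P[P1 c1 /eqP o1] /andP[P2 c2].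
  have [E1 E2] := split_on _ _ P1 P2.
  have Da : perm_on D (a1 * a2)%g.
    apply: perm_onM; first exact: subset_trans P1 KD.
    by apply: subset_trans P2 _; exact: subsetDl.
  have Ka : stable K (a1 * a2)%g.
    move=> z; rewrite permM; have [zK|nzK] := boolP (z \in K).
      by rewrite (out_perm P2) ?(perm_closed _ P1) // !inE (perm_closed _ P1) zK.
    rewrite (out_perm P1) //; have [zD|nzD] := boolP (z \in D).
      have := perm_closed z P2; rewrite !inE nzK zD /= => /andP[/negPf-> //].
    by rewrite (out_perm P2) ?(negPf nzK) // !inE (negPf nzD) andbF.
  split; first rewrite Da groupM //=; first (apply/eqP; rewrite -[RHS]o1; apply: orbit_of_ext).
    by rewrite o1; exact: E1.
  apply/eqP; congr (_, _); apply/permP=> z.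
    have [zK|nzK] := boolP (z \in K).
      by rewrite (restr_permE (stable_astabs Ka)) // E1.
    by rewrite (out_perm P1) // (out_perm (restr_perm_on K _)).
  have [zK|nzK] := boolP (z \in D :\: K).
    by rewrite (restr_permE (stable_astabs (perm_on_stableD Da Ka))) // E2.
  by rewrite (out_perm P2) // (out_perm (restr_perm_on _ _)).
move=> /andP[/andP[/andP[Da ax] /eqP aK] /eqP[e1 e2]].
have Ka : stable K (a1 * a2)%g by rewrite -aK; apply: orbit_of_stable; rewrite ?inE ?eqxx ?orbT.
have P1 : perm_on K a1 by rewrite -e1 restr_perm_on.
have P2 : perm_on (D :\: K) a2 by rewrite -e2 restr_perm_on.
have [E1 E2] := split_on _ _ P1 P2.
rewrite (big_setID K) /= (setIidPr KD); congr (_ * _); apply: eq_bigr => z zK.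
  by apply/esym/(phiL K) => //; exact: perm_on_stable P1 _.
apply/esym/(phiL (D :\: K)) => //.
- by move=> w; rewrite !inE Ku Du.
- by move=> w; rewrite !inE Kx Dx.
exact: perm_on_stable P2 _.
Qed.

Lemma eq_total phi psi D : local phi -> local psi -> stable D u -> stable D x ->
  (forall K y, stable K u -> stable K x -> y \in K ->
     connected_total phi K y = connected_total psi K y) ->
  total phi D = total psi D.
Proof.
move=> Lphi Lpsi + + eC; have [n] := ubnP #|D|; elim: n D => // n IHn D ltn Du Dx.
have [->|[y yD]] := set_0Vmem D.
  by apply: eq_bigr => a _; rewrite !big_set0.
rewrite !(peel _ Du Dx yD) //; apply: eq_bigr => K /and4P[KD /stableP Ku /stableP Kx yK].
rewrite eC // IHn //; last 2 first.
- by move=> w; rewrite !inE Ku Du.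
- by move=> w; rewrite !inE Kx Dx.
rewrite ltnS in ltn; apply: leq_trans ltn; apply: proper_card.
apply/properP; split; first exact: subsetDl.
by exists y => //; rewrite !inE yK.
Qed.
End Peel.

Local Close Scope ring_scope.

(** * A finite model *)

(** An enumerated type makes the model cheap to evaluate. *)
Inductive pt := p0|p1|p2|p3|p4|p5|p6|p7|p8|p9.
Definition pt_nat p :=
  match p with p0=>0|p1=>1|p2=>2|p3=>3|p4=>4|p5=>5|p6=>6|p7=>7|p8=>8|p9=>9 end.
Definition pts := [:: p0;p1;p2;p3;p4;p5;p6;p7;p8;p9].
Definition pt_eqb p q := match p, q with
 p0,p0|p1,p1|p2,p2|p3,p3|p4,p4|p5,p5|p6,p6|p7,p7|p8,p8|p9,p9 => true | _,_ => false end.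
Lemma pt_eqP : Equality.axiom pt_eqb. Proof. by do 2!case; constructor. Qed.
HB.instance Definition _ := hasDecEq.Build pt pt_eqP.

(** A word [s] stands for the function that maps the [i]-th point to the [i]-th entry
    of [s]. *)
Definition app (s : seq pt) p := nth p0 s (pt_nat p).
Definition dom k := take k pts.

Definition turn : BinNums.N := Eval vm_compute in bin_of_nat 2520.
Definition sixteen : BinNums.N := Eval vm_compute in bin_of_nat 16.

Section Model.
Variables l j : nat.
Let k := l * j.
(** The standard permutation with [j] cycles of length [l], on consecutive points. *)
Definition shift : seq pt := [seq nth p0 pts (y %/ l * l + (y %% l).+1 %% l) | y <- iota 0 k].
Definition heads : seq pt := [seq nth p0 pts (i * l) | i <- iota 0 j].
Fixpoint tuples (D : seq pt) j :=
  if j is j'.+1 then [seq v :: s | v <- D, s <- tuples D j'] else [:: [::]].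
(** A permutation commuting with [shift] is determined by the images [vs] of the points
    of [heads], one in each cycle of [shift]. *)
Definition expand (vs : seq pt) := flatten [seq traject (app shift) v l | v <- vs].
Definition words := [seq s <- [seq expand vs | vs <- tuples (dom k) j] | uniq s].

Definition unapp (g : seq pt) p := nth p0 pts (find (pt_eqb p) g).
(** The conjugate [g^-1 u g], as functions; [code] orders the words, so that a minimal
    word represents its conjugacy class under the centralizer of [shift]. *)
Definition conj_word g u := [seq unapp g (app u (app g q)) | q <- dom k].
Definition code (s : seq pt) :=
  foldl (fun acc p => BinNat.N.add (BinNat.N.mul sixteen acc) (bin_of_nat (pt_nat p)))
    BinNums.N0 s.
Definition minimal P u := ~~ has (fun g => BinNat.N.ltb (code (conj_word g u)) (code u)) P.

Definition transitive_word u a :=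
  size (component pt_eqb [:: app u; app a; app shift] p0) == k.
Definition exponent_word m u a :=
  foldr BinNat.N.add BinNums.N0 [seq exponent_at pt_eqb pt_nat m (app u) (app a) (app shift) y
    | y <- dom k].

(** The torsion and root conditions, and [exponent_at], depend on [m] modulo [L] only:
    the cycle lengths divide [L], and [verdict] looks at [m] modulo 8 on orbits of size
    4 and 8, and modulo 9 on orbits of size 9. *)
Definition periodic L u a := all (fun y =>
  let b z := app u (app a z) in let s := size (component pt_eqb [:: app u; app a] y) in
  [&& L %% len pt_eqb (app a) y == 0, L %% len pt_eqb b y == 0,
      ((s == 4) || (s == 8)) ==> (L %% 8 == 0) & (s == 9) ==> (L %% 9 == 0)]) (dom k).

(** The cycle lengths at each point, and the positions of its image by [shift] in its
    cycles: all that the torsion and root conditions need, whatever [m] is. *)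
Definition lengths u a := [seq
  let x := app shift in let b z := app u (app a z) in
  (len pt_eqb (app a) y, len pt_eqb b y, (hit (pt_eqb (x y)) (app a) y, hit (pt_eqb (x y)) b y))
  | y <- dom k].
Definition torsion_row m (d : seq (nat * nat * (nat * nat))) :=
  all (fun t => (m %% t.1.1 == 0) && (m %% t.1.2 == 0)) d.
Definition root_row m (d : seq (nat * nat * (nat * nat))) :=
  all (fun t => (m %% t.1.1 == t.2.1) && (m %% t.1.2 == t.2.2)) d.

(** [e] as a multiple of the [l]-th part of a turn; [l] if it is not a multiple. *)
Definition residue (e : BinNums.N) :=
  find (fun r => BinNat.N.eqb (BinNat.N.modulo e turn) (BinNat.N.mul (bin_of_nat r) (frac l)))
    (iota 0 l).

(** A sufficient condition for the sum of [c r *: z ^+ r] to be [K], for a primitive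
    [l]-th root of unity [z].  With [d r] the coefficient of [z ^+ r] in the difference
    and, for even [l], with [z ^+ r] and [z ^+ (r + l./2)] merged into one term, the
    coefficients have period [t], where [z ^+ t] is not 1.  Pairs of natural numbers
    stand for differences. *)
Definition balanced K (c : nat -> nat) :=
  let d r := (c (r %% l), if r %% l == 0 then K else 0) in
  let p r := if odd l then d r else
    ((d r).1 + (d (r + l./2)).2, (d r).2 + (d (r + l./2)).1) in
  let t := if l == 9 then 3 else if (l == 6) || (l == 10) then 2 else 1 in
  all (fun r => (p r).1 + (p (r + t)).2 == (p (r + t)).1 + (p r).2) (iota 0 l).

(** Identity (1) for the permutations in [rows]. *)
Definition balanced_row (rows : seq (seq pt * seq (nat * nat * (nat * nat)))) u m :=
  let E := [seq residue (exponent_word m u r.1) | r <- rows & torsion_row m r.2] in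
  let K := count (fun r => root_row m r.2) rows in
  all (fun r => r < l) E && balanced K (fun r => count (eq_op r) E).

(** Only minimal words [u], only [a] transitive with [u] and [shift], and only [m]
    below the period [L].  The conditional, rather than an implication, spares the
    other words under call by value. *)
Definition check L :=
  let P := words in
  all (fun u => if ~~ minimal P u then true else
    (let rows := [seq (a, lengths u a) | a <- P & transitive_word u a] in
     all (fun r => periodic L u r.1) rows &&
     all (balanced_row rows u) (iota 0 L))) P.

Definition rot_word a :=
  foldr BinNat.N.add BinNums.N0 [seq rot_at pt_eqb pt_nat (app a) (app shift) y | y <- dom k].
(** For an odd number of transpositions: following [a] by [shift] adds half a turn; the
    rotation vanishes if all cycles of [a] are odd; and some point shows that [shift]
    is no even power of [a], the value 10 of [hit] meaning that [shift] leaves the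
    cycle. *)
Definition check_odd := all (fun a =>
  let x := app shift in
  [&& BinNat.N.eqb (BinNat.N.modulo (rot_word [seq x q | q <- a]) turn)
        (BinNat.N.modulo (BinNat.N.add (rot_word a) (frac 2)) turn),
      all (fun y => odd (len pt_eqb (app a) y)) (dom k) ==>
        BinNat.N.eqb (BinNat.N.modulo (rot_word a) turn) BinNums.N0 &
      has (fun y => let h := hit (pt_eqb (x y)) (app a) y in
        (h == 10) || (~~ odd (len pt_eqb (app a) y) && odd h)) (dom k)]) words.

(** Facts on the model that are quicker to compute, for each cycle type in use, than to
    prove in general. *)
Definition well_formed :=
  [&& 0 < k, k <= 10, dom k == expand heads, all (fun h => h \in dom k) heads,
      all (fun q => (app shift q \in dom k) && (iter l (app shift) q == q)) (dom k) &
      all (fun s => [&& size s == k, all (fun q => q \in dom k) s &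
        all (fun q => app s (app shift q) == app shift (app s q)) (dom k)]) words].
End Model.

(** * The finite checks *)

(** The cycle types [l^j] with [1 < l] and [l * j <= 10], other than [2^1], [2^3] and
    [2^5], each with a period. *)
Definition cases : seq (nat * nat * nat) :=
  [:: (3,1,3); (4,1,24); (5,1,5); (6,1,6); (7,1,7); (8,1,24); (9,1,18); (10,1,10);
      (2,2,24); (3,2,6); (4,2,24); (5,2,10); (3,3,18); (2,4,24)].

Lemma cases_checked : all (fun c => let: (l, j, L) := c in
  if [&& well_formed l j, uniq (words l j) & 0 < L] then check l j L else false) cases.
Proof. vm_cast_no_check (erefl true). Qed.

Lemma odd_cases_checked :
  all (fun j => if well_formed 2 j then check_odd 2 j else false) [:: 1; 3; 5].
Proof. vm_cast_no_check (erefl true). Qed.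

(** * Labelings of a set by the model *)

Section Model.
Variables l j : nat.
Let k := l * j.
Let X := app (shift l j).
Let P := words l j.
Hypothesis wf : well_formed l j.

Lemma k_le10 : k <= 10. Proof. by case/and5P: wf. Qed.
Lemma k_gt0 : 0 < k. Proof. by case/and5P: wf. Qed.
Lemma dom_blocks : dom k = expand l j (heads l j).
Proof. by case/and5P: wf => _ _ /eqP. Qed.
Lemma heads_dom h : h \in heads l j -> h \in dom k.
Proof. by move: h; apply/allP; case/and5P: wf. Qed.
Lemma X_dom q : q \in dom k -> X q \in dom k.
Proof. by case/and5P: wf => _ _ _ _ /andP[/allP H _] /H /andP[]. Qed.
Lemma X_cycle q : q \in dom k -> iter l X q = q.
Proof. by case/and5P: wf => _ _ _ _ /andP[/allP H _] /H /andP[_ /eqP]. Qed.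
Lemma words_size s : s \in P -> size s = k.
Proof. by case/and5P: wf => _ _ _ _ /andP[_ /allP H] /H /and3P[/eqP]. Qed.
Lemma words_dom s q : s \in P -> q \in s -> q \in dom k.
Proof. by case/and5P: wf => _ _ _ _ /andP[_ /allP H] /H /and3P[_ /allP h _]; exact: h. Qed.
Lemma words_comm s q : s \in P -> q \in dom k -> app s (X q) = X (app s q).
Proof.
by case/and5P: wf => _ _ _ _ /andP[_ /allP H] /H /and3P[_ _ /allP h] /h /eqP.
Qed.
Lemma words_uniq s : s \in P -> uniq s.
Proof. by rewrite mem_filter => /andP[]. Qed.

Lemma size_dom : size (dom k) = k.
Proof. by rewrite size_take /=; case: ltngtP k_le10. Qed.
Lemma dom_uniq : uniq (dom k). Proof. by rewrite take_uniq. Qed.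

Lemma pt_nat_inj : injective pt_nat. Proof. by do 2!case. Qed.
Lemma nth_pts q : nth p0 pts (pt_nat q) = q. Proof. by case: q. Qed.
Lemma pt_nat_pts i : i < 10 -> pt_nat (nth p0 pts i) = i.
Proof. by do 10?[case: i => [//|i]]. Qed.

Lemma mem_dom q : (q \in dom k) = (pt_nat q < k).
Proof.
apply/idP/idP => [|qk].
  case/(nthP p0) => i; rewrite size_dom => ik <-; rewrite nth_take //.
  by rewrite pt_nat_pts // (leq_trans ik k_le10).
by rewrite -[q]nth_pts -(nth_take p0 qk) mem_nth // size_dom.
Qed.

Lemma app_map f q : q \in dom k -> app [seq f r | r <- dom k] q = f q.
Proof.
rewrite mem_dom => qk; rewrite /app (nth_map p0) ?size_dom // nth_take // nth_pts.
by [].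
Qed.

Lemma app_dom s q : s \in P -> q \in dom k -> app s q \in dom k.
Proof.
move=> sP qd; apply: (words_dom sP); rewrite mem_nth // words_size //.
by rewrite -mem_dom.
Qed.

Lemma app_inj s : s \in P -> {in dom k &, injective (app s)}.
Proof.
move=> sP q r; rewrite !mem_dom => qk rk /eqP.
by rewrite /app nth_uniq ?words_size ?words_uniq // => /eqP/pt_nat_inj.
Qed.

Lemma app_word s : s \in P -> [seq app s q | q <- dom k] = s.
Proof.
move=> sP; apply: (@eq_from_nth _ p0) => [|i]; rewrite size_map size_dom ?words_size // => ik.
rewrite (nth_map p0) ?size_dom // nth_take // /app pt_nat_pts //.
exact: leq_trans ik k_le10.
Qed.

Lemma app_unapp s q : s \in P -> q \in dom k -> unapp s (app s q) = q.
Proof.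
move=> sP; rewrite mem_dom => qk; rewrite /unapp /app.
rewrite (_ : find _ _ = index (nth p0 s (pt_nat q)) s); last first.
  by apply: eq_find => r /=; rewrite eq_sym.
by rewrite index_uniq ?words_size ?words_uniq // nth_pts.
Qed.

Lemma mem_tuples (D vs : seq pt) n : {subset vs <= D} -> size vs = n -> vs \in tuples D n.
Proof.
elim: n vs => [|n IHn] [|v vs] //= vD [sz]; apply/allpairsP; exists (v, vs).
split=> //; first by apply: vD; rewrite inE eqxx.
by apply: IHn => // w wv; apply: vD; rewrite inE wv orbT.
Qed.

(** All permutations commuting with [shift] are listed. *)
Lemma mem_words f : (forall q, q \in dom k -> f q \in dom k) ->
  {in dom k &, injective f} -> (forall q, q \in dom k -> f (X q) = X (f q)) ->
  [seq f q | q <- dom k] \in P.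
Proof.
move=> fD fI fX; rewrite mem_filter map_inj_in_uniq // dom_uniq /=.
apply/mapP; exists (map f (heads l j)).
  apply: mem_tuples; last by rewrite !size_map size_iota.
  by move=> q /mapP[h /heads_dom hd ->]; exact: fD.
rewrite {1}dom_blocks /expand map_flatten.
move: (heads l j) heads_dom => H Hd; rewrite -!map_comp; congr flatten.
apply/eq_in_map => h /Hd hd /=.
have {}hd n : map f (traject X h n) = traject X (f h) n; last exact: hd.
elim: n h hd => //= n IHn h hd; rewrite -fX // IHn //; exact: X_dom.
Qed.
End Model.

Lemma ltb_nat_of_bin (a b : BinNums.N) : BinNat.N.ltb a b -> nat_of_bin a < nat_of_bin b.
Proof.
move/BinNat.N.ltb_lt => ab; have E := BinNat.N.sub_add _ _ (BinNat.N.lt_le_incl _ _ ab).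
rewrite -E nat_of_bin_add -[X in X < _]add0n ltn_add2r lt0n; apply/eqP => c0.
move: E ab; rewrite -[X in BinNat.N.add X _]nat_of_binK c0 /= => ->.
exact: BinNat.N.lt_irrefl.
Qed.

Section Labeling.
Variables (T : finType) (l j : nat).
Let k := l * j.
Let X := app (shift l j).
Hypothesis wf : well_formed l j.
Variables (K : {set T}) (x : {perm T}).
Hypotheses (Kx : stable K x) (cardK : #|K| = k).

Definition labeling (psi : pt -> T) :=
  [/\ {in dom k &, injective psi}, {in dom k, forall q, psi q \in K} &
      {in dom k, forall q, x (psi q) = psi (X q)}].

Section OneLabeling.
Variable psi : pt -> T.
Hypothesis lab : labeling psi.
Let psiI := let: And3 h _ _ := lab in h.
Let psiK := let: And3 _ h _ := lab in h.
Let psiX := let: And3 _ _ h := lab in h.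

Definition unlabel y := nth p0 (dom k) (index y (map psi (dom k))).

Lemma psi_surj y : y \in K -> y \in map psi (dom k).
Proof.
have := @uniq_min_size _ (map psi (dom k)) (enum K).
rewrite map_inj_in_uniq ?dom_uniq // size_map size_dom // -cardE cardK leqnn.
case=> // [z /mapP[q qd ->]|_ E yK]; first by rewrite mem_enum psiK.
by rewrite E mem_enum.
Qed.

Lemma psiK_unlabel q : q \in dom k -> unlabel (psi q) = q.
Proof.
move=> qd; have pq : psi q \in map psi (dom k) by exact: map_f.
have iq : index (psi q) (map psi (dom k)) < size (dom k) by rewrite -(size_map psi) index_mem.
by apply: psiI; rewrite ?mem_nth // -(nth_map p0 (psi p0)) // nth_index.
Qed.

Lemma unlabel_dom y : y \in K -> unlabel y \in dom k.
Proof. by move/psi_surj/mapP=> [q qd ->]; rewrite psiK_unlabel. Qed.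

Lemma unlabelK y : y \in K -> psi (unlabel y) = y.
Proof. by move/psi_surj/mapP=> [q qd ->]; rewrite psiK_unlabel. Qed.

Definition word (f : T -> T) : seq pt := [seq unlabel (f (psi q)) | q <- dom k].

Lemma app_wordE f q : stable K f -> q \in dom k -> psi (app (word f) q) = f (psi q).
Proof.
by move=> Kf qd; rewrite app_map // unlabelK // Kf psiK.
Qed.

Lemma word_carries f : stable K f -> carries psi (fun q => q \in dom k) (app (word f)) f.
Proof.
move=> Kf q qd; split; last by rewrite app_wordE.
by rewrite app_map // unlabel_dom // Kf psiK.
Qed.

Lemma shift_carries : carries psi (fun q => q \in dom k) X x.
Proof. by move=> q qd; rewrite psiX //; split=> //; exact: X_dom. Qed.

Lemma word_in (p : {perm T}) : stable K p -> commute p x -> word p \in words l j.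
Proof.
move=> Kp px; apply: mem_words => // [q qd|q r qd rd|q qd].
- by rewrite unlabel_dom // Kp psiK.
- move=> E; apply: psiI => //; apply: (@perm_inj _ p).
  by rewrite -[LHS]unlabelK ?E ?unlabelK // Kp psiK.
have Xd := X_dom wf qd.
have K1 : p (psi q) \in K by rewrite Kp psiK.
have K2 : p (psi (X q)) \in K by rewrite Kp psiK.
apply: psiI; [exact: unlabel_dom | exact: (X_dom wf (unlabel_dom _)) |].
by rewrite -[RHS](psiX (unlabel_dom K1)) !unlabelK // -[X in p X](psiX qd) -!permM px.
Qed.

Lemma word_inj : {in [pred a | perm_on K a] &, injective (fun a : {perm T} => word a)}.
Proof.
move=> a b /= Ka Kb ab; apply/permP=> y; have [yK|nyK] := boolP (y \in K); last first.
  by rewrite !(out_perm _ nyK).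
have sa := perm_on_stable Ka (subxx K); have sb := perm_on_stable Kb (subxx K).
have ud := unlabel_dom yK; rewrite -(unlabelK yK) -(app_wordE sa ud) -(app_wordE sb ud).
by rewrite ab.
Qed.

Lemma word_surj s : s \in words l j ->
  exists a : {perm T}, [/\ perm_on K a, (a \in 'C[x])%g & word a = s].
Proof.
move=> sW; pose f y := if y \in K then psi (app s (unlabel y)) else y.
have fK y : (f y \in K) = (y \in K).
  by rewrite /f; case: ifP => // yK; rewrite psiK // app_dom // unlabel_dom.
have fI : injective f.
  move=> y z E; have yz : (y \in K) = (z \in K) by rewrite -fK E fK.
  move: E; rewrite /f yz; case: ifP => // zK.
  have yK : y \in K by rewrite yz.
  have yd := unlabel_dom yK; have zd := unlabel_dom zK.
  move/(psiI (app_dom wf sW yd) (app_dom wf sW zd))/(app_inj wf sW yd zd) => E.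
  by rewrite -(unlabelK yK) E unlabelK.
exists (perm fI); split.
- by apply/subsetP=> y; rewrite inE permE /f; case: ifP => //; rewrite eqxx.
- apply/cent1P/permP=> y; rewrite !permM !permE /f Kx; case: ifP => // yK.
  have ud := unlabel_dom yK.
  have E : unlabel (x y) = X (unlabel y).
    rewrite -{1}(unlabelK yK) (psiX ud) psiK_unlabel //; exact: (X_dom wf).
  by rewrite E (psiX (app_dom wf sW ud)) (words_comm wf sW ud).
rewrite -[RHS](app_word wf sW); apply/eq_in_map => q qd.
by rewrite permE /f psiK // !psiK_unlabel // app_dom.
Qed.

Lemma sum_words (R : nmodType) (F : seq pt -> R) : uniq (words l j) ->
  (\sum_(a : {perm T} | perm_on K a && (a \in 'C[x])%g) F (word a) = \sum_(s <- words l j) F s)%R.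
Proof.
move=> U; pose A := [pred a | perm_on K a && (a \in 'C[x])%g].
rewrite -(@perm_big _ _ _ _ [seq word (a : {perm T}) | a : {perm T} <- enum A]);
  first by rewrite big_map big_enum.
apply: uniq_perm => // [|s].
  rewrite map_inj_in_uniq ?enum_uniq // => a b; rewrite !mem_enum => /andP[Ka _] /andP[Kb _].
  exact: word_inj.
apply/mapP/idP => [[a]|/word_surj[a [Ka ax <-]]].
  rewrite mem_enum => /andP[Ka /cent1P ax] ->; apply: word_in ax.
  exact: perm_on_stable Ka (subxx K).
by exists a; rewrite // mem_enum inE Ka.
Qed.

Lemma relabel g : g \in words l j -> labeling (psi \o app g).
Proof.
move=> gW; split=> [q r qd rd /=|q qd /=|q qd /=].
- by move/(psiI (app_dom wf gW qd) (app_dom wf gW rd))/(app_inj wf gW qd rd).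
- by rewrite psiK // app_dom.
by rewrite psiX ?app_dom // words_comm.
Qed.
End OneLabeling.

(** Composing a labeling with a word conjugates the words of all permutations. *)
Lemma word_relabel psi g (p : {perm T}) : labeling psi -> g \in words l j ->
  stable K p -> commute p x ->
  word (psi \o app g) p = conj_word l j g (word psi p).
Proof.
move=> lab gW Kp px; apply/eq_in_map => q qd.
have lab' := relabel lab gW; have [psiI psiK psiX] := lab.
have gd := app_dom wf gW qd; have pW := word_in lab Kp px.
have Kpq : p ((psi \o app g) q) \in K by rewrite Kp psiK.
have rd := unlabel_dom lab' Kpq.
rewrite -[LHS](app_unapp wf gW rd); congr (unapp g _).
apply: psiI; [exact: app_dom | exact: app_dom pW gd |].
by rewrite (app_wordE lab Kp gd); exact: (unlabelK lab' Kpq).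
Qed.

(** Relabel as long as some conjugate of the word of [u] has a smaller code. *)
Lemma minimal_labeling psi (u : {perm T}) : labeling psi -> stable K u -> commute u x ->
  exists2 psi', labeling psi' & minimal l j (words l j) (word psi' u).
Proof.
move=> lab Ku ux; have [n] := ubnP (nat_of_bin (code (word psi u))).
elim: n psi lab => // n IHn psi lab ltn.
have [M|] := boolP (minimal l j (words l j) (word psi u)); first by exists psi.
rewrite negbK => /hasP[g gW lt]; apply: (IHn _ (relabel lab gW)).
rewrite word_relabel //; rewrite ltnS in ltn; apply: leq_trans ltn.
exact: ltb_nat_of_bin lt.
Qed.
End Labeling.

(** * Existence of labelings *)

Lemma nth_traject_default S (f : S -> S) z0 z i n : i < n ->
  nth z0 (traject f z n) i = iter i f z.
Proof. by move=> il; rewrite (set_nth_default z) ?size_traject // nth_traject. Qed.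

Section Exists.
Variables (T : finType) (T10 : #|T| <= 10) (x : {perm T}) (l : nat).

(** The cycles of [x] on [K] are removed one at a time. *)
Lemma cycle_blocks (K : {set T}) : stable K x -> {in K, forall y, len eq_op x y = l} ->
  exists ys, let s := flatten [seq traject x y l | y <- ys] in uniq s /\ s =i K.
Proof.
have [n] := ubnP #|K|; elim: n K => // n IHn K ltn Kx Kl.
have [->|[y yK]] := set_0Vmem K; first by exists [::]; split=> // z; rewrite inE.
pose K' := K :\: porbit x y.
have trE z : (z \in traject x y l) = (z \in porbit x y).
  by rewrite -(Kl y yK) len_porbit // porbit_traject.
have pK : porbit x y \subset K.
  by apply/subsetP=> z /porbitP[i ->]; rewrite permX; elim: i => //= i; rewrite Kx.
have [||z|ys [Us Es]] := IHn K'.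
- rewrite ltnS in ltn; apply: leq_trans ltn; apply: proper_card.
  apply/properP; split; first exact: subsetDl.
  by exists y => //; rewrite !inE porbit_id.
- move=> z; rewrite !inE Kx; congr (~~ _ && _).
  by rewrite -!eq_porbit_mem; have := mem_porbit x 1 z; rewrite expg1 -eq_porbit_mem => /eqP->.
- by rewrite inE => /andP[_]; exact: Kl.
exists (y :: ys); split=> /=; last first.
  move=> z; rewrite mem_cat trE [X in _ || X]Es !inE; case zp: (_ \in porbit _ _) => //=.
  by rewrite (subsetP pK).
have U1 : uniq (traject x y l) by rewrite -(Kl y yK) len_porbit // uniq_traject_porbit.
rewrite cat_uniq U1 Us andbT /=; apply/hasPn => z.
by rewrite [_ \in _]Es inE trE => /andP[].
Qed.

(** The model consists of the same number of cycles of the same length. *)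
Lemma labeling_exists (K : {set T}) : stable K x -> {in K, forall y, len eq_op x y = l} ->
  exists j, l * j = #|K| /\ (well_formed l j -> exists psi, labeling l j K x psi).
Proof.
move=> Kx Kl; have [ys [Us Es]] := cycle_blocks Kx Kl; exists (size ys).
set s := flatten _ in Us Es.
have sz : size s = l * size ys.
  rewrite size_flatten /shape -map_comp (eq_map (g := fun=> l)); last by move=> z /=;
    rewrite size_traject.
  by elim: (ys) => [|z zs /= ->]; rewrite ?muln0 ?mulnS.
have cK : l * size ys = #|K|.
  by rewrite -sz -(card_uniqP Us); apply: eq_card.
split=> // wf; have k0 := k_gt0 wf.
have [y0 _] : exists y0, y0 \in K by apply/card_gt0P; rewrite -cK.
pose psi q := nth y0 s (pt_nat q).
have mpsi : map psi (dom (l * size ys)) = s.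
  apply: (@eq_from_nth _ y0); rewrite size_map (size_dom wf) ?sz // => i il.
  rewrite (nth_map p0) ?(size_dom wf) // /psi nth_take // pt_nat_pts //.
  exact: leq_trans il (k_le10 wf).
have blk : [seq map psi (traject (app (shift l (size ys))) h l) | h <- heads l (size ys)] =
           [seq traject x y l | y <- ys].
  apply: eq_from_flatten_shape.
    by rewrite -/s -mpsi (dom_blocks wf) /expand map_flatten -map_comp.
  rewrite /shape -!map_comp; apply: (@eq_from_nth _ 0); rewrite !size_map size_iota // => i il.
  rewrite (nth_map 0) ?size_iota // (nth_map y0) //=.
  by rewrite size_map !size_traject.
exists psi; split.
- move=> q r; rewrite !(mem_dom wf) => qk rk /eqP.
  by rewrite /psi nth_uniq ?sz // => /eqP/pt_nat_inj.
- by move=> q; rewrite (mem_dom wf) => qk; rewrite -Es mem_nth // sz.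
move=> q; rewrite {1}(dom_blocks wf) => /flatten_mapP[h hh qh].
have hd := heads_dom wf hh.
have ih : index h (heads l (size ys)) < size ys.
  by have := hh; rewrite -index_mem size_map size_iota.
have := congr1 (fun b => nth [::] b (index h (heads l (size ys)))) blk.
rewrite (nth_map p0) ?index_mem // nth_index // (nth_map y0) //.
set y := nth y0 ys _; case/trajectP: qh => i il ->{q} E.
have E' t : t < l -> psi (iter t (app (shift l (size ys))) h) = iter t x y.
  move=> tl; have := congr1 (fun b => nth y0 b t) E.
  by rewrite /= (nth_map p0) ?size_traject // !nth_traject_default.
have yK : y \in K.
  rewrite -Es; apply/flatten_mapP; exists y; first by rewrite mem_nth.
  by apply/trajectP; exists 0 => //; case: (l) il.
rewrite E' // -iterS; have := il; rewrite leq_eqVlt => /orP[/eqP il'|il'].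
  rewrite il' -iterS il' (X_cycle wf hd) -[in LHS](Kl y yK) iter_len //.
  by rewrite -[h]/(iter 0 (app (shift l (size ys))) h) E' // -il'.
by rewrite -iterS E'.
Qed.
End Exists.

(** * Sums of roots of unity *)

Local Open Scope ring_scope.

Section RootSums.
Variables (F : fieldType) (char0 : forall n : nat, (0 < n)%N -> n%:R != 0 :> F).

Definition periodic_fun l (g : nat -> F) := forall r, g (r + l)%N = g r.

Section OneRoot.
Variables (l : nat) (z : F).
Hypothesis pz : l.-primitive_root z.

Let zl : z ^+ l = 1. Proof. exact: prim_expr_order. Qed.

Lemma sum_cyclic g t : periodic_fun l g ->
  \sum_(r < l) g (r + t)%N * z ^+ (r + t) = \sum_(r < l) g r * z ^+ r.
Proof.
move=> gp; elim: t => [|t IHt]; first by apply: eq_bigr => r _; rewrite addn0.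
rewrite -{}IHt; case: l gp zl => [|l'] gp zl'; first by rewrite !big_ord0.
rewrite big_ord_recr [RHS]big_ord_recl addrC /=; congr (_ + _).
  by apply: eq_bigr => r _; rewrite /bump /= add1n addSnnS.
by rewrite addnS -addSn addnC gp exprD zl' mulr1.
Qed.

(** Such a sum is unchanged when multiplied by [z ^+ t]. *)
Lemma shift_fixed_sum g t : periodic_fun l g -> z ^+ t != 1 ->
  (forall r, (r < l)%N -> g (r + t)%N = g r) -> \sum_(r < l) g r * z ^+ r = 0.
Proof.
move=> gp zt gt; apply/eqP; have := sum_cyclic t gp.
rewrite (eq_bigr (fun r : 'I_l => z ^+ t * (g r * z ^+ r))); last first.
  by move=> r _; rewrite gt // exprD mulrA mulrC.
rewrite -mulr_sumr => /eqP; rewrite -subr_eq0 -[X in _ - X]mul1r -mulrBl mulf_eq0.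
by rewrite subr_eq0 (negPf zt).
Qed.

(** Since [z ^+ l./2 = -1], the terms [r] and [r + l./2] can be merged, which counts
    each of them twice. *)
Lemma half_turn_sum g : periodic_fun l g -> z ^+ l./2 = -1 ->
  \sum_(r < l) (g r - g (r + l./2)%N) * z ^+ r = (\sum_(r < l) g r * z ^+ r) *+ 2.
Proof.
move=> gp zh; rewrite mulr2n -{2}(sum_cyclic l./2 gp) -big_split; apply: eq_bigr => r _ /=.
by rewrite exprD zh mulrBl mulrN1 mulrN.
Qed.
End OneRoot.

Lemma balanced_sum l z K c : l.-primitive_root z -> (1 < l <= 10)%N -> balanced l K c ->
  \sum_(r < l) (c r)%:R * z ^+ r = K%:R :> F.
Proof.
move=> pz /andP[l1 l10] bal.
pose d r := (c (r %% l)%N, if (r %% l == 0)%N then K else 0%N).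
pose p r := if odd l then d r else
  ((d r).1 + (d (r + l./2)).2, (d r).2 + (d (r + l./2)).1)%N.
pose t := (if l == 9 then 3 else if (l == 6) || (l == 10) then 2 else 1)%N.
have {}bal : all (fun r => (p r).1 + (p (r + t)).2 == (p (r + t)).1 + (p r).2)%N (iota 0 l) by [].
pose v (q : nat * nat) : F := q.1%:R - q.2%:R.
have vd : periodic_fun l (v \o d) by move=> r; rewrite /= /d modnDr.
have zt : z ^+ t != 1.
  rewrite -(prim_order_dvd pz) /t.
  by move: (l) l1 l10; do 11?case=> //.
have vpt r : (r < l)%N -> v (p (r + t)%N) = v (p r).
  move=> rl; have ri : r \in iota 0 l by rewrite mem_iota.
  have /eqP E := allP bal r ri.
  by apply/eqP; rewrite /v subr_eq addrAC eq_sym subr_eq -!natrD E.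
have l0 : (0 < l)%N by exact: ltnW.
suff S0 : \sum_(r < l) v (d r) * z ^+ r = 0.
  apply/eqP; rewrite -subr_eq0 -[X in _ == X]S0; apply/eqP.
  transitivity (\sum_(r < l) ((c r)%:R * z ^+ r - (if r == 0%N :> nat then K%:R else 0) * z ^+
    r)).
    rewrite big_split /= sumrN; congr (_ - _).
    rewrite (bigD1 (Ordinal l0)) //= mulr1 big1 ?addr0 // => r nr.
    by rewrite -val_eqE /= in nr; rewrite (negPf nr) mul0r.
  apply: eq_bigr => r _; rewrite /v /d /= modn_small // -mulrBl.
  by case: ifP.
case: (boolP (odd l)) => ol.
  apply: (shift_fixed_sum pz vd zt) => r rl /=.
  by have := vpt r rl; rewrite /p ol.
have h0 : (0 < l./2)%N by rewrite half_gt0.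
have hl : (l./2 < l)%N by rewrite -[X in (_ < X)%N](even_halfK ol) -addnn -[X in (X <
  _)%N]addn0 ltn_add2l.
have zh : z ^+ l./2 = -1.
  have : (z ^+ l./2) ^+ 2 == 1 by rewrite -exprM muln2 even_halfK // prim_expr_order.
  rewrite sqrf_eq1 => /orP[|/eqP//].
  by rewrite -(prim_order_dvd pz) gtnNdvd.
have vp r : v (p r) = v (d r) - v (d (r + l./2)%N).
  by rewrite /p (negPf ol) /v !natrD opprD opprB addrACA.
have gp : periodic_fun l (v \o p).
  have vd' q : v (d (q + l)%N) = v (d q) by exact: vd.
  by move=> r /=; rewrite !vp addnAC !vd'.
have := half_turn_sum pz vd zh.
rewrite (eq_bigr (fun r : 'I_l => v (p r) * z ^+ r)); last by move=> r _; rewrite vp.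
rewrite (shift_fixed_sum pz gp zt vpt) => /esym/eqP.
by rewrite -mulr_natl mulf_eq0 (negPf (char0 _)) // => /eqP.
Qed.
End RootSums.

Local Close Scope ring_scope.

(** * The identity on the sets covered by the checks *)

Local Open Scope ring_scope.

Section Weights.
Variables (T : finType) (T10 : (#|T| <= 10)%N) (F : fieldType).
Variables (N : nat) (NE : N = 2520%N) (w : F) (wN : w ^+ N = 1).
Implicit Types (u a x : {perm T}) (K : {set T}) (rk : T -> nat).

Definition torsion_weight rk m u x a y : F :=
  if torsion_at eq_op m u a y then w ^+ nat_of_bin (exponent_at eq_op rk m u a x y) else 0.
Definition root_weight m u x a y : F := (root_at eq_op m u a x y)%:R.

(** The product of the local factors is the indicator function of the torsion pairs
    times the character. *)
Lemma prod_torsion_weight rk m u x a K : \prod_(y in K) torsion_weight rk m u x a y =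
  if [forall y in K, torsion_at eq_op m u a y] then w ^+ total_exponent m K rk u a x else 0.
Proof.
case: ifP => [/forall_inP H|/negbT].
  by rewrite /total_exponent -prodrXr; apply: eq_bigr => y /H; rewrite /torsion_weight => ->.
rewrite negb_forall_in => /existsP[y /andP[yK ny]].
by rewrite (bigD1 y) //= /torsion_weight (negPf ny) mul0r.
Qed.

Lemma prod_root_weight m u x a K : \prod_(y in K) root_weight m u x a y =
  [forall y in K, root_at eq_op m u a x y]%:R.
Proof.
case: forallP => [H|].
  by apply: big1 => y yK; rewrite /root_weight; move: (H y); rewrite yK /= => ->.
move/forallP; rewrite negb_forall => /existsP[y]; rewrite negb_imply => /andP[yK ny].
by rewrite (bigD1 y) //= /root_weight (negPf ny) mul0r.
Qed.

Lemma carries_id K (f g : T -> T) : stable K f -> {in K, f =1 g} ->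
  carries id (fun y => y \in K) f g.
Proof. by move=> Kf fg y yK; rewrite Kf fg. Qed.

(** Transport along the identity, restricted to the stable set. *)
Lemma local_torsion_weight rk m u x : local u x (torsion_weight rk m u x).
Proof.
move=> K a a' Ku Kx Ka aa y yK; rewrite /torsion_weight.
have cu := carries_id Ku (fun y _ => erefl); have cx := carries_id Kx (fun y _ => erefl).
have ca := carries_id Ka aa.
rewrite -(@torsion_at_carries _ _ eq_op eq_op id _ _ m _ _ _ _ y cu ca) //.
by rewrite -(@exponent_at_carries _ _ eq_op eq_op rk rk id _ _ _ m _ _ _ _ _ _ y cu ca cx).
Qed.

Lemma local_root_weight m u x : local u x (root_weight m u x).
Proof.
move=> K a a' Ku Kx Ka aa y yK; rewrite /root_weight.
have cu := carries_id Ku (fun y _ => erefl); have cx := carries_id Kx (fun y _ => erefl).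
have ca := carries_id Ka aa.
by rewrite -(@root_at_carries _ _ eq_op eq_op id _ _ m _ _ _ _ _ _ y cu ca cx).
Qed.

Lemma expw_mod i k : i = k %[mod N] -> w ^+ i = w ^+ k.
Proof. by move=> ik; rewrite -(expr_mod i wN) ik expr_mod. Qed.

Lemma turnE : nat_of_bin turn = N.
Proof. by rewrite NE. Qed.

Lemma modulo_turn e : nat_of_bin (BinNat.N.modulo e turn) = e %[mod N].
Proof.
have E : e = BinNat.N.add (BinNat.N.mul turn (BinNat.N.div e turn)) (BinNat.N.modulo e turn).
  exact: BinNat.N.div_mod.
by rewrite [in RHS]E nat_of_bin_add nat_of_bin_mul turnE mulnC modnMDl.
Qed.

Lemma exp_residue l e : (residue l e < l)%N ->
  w ^+ nat_of_bin e = (w ^+ nat_of_bin (frac l)) ^+ residue l e.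
Proof.
move=> rl; have : has (fun r => BinNat.N.eqb (BinNat.N.modulo e turn)
  (BinNat.N.mul (bin_of_nat r) (frac l))) (iota 0 l) by rewrite has_find size_iota.
move/(nth_find 0%N); rewrite -/(residue l e) nth_iota // add0n => /BinNat.N.eqb_eq E.
rewrite -exprM; apply: expw_mod; rewrite -modulo_turn E nat_of_bin_mul bin_of_natK.
by rewrite mulnC.
Qed.
End Weights.

Section Periodicity.
Variables (l j L m : nat) (u a : seq pt).
Hypothesis per : periodic l j L u a.

Lemma periodic_two_part : (8 %| L)%N -> two_part (m %% L) = two_part m.
Proof.
move=> L8; rewrite /two_part modn_dvdm //.
by rewrite [(_ %% L %% 4)%N]modn_dvdm // (dvdn_trans _ L8).
Qed.
Lemma periodic_three_part : (9 %| L)%N -> three_part (m %% L) = three_part m.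
Proof. by move=> L9; rewrite /three_part modn_dvdm. Qed.

Lemma periodic_torsion : torsion_row (m %% L) (lengths l j u a) = torsion_row m (lengths l j u a).
Proof.
rewrite /torsion_row /lengths !all_map; apply: eq_in_all => y yd /=.
by have /and4P[La Lb _ _] := allP per y yd; rewrite !modn_dvdm.
Qed.

Lemma periodic_root : root_row (m %% L) (lengths l j u a) = root_row m (lengths l j u a).
Proof.
rewrite /root_row /lengths !all_map; apply: eq_in_all => y yd /=.
by have /and4P[La Lb _ _] := allP per y yd; rewrite !modn_dvdm.
Qed.

Lemma periodic_exponent : exponent_word l j (m %% L) u a = exponent_word l j m u a.
Proof.
rewrite /exponent_word; congr foldr; apply/eq_in_map => y yd.
have /and4P[_ _ /implyP L8 /implyP L9] := allP per y yd.
suff V : verdict pt_eqb (m %% L) (app u) (app a) (component pt_eqb [:: app u; app a] y) =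
  verdict pt_eqb m (app u) (app a) (component pt_eqb [:: app u;
    app a] y) by rewrite /exponent_at V.
rewrite /verdict; case: ifP => [/L8 L8'|_]; first by rewrite periodic_two_part.
by case: ifP => // /L9 L9'; rewrite periodic_three_part.
Qed.
End Periodicity.

Lemma foldr_nat_of_bin (S : Type) (f : S -> BinNums.N) s :
  nat_of_bin (foldr BinNat.N.add BinNums.N0 [seq f y | y <- s]) =
    (\sum_(y <- s) nat_of_bin (f y))%N.
Proof. by elim: s => [|y s IHs] /=; rewrite ?big_nil // big_cons nat_of_bin_add IHs. Qed.

Lemma sum_by_count (R : pzRingType) (z : R) l E : all (fun r => r < l)%N E ->
  \sum_(e <- E) z ^+ e = \sum_(r < l) (count (eq_op (r : nat)) E)%:R * z ^+ r.
Proof.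
elim: E => [_|e E IHE /= /andP[el /IHE E']].
  by rewrite big_nil big1 // => r _; rewrite mul0r.
rewrite big_cons E'; under [RHS]eq_bigr do rewrite natrD mulrDl.
rewrite big_split /=; congr (_ + _); rewrite (bigD1 (Ordinal el)) //= eqxx mul1r.
by rewrite big1 ?addr0 // => r; rewrite -val_eqE /= => /negPf->; rewrite mul0r.
Qed.

Section Checked.
Variables (T : finType) (T10 : (#|T| <= 10)%N) (F : fieldType).
Hypothesis char0 : forall n : nat, (0 < n)%N -> n%:R != 0 :> F.
Variables (N : nat) (NE : N = 2520%N) (w : F) (pw : N.-primitive_root w).
Variables (K : {set T}) (u x : {perm T}) (m l j : nat) (psi : pt -> T).
Hypotheses (Ku : stable K u) (Kx : stable K x) (ux : commute u x) (cK : #|K| = (l * j)%N).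
Hypotheses (wf : well_formed l j) (lab : labeling l j K x psi).
Let k := (l * j)%N.
Let us := word l j psi u.
Let wN : w ^+ N = 1 := prim_expr_order pw.
Let rkI := let: And3 h _ _ := lab in h.
Let psiK := let: And3 _ h _ := lab in h.

Let eE : forall q r, q \in dom k -> r \in dom k -> (psi q == psi r) = pt_eqb q r.
Proof.
move=> q r qd rd; rewrite -[pt_eqb q r]/(q == r); apply/eqP/eqP => [|-> //]; exact: rkI.
Qed.

(** The rank that corresponds to the order of the points of the model. *)
Definition label_rank y := pt_nat (unlabel l j psi y).
Let rkE : forall q r, q \in dom k -> r \in dom k ->
  (label_rank (psi q) <= label_rank (psi r))%N = (pt_nat q <= pt_nat r)%N.
Proof. by move=> q r qd rd; rewrite /label_rank !(psiK_unlabel lab). Qed.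

Let rk_inj : {in K &, injective label_rank}.
Proof.
move=> y z yK zK /pt_nat_inj E.
by rewrite -(unlabelK wf cK lab yK) E (unlabelK wf cK lab).
Qed.

Lemma forall_label (P : pred T) :
  [forall y in K, P y] = all (fun q => P (psi q)) (dom k).
Proof.
apply/forall_inP/allP => [H q qd|H y yK]; first by apply: H; exact: psiK.
by rewrite -(unlabelK wf cK lab yK); apply: H; exact: (unlabel_dom wf cK lab).
Qed.

Lemma sum_label (f : T -> nat) : (\sum_(y in K) f y = \sum_(q <- dom k) f (psi q))%N.
Proof.
rewrite -(big_map psi xpredT f) -big_enum /=; apply: perm_big; apply: uniq_perm.
- exact: enum_uniq.
- by rewrite map_inj_in_uniq // (dom_uniq l j).
move=> y; rewrite mem_enum; apply/idP/idP => [|/mapP[q qd ->]]; last exact: psiK.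
exact: (psi_surj wf cK lab).
Qed.

Section OnePermutation.
Variable a : {perm T}.
Hypotheses (Ka : stable K a) (ax : commute a x).
Let as_ := word l j psi a.
Let cu := word_carries wf cK lab Ku.
Let ca := word_carries wf cK lab Ka.
Let cx := shift_carries wf lab.

Lemma torsion_word :
  [forall y in K, torsion_at eq_op m u a y] = torsion_row m (lengths l j us as_).
Proof.
rewrite forall_label /torsion_row /lengths all_map; apply: eq_in_all => q qd.
exact: (torsion_at_carries eE).
Qed.

Lemma root_word :
  [forall y in K, root_at eq_op m u a x y] = root_row m (lengths l j us as_).
Proof.
rewrite forall_label /root_row /lengths all_map; apply: eq_in_all => q qd.
exact: (root_at_carries eE m cu ca cx qd).
Qed.

Lemma exponent_wordE rk : injective rk ->
  total_exponent m K rk u a x = exponent_word l j m us as_ %[mod N].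
Proof.
move=> rkinj; rewrite (exponent_rk T10 NE erefl m Ku Ka (in2W rkinj) rk_inj Kx (commute_sym ux)
  (commute_sym ax)).
congr (_ %% _)%N; rewrite /total_exponent /exponent_word foldr_nat_of_bin sum_label;
  apply: eq_big_seq => q qd.
by rewrite (exponent_at_carries eE rkE m cu ca cx qd).
Qed.

(** By stability, orbits of points of [K] stay in [K], so that their sizes decide. *)
Lemma transitive_wordE y : y \in K ->
  (orbit_of [:: u; a; x] y == K) = transitive_word l j us as_.
Proof.
move=> yK; have p0d : p0 \in dom k by rewrite (mem_dom wf) (k_gt0 wf).
have pK : psi p0 \in K by exact: psiK.
have oK z : z \in K -> orbit_of [:: u; a; x] z \subset K.
  by move=> zK; apply: orbit_of_min => // f; rewrite !inE => /or3P[] /eqP->.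
have -> : (orbit_of [:: u; a; x] y == K) = (orbit_of [:: u; a; x] (psi p0) == K).
  by apply/eqP/eqP => E; rewrite -[RHS]E; apply: orbit_of_eq; rewrite // E.
rewrite eqEcard oK //= /transitive_word -/k.
have [//|i|E _] := @component_carries _ _ _ _ psi (fun q => q \in dom k) eE
  [:: app us; app as_; app (shift l j)] [:: u : T -> T; a : T -> T; x : T -> T] p0 _ _ p0d.
  by case: i => [|[|[|i]]].
have U := @component_uniq T [:: u : T -> T; a : T -> T; x : T -> T] (psi p0).
have sz : size (component pt_eqb [:: app us; app as_; app (shift l j)] p0) =
    #|orbit_of [:: u; a; x] (psi p0)|.
  rewrite -(size_map psi) -E -(card_uniqP U); apply: eq_card => z.
  by rewrite inE component_connect.
rewrite sz /k -cK eqn_leq; apply/idP/andP => [->|[_ ->]] //; split=> //.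
by apply: subset_leq_card; exact: oK.
Qed.
End OnePermutation.

Lemma sum_connected y (phi : {perm T} -> T -> F) f : y \in K -> uniq (words l j) ->
  (forall a : {perm T}, stable K a -> commute a x ->
    \prod_(z in K) phi a z = f (word l j psi a)) ->
  connected_total u x phi K y = \sum_(s <- words l j | transitive_word l j us s) f s.
Proof.
move=> yK U phif; rewrite [RHS]big_mkcond /=.
rewrite -(sum_words wf Kx cK lab (fun s => if transitive_word l j us s then f s else 0) U).
rewrite -big_mkcondr /connected_total.
have comm a : (a \in 'C[x])%g -> commute a x by move/cent1P.
apply: eq_big => a.
  rewrite andbA; apply: andb_id2l => /andP[Ka /comm ax].
  by rewrite transitive_wordE //; exact: perm_on_stable Ka (subxx K).
case/and3P=> Ka /comm ax _; apply: phif => //; exact: perm_on_stable Ka (subxx K).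
Qed.

(** The sums over permutations become sums over words, [m] is replaced by its remainder
    modulo the period, and the exponents are grouped by residue. *)
Lemma checked_connected rk L y : injective rk -> (1 < l <= 10)%N -> y \in K ->
  uniq (words l j) -> (0 < L)%N -> check l j L -> minimal l j (words l j) us ->
  connected_total u x (torsion_weight w rk m u x) K y =
  connected_total u x (root_weight F m u x) K y.
Proof.
move=> rkinj l10 yK U L0 chk mn.
pose t s := torsion_row m (lengths l j us s).
pose r s := root_row m (lengths l j us s).
rewrite (@sum_connected y _ (fun s =>
  if t s then w ^+ nat_of_bin (exponent_word l j m us s) else 0)) //; last first.
  move=> a Ka ax; rewrite prod_torsion_weight torsion_word // /t; case: ifP => // _.
  by apply: (expw_mod wN); exact: exponent_wordE.
rewrite (@sum_connected y _ (fun s => (r s)%:R)) //; last first.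
  by move=> a Ka ax; rewrite prod_root_weight root_word.
have usP : us \in words l j by exact: (word_in wf cK lab Ku ux).
have := allP chk us usP; rewrite mn /=.
set rows := [seq _ | _ <- _ & _] => /andP[/allP per /allP bal].
have mL : (m %% L)%N \in iota 0 L by rewrite mem_iota /= ltn_mod.
have /andP[El Kc] := bal _ mL.
set E := [seq _ | _ <- _ & _] in El Kc; set C := count _ _ in Kc.
pose z := w ^+ nat_of_bin (frac l).
have pz : l.-primitive_root z.
  have l0 : (0 < l <= 10)%N by case/andP: l10 => /ltnW-> ->.
  have := frac_len l0; rewrite -NE => fl.
  have -> : l = (N %/ gcdn (nat_of_bin (frac l)) N)%N.
    have f0 : (0 < nat_of_bin (frac l))%N by move: (prim_order_gt0 pw);
      rewrite -fl muln_gt0 => /andP[].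
    have -> : gcdn (nat_of_bin (frac l)) N = nat_of_bin (frac l) by apply/gcdn_idPl;
      rewrite -fl dvdn_mull.
    by rewrite -fl mulnK.
  exact: exp_prim_root.
pose S := [seq a <- words l j | transitive_word l j us a].
have perS s : s \in S -> periodic l j L us s by move=> sS; apply: (per (s, lengths l j us s));
  exact: map_f.
transitivity (\sum_(e <- E) z ^+ e).
  rewrite -big_filter -/S /E /rows -/S big_map big_filter big_map /= [RHS]big_mkcond /=.
  apply: eq_big_seq => s sS; rewrite (periodic_torsion m (perS s sS)) -/(t s).
  case ts: (t s) => //; rewrite (periodic_exponent m (perS s sS)); apply: (exp_residue NE wN).
  rewrite -(periodic_exponent m (perS s sS)); apply: (allP El); apply/mapP.
  exists (s, lengths l j us s) => //;
    rewrite mem_filter (periodic_torsion m (perS s sS)) -/(t s) ts.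
  exact: map_f.
rewrite (sum_by_count _ El) (balanced_sum char0 pz l10 Kc) /C /rows -/S count_map -sum1_count
  natr_sum.
rewrite big_mkcond -[RHS]big_filter -/S; apply: eq_big_seq => s sS /=.
by rewrite (periodic_root m (perS s sS)) -/(r s); case: (r s).
Qed.
End Checked.

Local Close Scope ring_scope.

(** * The identity for an odd number of transpositions *)

Local Open Scope ring_scope.

Section Involution.
Variables (T : finType) (T10 : (#|T| <= 10)%N) (F : fieldType).
Hypothesis char0 : forall n : nat, (0 < n)%N -> n%:R != 0 :> F.
Variables (N : nat) (NE : N = 2520%N) (w : F) (pw : N.-primitive_root w).
Variables (K : {set T}) (u x : {perm T}) (m j : nat) (psi : pt -> T).
Hypotheses (Ku : stable K u) (Kx : stable K x) (ux : commute u x) (cK : #|K| = (2 * j)%N).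
Hypotheses (wf : well_formed 2 j) (lab : labeling 2 j K x psi).
Hypotheses (oj : odd j) (chk : check_odd 2 j).
Let k := (2 * j)%N.
Let us := word 2 j psi u.
Let wN : w ^+ N = 1 := prim_expr_order pw.
Let psiK := let: And3 _ h _ := lab in h.
Let psiX := let: And3 _ _ h := lab in h.
Let xK := restr_perm K x.

Let xxE z : z \in K -> x (x z) = z.
Proof.
move=> zK; have zd := unlabel_dom wf cK lab zK.
rewrite -(unlabelK wf cK lab zK) (psiX zd) psiX; last exact: (X_dom wf).
by have /= -> := X_cycle wf zd.
Qed.

Let xKE z : z \in K -> xK z = x z.
Proof. by move=> zK; rewrite /xK restr_permE //; exact: stable_astabs. Qed.

Let xK_on : perm_on K xK := restr_perm_on K x.

Let xK2 : (xK * xK)%g = 1%g.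
Proof.
apply/permP=> z; rewrite perm1 permM; have [zK|nzK] := boolP (z \in K).
  by rewrite !xKE ?Kx // xxE.
by rewrite !(out_perm xK_on).
Qed.

Let xK_even : ~~ odd m -> (xK ^+ m = 1)%g.
Proof. by move=> em; rewrite -(even_halfK em) -mul2n expgM expgS expg1 xK2 expg1n. Qed.

Let xK_odd : odd m -> (xK ^+ m = xK)%g.
Proof.
by move=> om; rewrite -[m]odd_double_half om -mul2n expgD expgM [(xK ^+ 2)%g]expgS !expg1 xK2
  expg1n mulg1.
Qed.

Let xK_comm (p : {perm T}) : stable K p -> commute p x -> commute p xK.
Proof.
move=> Kp px; apply/commute_sym/cent1P; apply: restr_permC => //.
by apply/cent1P/commute_sym.
Qed.

Section OnePermutation.
Variable a : {perm T}.
Hypotheses (Ka : perm_on K a) (ax : commute a x).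
Let sa : stable K a := perm_on_stable Ka (subxx K).
Let axK := xK_comm sa ax.
Let uxK := xK_comm Ku ux.

Lemma twist_on : perm_on K (a * xK)%g. Proof. exact: perm_onM. Qed.

Lemma twist_comm : commute (a * xK)%g x.
Proof. by apply/commute_sym/commuteM; [exact/commute_sym | exact: xK_comm]. Qed.

Let twist_stable : stable K (a * xK)%g := perm_on_stable twist_on (subxx K).

Lemma twistE z : z \in K -> (a * xK)%g z = x (a z).
Proof. by move=> zK; rewrite permM xKE // sa. Qed.

Lemma twistK : (a * xK * xK)%g = a. Proof. by rewrite -mulgA xK2 mulg1. Qed.

Lemma expg_twist : ((a * xK) ^+ m = a ^+ m * xK ^+ m)%g.
Proof. exact: expgMn. Qed.

Lemma expg_twist_u : ((a * xK * u) ^+ m = (a * u) ^+ m * xK ^+ m)%g.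
Proof.
rewrite -mulgA -uxK mulgA; apply: expgMn.
by apply/commute_sym/commuteM; exact/commute_sym.
Qed.

(** Given [u] and [x], the permutations [a] and [a * xK] generate the same group on
    [K]. *)
Lemma twist_orbit y : orbit_of [:: u; a; x] y = K -> orbit_of [:: u; (a * xK)%g; x] y = K.
Proof.
move=> aK; have yK : y \in K by rewrite -aK orbit_of_refl.
set O := orbit_of _ y.
have sO (f : {perm T}) : f \in [:: u; (a * xK)%g; x] -> stable O f by exact: orbit_of_stable.
have Ou : stable O u by apply: sO; rewrite !inE eqxx.
have Ot : stable O (a * xK)%g by apply: sO; rewrite !inE eqxx orbT.
have Ox : stable O x by apply: sO; rewrite !inE eqxx !orbT.
have OK : O \subset K.
  apply: orbit_of_min => // f; rewrite !inE => /or3P[] /eqP-> //.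
have Oa : stable O a.
  move=> z; apply/idP/idP => zO.
    by have zK : z \in K; [rewrite -sa (subsetP OK) | rewrite -Ot twistE // Ox].
  by have zK := subsetP OK z zO; rewrite -Ox -twistE // Ot.
apply/eqP; rewrite eqEsubset OK /= -aK; apply: orbit_of_min; first exact: orbit_of_refl.
by move=> f; rewrite !inE => /or3P[] /eqP->.
Qed.

Lemma word_twist : word 2 j psi (a * xK)%g = [seq app (shift 2 j) q | q <- word 2 j psi a].
Proof.
rewrite /word -map_comp; apply/eq_in_map => q qd /=.
have qK := psiK qd; have aqK : a (psi q) \in K by rewrite sa.
rewrite twistE // -{1}(unlabelK wf cK lab aqK) psiX ?(unlabel_dom wf cK lab) //.
by apply: (psiK_unlabel lab); apply: (X_dom wf); exact: (unlabel_dom wf cK lab).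
Qed.

(** [K] consists of the orbit of [z] under [u] and [a] and of its image by [x], so this
    orbit has [2 * j] or [j] points, with [j] equal to 1, 3 or 5. *)
Lemma component_size y z : orbit_of [:: u; a; x] y = K -> z \in K ->
  let s := size (component eq_op [:: u : T -> T; a : T -> T] z) in
  [&& s != 4, s != 8 & s != 9]%N.
Proof.
move=> aK zK; set s := size _.
pose O v := orbit_of [:: u; a] v.
have yK : y \in K by rewrite -aK orbit_of_refl.
have cO v : size (component eq_op [:: u : T -> T; a : T -> T] v) = #|O v|.
  have U := @component_uniq T [:: u : T -> T; a : T -> T] v.
  by rewrite -(card_uniqP U); apply: eq_card => v'; rewrite inE component_connect.
have xO v v' : (x v' \in O (x v)) = (v' \in O v).
  have eE y1 y2 : predT y1 -> predT y2 -> (x y1 == x y2) = (y1 == y2) by rewrite perm_eqE.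
  have [//|i|E _] := @component_carries _ _ _ _ x predT eE
    [:: u : T -> T; a : T -> T] [:: u : T -> T; a : T -> T] v _ _ isT.
    by case: i => [|[|i]] //= _; apply: carries_perm; exact/commute_sym.
  rewrite !inE -![connect _ _ _](component_connect T10 [:: u : T -> T; a : T -> T]) E.
  by rewrite mem_map //; exact: perm_inj.
have Oz v : v \in O z -> v \in K.
  move: v; apply/subsetP/orbit_of_min => // f; rewrite !inE => /orP[] /eqP-> //.
have Oxz v : v \in O (x z) -> v \in K.
  move: v; apply/subsetP/orbit_of_min; first by rewrite Kx.
  by move=> f; rewrite !inE => /orP[] /eqP->.
have cx : #|O (x z)| = #|O z|.
  rewrite -[RHS](card_imset _ (@perm_inj _ x)); apply: eq_card => v.
  by rewrite -(permKV x v) xO mem_imset //; exact: perm_inj.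
have KE : K = O z :|: O (x z).
  apply/eqP; rewrite eqEsubset; apply/andP; split; last first.
    by apply/subsetP=> v; rewrite in_setU => /orP[/Oz|/Oxz].
  have <- : orbit_of [:: u; a; x] z = K by rewrite -[RHS]aK; apply: orbit_of_eq; rewrite // aK.
  apply: orbit_of_min; first by rewrite in_setU orbit_of_refl.
  move=> f; rewrite !inE => /or3P[] /eqP-> v.
  - by rewrite !in_setU !(orbit_of_stable T10) ?inE ?eqxx.
  - by rewrite !in_setU !(orbit_of_stable T10) ?inE ?eqxx ?orbT.
  have half v' : v' \in O z :|: O (x z) -> x v' \in O z :|: O (x z).
    rewrite !in_setU => /orP[vO|vO]; apply/orP; [right | left]; first by rewrite -/(O _) xO.
    by have := xO (x z) v'; rewrite (xxE zK) => ->.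
  apply/idP/idP => [xv|]; last exact: half.
  have xvK : x v \in K by move: xv; rewrite in_setU => /orP[/Oz|/Oxz].
  have vK : v \in K by rewrite -Kx.
  by rewrite -(xxE vK); exact: half.
have : (#|K| == #|O z|) || (#|K| == 2 * #|O z|)%N.
  have [/orbit_of_eq E|nE] := boolP (x z \in O z).
    by rewrite KE -[O (x z)]/(orbit_of _ _) E // setUid eqxx.
  rewrite KE cardsU cx disjoint_setI0 ?cards0 ?subn0 ?addnn ?mul2n ?eqxx ?orbT //.
  rewrite disjoint_subset; apply/subsetP=> v vz; rewrite inE; apply: contra nE => vxz.
  by rewrite -[O z](orbit_of_eq T10 vz) (orbit_of_eq T10 vxz) orbit_of_refl.
rewrite /s cO cK eqn_pmul2l //; have := k_le10 wf.
rewrite -[10%N]/(2 * 5)%N leq_pmul2l //; move: (j) oj => i oi i5.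
by case/orP=> /eqP <-; move: i oi i5; do 6?case=> //.
Qed.

(** By [component_size], only the rotation of [a] enters. *)
Lemma exponent_rot_word rk y : injective rk -> orbit_of [:: u; a; x] y = K ->
  total_exponent m K rk u a x = nat_of_bin (rot_word 2 j (word 2 j psi a)) %[mod N].
Proof.
move=> rkinj aK.
rewrite (exponent_wordE T10 NE m Ku Kx ux cK wf lab sa ax rkinj).
rewrite /exponent_word /rot_word; congr (nat_of_bin _ %% _)%N; congr foldr;
  apply/eq_in_map => q qd.
have eE y1 y2 : y1 \in dom k -> y2 \in dom k -> (psi y1 == psi y2) = pt_eqb y1 y2.
  have [psiI _ _] := lab.
  by move=> d1 d2; rewrite -[pt_eqb _ _]/(y1 == y2); apply/eqP/eqP => [|-> //]; exact: psiI.
have := component_size aK (psiK qd).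
have [//|i|-> _] := @component_carries _ _ pt_eqb eq_op psi (fun q => q \in dom k) eE
  [:: app us; app (word 2 j psi a)] [:: u : T -> T; a : T -> T] q _ _ qd.
  by case: i => [|[|i]] //= _; [exact: (word_carries wf cK lab Ku) | exact: (word_carries wf cK
    lab sa)].
rewrite size_map /= => /and3P[/negPf s4 /negPf s8 /negPf s9].
by rewrite /exponent_at /verdict s4 s8 s9 /=; case: (rot_at _ _ _ _ _).
Qed.
End OnePermutation.

Let Q (a : {perm T}) := nat_of_bin (rot_word 2 j (word 2 j psi a)).
Let C y (a : {perm T}) := [&& perm_on K a, (a \in 'C[x])%g & orbit_of [:: u; a; x] y == K].

Lemma twist_C y a : C y (a * xK)%g = C y a.
Proof.
suff H b : C y b -> C y (b * xK)%g.
  by apply/idP/idP => [/H|/H //]; rewrite twistK.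
case/and3P=> Kb /cent1P bx /eqP bK; rewrite /C twist_on //=.
by rewrite twist_orbit // eqxx andbT; apply/cent1P; exact: twist_comm.
Qed.

Lemma half_turn_root : w ^+ nat_of_bin (frac 2) = -1.
Proof.
have hN := half_turnN NE (erefl (nat_of_bin (frac 2))).
have : (w ^+ nat_of_bin (frac 2)) ^+ 2 == 1 by rewrite -exprM hN wN.
rewrite sqrf_eq1 => /orP[|/eqP//]; rewrite -(prim_order_dvd pw).
have h0 : (0 < nat_of_bin (frac 2))%N by move: (prim_order_gt0 pw);
  rewrite -hN muln_gt0 => /andP[].
by rewrite gtnNdvd // -hN muln2 -addnn -[X in (X < _)%N]addn0 ltn_add2l.
Qed.

Lemma check_word y a : C y a -> let s := word 2 j psi a in
  [/\ Q (a * xK)%g = Q a + nat_of_bin (frac 2) %[mod N],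
      all (fun q => odd (len pt_eqb (app s) q)) (dom k) -> Q a = 0 %[mod N] &
      has (fun q => let h := hit (pt_eqb (app (shift 2 j) q)) (app s) q in
         (h == 10) || ~~ odd (len pt_eqb (app s) q) && odd h)%N (dom k)].
Proof.
case/and3P=> Ka /cent1P ax _ s.
have sW : s \in words 2 j by exact: (word_in wf cK lab (perm_on_stable Ka (subxx K)) ax).
have /and3P[/BinNat.N.eqb_eq c1 c2 c3] := allP chk s sW; split=> //.
  rewrite /Q word_twist // -(modulo_turn NE) c1 (modulo_turn NE) nat_of_bin_add.
  by [].
move=> al; move: c2; rewrite al /= => /BinNat.N.eqb_eq c2.
by rewrite /Q -(modulo_turn NE) c2.
Qed.

(** For even [m], the right-hand side is zero and [a -> a * xK] changes the sign of each
    term on the left.  For odd [m], torsion pairs have odd cycles, hence trivial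
    characters, and [(a * xK) ^+ m] is [a ^+ m * xK]: the same map exchanges the two
    sets of pairs. *)
Lemma odd_connected rk y : injective rk -> y \in K ->
  connected_total u x (torsion_weight w rk m u x) K y =
  connected_total u x (root_weight F m u x) K y.
Proof.
move=> rkinj yK; rewrite /connected_total.
pose t (a : {perm T}) := [forall z in K, torsion_at eq_op m u a z].
transitivity (\sum_(a | C y a) (if t a then w ^+ Q a else 0)).
  apply: eq_bigr => a /and3P[Ka /cent1P ax /eqP aK]; rewrite prod_torsion_weight -/(t a).
  by case: (t a) => //; apply: (expw_mod wN); exact: exponent_rot_word aK.
under [RHS]eq_bigr do rewrite prod_root_weight.
have tE a : C y a -> t a = [forall z in K, ((a ^+ m)%g z == z) && (((a * u) ^+ m)%g z == z)].
  by move=> _; apply: eq_forallb => z; rewrite torsion_atP.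
have [om | em] := boolP (odd m); last first.
  rewrite [RHS]big1 => [|a Ca]; last first.
    have [_ _ /hasP[q qd /= bad]] := check_word Ca.
    case/and3P: Ca => Ka /cent1P ax _; have sa := perm_on_stable Ka (subxx K).
    rewrite (root_word m Ku cK wf lab sa); case r: (root_row _ _) => //.
    have : all (fun q => m %% len pt_eqb (app (word 2 j psi a)) q ==
        hit (pt_eqb (app (shift 2 j) q)) (app (word 2 j psi a)) q)%N (dom k).
      by move: r; rewrite /root_row /lengths all_map; apply: sub_all => q' /andP[].
    move/allP/(_ q qd)/eqP => E; move: bad; rewrite -E.
    have l10 : (len pt_eqb (app (word 2 j psi a)) q <= 10)%N.
      have eE y1 y2 : y1 \in dom k -> y2 \in dom k -> (psi y1 == psi y2) = pt_eqb y1 y2.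
        have [psiI _ _] := lab; move=> d1 d2; rewrite -[pt_eqb _ _]/(y1 == y2).
        by apply/eqP/eqP => [|-> //]; exact: psiI.
      have := len_carries eE (word_carries wf cK lab sa) qd => <-; exact: len_le10.
    case/orP => [/eqP E10 | /andP[el]].
      have : (m %% len pt_eqb (app (word 2 j psi a)) q < len pt_eqb (app (word 2 j psi a)) q)%N
        by rewrite ltn_mod.
      by rewrite E10 ltnNge l10.
    have el' : odd (len pt_eqb (app (word 2 j psi a)) q) = false := negbTE el.
    by rewrite (odd_mod m el') (negPf em).
  have S0 : \sum_(a | C y a) (if t a then w ^+ Q a else 0) =
            - \sum_(a | C y a) (if t a then w ^+ Q a else 0).
    rewrite {1}(reindex_inj (mulIg xK)) /= -sumrN; apply: eq_big => [a|a]; first exact: twist_C.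
    rewrite twist_C => Ca; have [qE _ _] := check_word Ca.
    have Ca' : C y (a * xK)%g by rewrite twist_C.
    rewrite !tE //; case/and3P: Ca => Ka /cent1P ax _.
    rewrite expg_twist // expg_twist_u // xK_even // !mulg1.
    case: ifP => _; last by rewrite oppr0.
    by rewrite (expw_mod wN qE) exprD half_turn_root mulrN1.
  apply/eqP; move/eqP: S0; rewrite -addr_eq0 -mulr2n -mulr_natl mulf_eq0.
  by rewrite (negPf (char0 _)).
rewrite [RHS](reindex_inj (mulIg xK)) /=; apply: eq_big => [a|a Ca].
  by rewrite -/(C y (a * xK)%g) twist_C.
have [_ q0 _] := check_word Ca.
have rE : [forall z in K, root_at eq_op m u (a * xK)%g x z] = t a.
  rewrite tE //; case/and3P: Ca => Ka /cent1P ax _; have sa := perm_on_stable Ka (subxx K).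
  apply: eq_forallb => z; case zK: (z \in K) => //=.
  rewrite root_atP // expg_twist // expg_twist_u // xK_odd // !permM.
  have am (b : {perm T}) : stable K b -> (b ^+ m)%g z \in K.
    by move=> sb; rewrite permX; elim: (m) => [|n IHn] //=; rewrite sb.
  by rewrite !xKE ?am ?perm_eqE // => v; rewrite permM Ku sa.
rewrite rE; case ta: (t a) => //; rewrite (expw_mod wN (q0 _)) //.
case/and3P: Ca => Ka /cent1P ax _; have sa := perm_on_stable Ka (subxx K).
move: ta; rewrite /t (torsion_word m Ku cK wf lab sa) /torsion_row /lengths all_map.
apply: sub_all => q /= /andP[/eqP lm _].
exact: (@dvdn_odd (len pt_eqb (app (word 2 j psi a)) q) m (introT eqP lm) om).
Qed.
End Involution.

Local Close Scope ring_scope.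

(** * Sweedler powers of the integral *)

Local Open Scope ring_scope.

Section SweedlerPower.
Variables (F : fieldType) (gT : finGroupType).
Local Notation D := (drinfeld_double F gT).

Lemma lin_ext_comp (I : finType) (V W : lmodType F) (g : {linear V -> W})
    (f : I -> V) (u : {ffun I -> F^o}) :
  g (lin_ext f u) = lin_ext (g \o f) u.
Proof. by rewrite /lin_ext linear_sum; apply: eq_bigr => i _; rewrite linearZ. Qed.

Lemma eq_lin_ext (I : finType) (V : lmodType F) (f g : I -> V) :
  f =1 g -> lin_ext f =1 lin_ext g.
Proof. by move=> fg u; apply: eq_bigr => i _; rewrite fg. Qed.

(** The multiplication of a tensor with its first factor replaced by [f]: splitting that
    factor by the comultiplication only changes [f]. *)
Definition head_mul k (f : gT * gT -> D) : dbl_tensor F gT k.+1 -> D :=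
  lin_ext (fun t : k.+1.-tuple (gT * gT) =>
    f (thead t) * \prod_(b <- behead t) dbl F b.1 b.2).

HB.instance Definition _ k f :=
  GRing.isLinear.Build F (dbl_tensor F gT k.+1) D _ (@head_mul k f)
    (lin_ext_is_linear _).

Definition split_head (f : gT * gT -> D) (b : gT * gT) : D :=
  \sum_h f (h, b.2) * dbl F (h^-1 * b.1)%g b.2.

Lemma head_mul_comul k f (v : dbl_tensor F gT k.+1) :
  head_mul f (comul_head v) = head_mul (split_head f) v.
Proof.
rewrite /comul_head (lin_ext_comp (@head_mul k.+1 f)).
apply: eq_lin_ext => t /=; rewrite (lin_ext_comp (@head_mul k.+1 f)) /=.
rewrite /comul lin_ext_basis (linear_sum (lin_ext _)) /=.
rewrite /split_head mulr_suml; apply: eq_bigr => h _.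
rewrite lin_ext_basis /= /head_mul lin_ext_basis theadE /= big_cons mulrA.
by [].
Qed.

Lemma iter_mul_head k (v : dbl_tensor F gT k.+1) :
  iter_mul v = head_mul (fun b => dbl F b.1 b.2) v.
Proof.
apply: eq_lin_ext => t /=; rewrite {1}(tuple_eta t) /= big_cons.
by [].
Qed.

Lemma head_mul_iter k f b :
  head_mul f (iter_comul k (basis_vec F b)) = iter k split_head f b.
Proof.
elim: k f => [|k IHk] f /=.
  rewrite lin_ext_basis /head_mul lin_ext_basis theadE big_nil mulr1; by [].
by rewrite head_mul_comul IHk -iterSr.
Qed.

(** The indices that multiply to a nonzero term are [h], [x^-1 h x], [x^-2 h x^2] and so
    on, and their product telescopes to [(h x^-1) ^+ k.+1 * x ^+ k.+1]. *)
Lemma iter_split_head k g x :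
  iter k split_head (fun b => dbl F b.1 b.2) (g, x) =
  \sum_(h | ((h * x^-1) ^+ k.+1 * x ^+ k.+1)%g == g) dbl F h (x ^+ k.+1)%g.
Proof.
elim: k g => [|k IHk] g.
  rewrite (big_pred1 g) //= => h; by rewrite !expg1 mulgKV.
rewrite iterS /= /split_head /=.
under eq_bigr => h' _ do rewrite IHk mulr_suml.
rewrite (exchange_big_dep predT) //=.
rewrite [RHS]big_mkcond /=; apply: eq_bigr => h _.
rewrite (big_pred1 ((h * x^-1) ^+ k.+1 * x ^+ k.+1)%g); last by move=> h' /=; rewrite eq_sym.
rewrite dblM -expgSr.
set y := (x ^+ k.+1)%g; set w := ((h * x^-1) ^+ k.+1)%g.
have -> : (h == y * ((w * y)^-1 * g) * y^-1)%g = (((h * x^-1) ^+ k.+2 * x ^+ k.+2)%g == g).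
  rewrite [in RHS]expgSr [(x ^+ k.+2)%g]expgS -/w -/y invMg !mulgA mulgV mul1g.
  rewrite mulgKV -mulgA -/w.
  rewrite -(inj_eq (mulgI w)) -(inj_eq (mulIg y)).
  by rewrite !mulgA mulgV mul1g mulgKV.
by [].
Qed.

Lemma sweedler_integral m : (0 < m)%N ->
  sweedler_power m (integral F gT) =
  (#|gT|%:R^-1 : F) *: \sum_a \sum_(h | ((a * h) ^+ m == a ^+ m)%g)
                          dbl F h (a ^+ m)^-1%g.
Proof.
case: m => // k _; rewrite /sweedler_power /= iter_mul_head /integral.
have E (v : D) : head_mul (fun b => dbl F b.1 b.2) (iter_comul k v) =
    lin_ext (fun b => iter k split_head (fun b => dbl F b.1 b.2) b) v.
  rewrite [v in LHS]basis_vecE.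
  have L (w : D) : iter_comul k w = lin_ext (fun b => iter_comul k (basis_vec F b)) w.
    elim: {v} k => [|k IHk] /=.
      by apply: eq_lin_ext => b /=; rewrite lin_ext_basis.
    by rewrite IHk /comul_head; exact: lin_ext_comp.
  rewrite -basis_vecE L (lin_ext_comp (@head_mul k _)); apply: eq_lin_ext => b /=.
  exact: head_mul_iter.
rewrite E linearZ linear_sum /=; congr (_ *: _).
rewrite (reindex_inj invg_inj) /=; apply: eq_bigr => a _.
rewrite lin_ext_basis iter_split_head invgK -expgVn; apply: eq_bigl => h.
rewrite expgVn -eq_mulgV1.
have -> : ((h * a) ^+ k.+1 = ((a * h) ^+ k.+1) ^ a^-1^-1)%g.
  by rewrite invgK conjXg conjgE !mulgA mulVg mul1g.
rewrite invgK -[X in _ == X](_ : ((a ^+ k.+1) ^ a)%g = _) ?(inj_eq (conjg_inj a)) //.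
by rewrite conjXg conjgE mulKg.
Qed.
End SweedlerPower.

Local Close Scope ring_scope.

(** * Traces of idempotents *)

Import passmx.

Local Open Scope ring_scope.

(** Write [A = C B] with [C] of full column rank and [B] of full row rank.  Idempotence
    gives [B C = 1], and [\tr (C B) = \tr (B C)]. *)
Lemma mxtrace_idem (F : fieldType) n (A : 'M[F]_n) :
  A *m A = A -> \tr A = (\rank A)%:R.
Proof.
have /row_fullP[L LC] := col_base_full A; have /row_freeP[R BR] := row_base_free A.
move=> AA; rewrite -{1}(mulmx_base A) mxtrace_mulC.
have AAb := etrans (congr2 mulmx (mulmx_base A) (mulmx_base A))
  (etrans AA (esym (mulmx_base A))).
move: (\rank A) (col_base A) (row_base A) L R LC BR AAb => r C B L R LC BR.
move/(congr1 (fun M => L *m M *m R)).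
by rewrite !mulmxA LC !mul1mx -!mulmxA BR !mulmx1 => ->; rewrite mxtrace1.
Qed.

Section EndTrace.
Variables (F : fieldType) (V : vectType F).
Implicit Types f g : 'End(V).

Lemma end_trace_sum (I : finType) (P : pred I) (f : I -> 'End(V)) :
  end_trace (\sum_(i | P i) f i) = \sum_(i | P i) end_trace (f i).
Proof. by rewrite /end_trace !raddf_sum. Qed.

Lemma end_traceZ (c : F) f : end_trace (c *: f) = c * end_trace f.
Proof. by rewrite /end_trace linearZ /= mxtraceZ. Qed.

Lemma end_trace_mulC f g : end_trace (f \o g)%VF = end_trace (g \o f)%VF.
Proof.
have B := vbasisP {:V}.
by rewrite /end_trace !(mxof_comp _ _ B) mxtrace_mulC.
Qed.

Lemma end_trace_idem f : (f \o f)%VF = f -> exists r : nat, end_trace f = r%:R.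
Proof.
move=> ff; exists (\rank (mxof (vbasis {:V}) (vbasis {:V}) f)).
have B := vbasisP {:V}.
by apply: mxtrace_idem; rewrite -(mxof_comp _ _ B) ff.
Qed.
End EndTrace.

Section ConjPairs.
Variable gT : finGroupType.
Local Open Scope group_scope.

Definition pairJ (p : gT * gT) (g : gT) : gT * gT := (p.1 ^ g, p.2 ^ g).

Lemma pairJ_is_action : is_action setT pairJ.
Proof.
apply: is_total_action => [[u a]|[u a] x y]; first by rewrite /pairJ !conjg1.
by rewrite /pairJ /= !conjgM.
Qed.
Definition pairJ_action := Action pairJ_is_action.

(** Weighted by the orders of the stabilizers, the terms of an orbit add up to [#|gT|]
    times one term. *)
Lemma sum_card_stab_orbits (F : fieldType) (S : {set gT * gT})
    (f : gT * gT -> F) (r : gT * gT -> nat) :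
    (forall p g, p \in S -> pairJ p g \in S) ->
    (forall p g, p \in S -> f (pairJ p g) = f p) ->
    (forall p, p \in S -> f p = (r p)%:R)%R ->
  exists k : nat, (\sum_(p in S) #|'C[p.1] :&: 'C[p.2]|%:R * f p
                   = #|gT|%:R * k%:R :> F)%R.
Proof.
move=> SJ fJ fr; pose to := pairJ_action.
have actS : [acts [set: gT], on S | to].
  apply/actsP => g _ p; apply/idP/idP => Sp; last exact: SJ.
  have := SJ _ g^-1 Sp; rewrite /pairJ /= !conjgK.
  by case: p {Sp}.
rewrite (set_partition_big _ (orbit_partition actS)) /=.
pose some_in (O : {set gT * gT}) := odflt (1, 1) [pick p in O].
exists (\sum_(O in orbit to [set: gT] @: S) r (some_in O))%N.
rewrite natr_sum mulr_sumr; apply: eq_bigr => _ /imsetP[p0 Sp0 ->].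
set O := orbit _ _ _.
have Op0 : p0 \in O by exact: orbit_refl.
have [p1 Op1 ->] : exists2 p, p \in O & some_in O = p.
  by rewrite /some_in; case: pickP => [p Op|/(_ p0)]; [exists p | rewrite Op0].
have defO : O = orbit to [set: gT] p1 by apply/esym/orbit_eqP.
have Sp1 : p1 \in S by case/orbitP: Op1 => g _ <-; exact: SJ.
have stab p : 'C_[set: gT][p | to] = 'C[p.1] :&: 'C[p.2].
  have fixJ u g : (u ^ g == u) = (g \in 'C[u]).
    by rewrite cent1E conjgE -(inj_eq (mulgI g)) mulKVg eq_sym.
  apply/setP=> g; rewrite setTI in_setI -!fixJ; apply/astab1P/andP => /=.
    by case: p => u a [/= -> ->].
  by case: p => u a /= [/eqP ua /eqP aa]; congr pair.
rewrite defO (eq_bigr (fun=> #|'C[p1.1] :&: 'C[p1.2]|%:R * f p1)%R).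
  rewrite sumr_const -fr // -[LHS]mulr_natl mulrA -natrM -stab card_orbit_stab.
  by rewrite cardsT.
move=> _ /orbitP[g _ <-]; rewrite fJ //; congr (_%:R * _)%R.
rewrite -(cardJg (_ :&: _) g) conjIg !cent1J; by [].
Qed.
End ConjPairs.

Local Close Scope ring_scope.

(** * Indicators as sums of ranks *)

Local Open Scope ring_scope.

Section IndicatorAsSumOfRanks.
Variables (F : fieldType) (gT : finGroupType).
Hypothesis char0 : forall n : nat, (0 < n)%N -> n%:R != 0 :> F.
Variables (V : vectType F) (rho : {linear drinfeld_double F gT -> 'End(V)}).
Hypothesis rho_mod : is_module rho.
Variables (m : nat) (L : gT -> gT -> gT -> F).
Hypothesis m_gt0 : (0 < m)%N.

Definition torsion_pair (u a : gT) := ((a ^+ m == 1) && ((a * u) ^+ m == 1))%g.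

Hypothesis LM : forall u a x y, torsion_pair u a ->
  x \in ('C[u] :&: 'C[a])%g -> y \in ('C[u] :&: 'C[a])%g ->
  L u a (x * y)%g = L u a x * L u a y.
Hypothesis LJ : forall u a x g, torsion_pair u a ->
  x \in ('C[u] :&: 'C[a])%g -> L (u ^ g)%g (a ^ g)%g (x ^ g)%g = L u a x.
Hypothesis rootsL : forall u x, commute u x ->
  \sum_(a | (x \in 'C[a])%g && torsion_pair u a) L u a x
    = #|[set a | ((a ^+ m == x) && ((a * u) ^+ m == x))%g]|%:R.

Let t (h x : gT) := end_trace (rho (dbl F h x^-1%g)).

Lemma rhoM v w : rho (v * w) = (rho v \o rho w)%VF.
Proof. by case: rho_mod. Qed.

(** Conjugation by the invertible element [w g] of the double. *)
Let tJ (h x g : gT) : t (h ^ g)%g (x ^ g)%g = t h x.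
Proof.
pose w (k : gT) := \sum_(i : gT) dbl F i k : drinfeld_double F gT.
have wl k h' y : w k * dbl F h' y = dbl F (k * h' * k^-1)%g (k * y)%g.
  rewrite mulr_suml (bigD1 (k * h' * k^-1)%g) //= dblM eqxx big1 ?addr0 //.
  by move=> i /negPf ni; rewrite dblM ni.
have wr k h' y : dbl F h' y * w k = dbl F h' (y * k)%g.
  rewrite mulr_sumr (bigD1 (h' ^ y)%g) //= dblM big1 ?addr0; last first.
    move=> i ni; rewrite dblM; case: eqP => // eh; case/eqP: ni.
    by rewrite eh conjgE !mulgA mulVg mul1g mulgKV.
  by rewrite conjgE !mulgA mulgV mul1g mulgK eqxx.
rewrite /t; have -> : dbl F (h ^ g)%g (x ^ g)^-1%g = w g^-1%g * (dbl F h x^-1%g * w g).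
  by rewrite wr wl invgK -conjVg !conjgE !mulgA.
rewrite rhoM end_trace_mulC -rhoM -mulrA.
have -> : w g * w g^-1%g = 1.
  rewrite {2}/w mulr_sumr (eq_bigr (fun i => dbl F (g * i * g^-1)%g 1%g)).
    rewrite (reindex_inj (conjg_inj g)) /=; apply: eq_bigr => i _.
    by rewrite conjgE !mulgA mulgV mul1g mulgK.
  by move=> i _; rewrite wl mulgV.
by rewrite mulr1.
Qed.

(** [e p] is the idempotent attached to the pair [p], and [r p] its rank. *)
Lemma indicator_natural : exists k : nat,
  end_trace (rho (sweedler_power m (integral F gT))) = k%:R.
Proof.
pose B (p : gT * gT) := ('C[p.1] :&: 'C[p.2])%G.
have cB p : #|B p|%:R != 0 :> F by apply: char0; exact: cardG_gt0.
pose S := [set p : gT * gT | torsion_pair p.1 p.2].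
pose e (p : gT * gT) : drinfeld_double F gT :=
  #|B p|%:R^-1 *: \sum_(x in B p) L p.1 p.2 x *: dbl F p.1 x^-1%g.
have e_idem p : p \in S -> e p * e p = e p.
  rewrite inE => Sp; rewrite /e -scalerAl -scalerAr; congr (_ *: _).
  rewrite mulr_sumr -[RHS]scale1r -[X in _ = X *: _](mulVf (cB p)) -scalerA; congr (_ *: _).
  rewrite scaler_nat -sumr_const; apply: eq_bigr => x Bx.
  rewrite mulr_suml [RHS](reindex_inj (mulgI x)) /=.
  apply: eq_big => [y | y By]; first by rewrite groupMl.
  rewrite -scalerAl -scalerAr scalerA mulrC -LM //.
  rewrite dblM invgK; have xu : commute y p.1 by case/setIP: By => /cent1P.
  by rewrite -mulgA -xu mulKg eqxx invMg.
have tr_e p : #|B p|%:R * end_trace (rho (e p)) = \sum_(x in B p) L p.1 p.2 x * t p.1 x.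
  rewrite /e linearZ end_traceZ mulVKf // linear_sum end_trace_sum.
  by apply: eq_bigr => x _; rewrite linearZ end_traceZ.
have rank_e p : p \in S -> exists r : nat, end_trace (rho (e p)) == r%:R.
  move=> Sp; have [r ->] : exists r : nat, end_trace (rho (e p)) = r%:R.
    by apply: end_trace_idem; rewrite -rhoM e_idem.
  by exists r.
pose r p := if insub p : {? p | p \in S} is Some q then
   xchoose (rank_e (val q) (valP q)) else 0%N.
have rP p : p \in S -> end_trace (rho (e p)) = (r p)%:R.
  by move=> Sp; rewrite /r insubT /=; apply/eqP; exact: (xchooseP (rank_e _ _)).
have SJ p g : p \in S -> pairJ p g \in S.
  by rewrite !inE /torsion_pair /= -conjMg -!conjXg !conjg_eq1.
have BJ p g : B (pairJ p g) = (B p :^ g)%G.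
  by apply/val_inj; rewrite /= conjIg !cent1J.
have eJ p g : p \in S -> end_trace (rho (e (pairJ p g))) = end_trace (rho (e p)).
  rewrite inE => Sp; apply: (mulfI (cB p)); rewrite tr_e.
  rewrite -(cardJg (B p) g) -[#|_|]/#|(B p :^ g)%G| -BJ tr_e BJ /=.
  rewrite [LHS](reindex_inj (conjg_inj g)) /=; apply: eq_big => x.
    by rewrite memJ_conjg.
  by rewrite memJ_conjg => Bx; rewrite tJ LJ.
have [k Ek] := sum_card_stab_orbits SJ eJ rP.
exists k; apply: (mulfI (char0 (cardG_gt0 [set: gT]))); rewrite cardsT -Ek.
rewrite sweedler_integral // linearZ end_traceZ mulrA mulfV; last first.
  by rewrite -cardsT; apply: char0; exact: cardG_gt0.
rewrite mul1r linear_sum end_trace_sum.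
transitivity (\sum_a \sum_(u | (a ^+ m == (a * u) ^+ m)%g) t u (a ^+ m)%g).
  apply: eq_bigr => a _; rewrite linear_sum end_trace_sum.
  by apply: eq_bigl => u; rewrite eq_sym.
rewrite (exchange_big_dep predT) //=.
transitivity (\sum_u \sum_(x in 'C[u]%g) \sum_(a | (x \in 'C[a])%g && torsion_pair u a) L u a x
  * t u x).
  apply: eq_bigr => u _; rewrite (partition_big (fun a => a ^+ m)%g (mem 'C[u]%g)) /=.
    apply: eq_bigr => x ux; rewrite -mulr_suml rootsL; last by apply/esym/cent1P.
    rewrite -sum1_card natr_sum mulr_suml; apply: eq_big => a.
      by rewrite inE andbC; case: eqP => //= ->; rewrite eq_sym.
    by rewrite mul1r => /andP[_ /eqP->].
  move=> a /eqP ax; apply/cent1P; apply: (mulgI a).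
  have E : (a * u * a ^+ m = a ^+ m * (a * u))%g by rewrite ax -expgS expgSr.
  by rewrite mulgA -expgS expgSr -mulgA -E mulgA.
transitivity (\sum_(p in S) \sum_(x in B p) L p.1 p.2 x * t p.1 x); last first.
  by apply: eq_bigr => p _; rewrite tr_e.
rewrite (eq_bigl (fun p => true && torsion_pair p.1 p.2)); last by move=> p; rewrite inE.
rewrite -(pair_big_dep predT torsion_pair (fun u a => \sum_(x in B (u, a)) L u a x * t u x)).
apply: eq_bigr => u _; rewrite (exchange_big_dep (torsion_pair u)) /=;
  last by move=> ? ? _ /andP[].
apply: eq_bigr => a Pa; apply: eq_bigl => x.
by rewrite in_setI Pa andbT.
Qed.
End IndicatorAsSumOfRanks.

Local Close Scope ring_scope.

(** * The theorem *)

Local Open Scope ring_scope.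

Section Connected.
Variables (T : finType) (T10 : (#|T| <= 10)%N) (F : fieldType).
Hypothesis char0 : forall n : nat, (0 < n)%N -> n%:R != 0 :> F.
Variables (N : nat) (NE : N = 2520%N) (w : F) (pw : N.-primitive_root w).
Let wN : w ^+ N = 1 := prim_expr_order pw.
Implicit Types (K : {set T}) (u x a : {perm T}).

Lemma exponent_ext m K rk (u a x x' : T -> T) : stable K u -> stable K a -> stable K x ->
  {in K, x =1 x'} -> total_exponent m K rk u a x' = total_exponent m K rk u a x.
Proof.
move=> Ku Ka Kx xx; rewrite /total_exponent; apply: eq_bigr => y yK.
suff E : exponent_at eq_op rk m u a x' y = exponent_at eq_op rk m u a x y by rewrite E.
by apply: (@exponent_at_carries _ _ eq_op eq_op rk rk id (fun y => y \in K)) => //;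
  apply: carries_id.
Qed.

(** On [K] the element [x] agrees with the identity, where the characters are 1 and the
    torsion and root conditions coincide. *)
Lemma trivial_connected K u x m rk y : injective rk -> stable K u -> {in K, forall z, x z = z} ->
  connected_total u x (torsion_weight w rk m u x) K y =
    connected_total u x (root_weight F m u x) K y.
Proof.
move=> rkinj Ku Kx; apply: eq_bigr => a /and3P[Ka _ _]; have sa := perm_on_stable Ka (subxx K).
have s1 : stable K (1%g : {perm T}) by move=> z; rewrite perm1.
rewrite prod_torsion_weight prod_root_weight (@exponent_ext m K rk u a (1%g : {perm T}) x) //;
  last first.
  by move=> z zK; rewrite perm1 Kx.
rewrite (expw_mod wN (exponent1 T10 NE erefl m (in2W rkinj) Ku sa)) expr0.
have -> : [forall z in K, torsion_at eq_op m u a z] = [forall z in K, root_at eq_op m u a x z].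
  apply: eq_forallb => z; case zK: (z \in K) => //=.
  by rewrite torsion_atP // root_atP // Kx.
by case: ifP.
Qed.

(** If some [a] is transitive on [K] with [u] and [x], then [x] is semiregular on [K]:
    the points whose [x]-cycle has a given length form a stable set. *)
Lemma connected_eq K u x m rk y : injective rk -> stable K u -> stable K x -> y \in K ->
  commute u x ->
  connected_total u x (torsion_weight w rk m u x) K y =
    connected_total u x (root_weight F m u x) K y.
Proof.
move=> rkinj Ku Kx yK ux.
case: (pickP (fun a => [&& perm_on K a, (a \in 'C[x])%g & orbit_of [:: u; a;
  x] y == K])) => [a|none];
  last by rewrite /connected_total !big_pred0.
case/and3P=> Ka /cent1P ax /eqP aK.
pose l := len eq_op x y.
have Kl : {in K, forall z, len eq_op x z = l}.
  have yl : y \in [set z | len eq_op x z == l] by rewrite inE.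
  have sl : orbit_of [:: u; a; x] y \subset [set z | len eq_op x z == l].
    apply: orbit_of_min => // f fg z; rewrite !inE len_stable //.
    move: fg; rewrite !inE => /or3P[] /eqP->;
      [exact/commute_sym | exact/commute_sym | exact: commute_refl].
  by move=> z zK; have := subsetP sl z; rewrite aK zK inE => /(_ isT) /eqP.
have [j [cK mklab]] := labeling_exists T10 Kx Kl.
have k10 : (l * j <= 10)%N by rewrite cK (leq_trans (max_card _)).
have k0 : (0 < l * j)%N by rewrite cK; apply/card_gt0P; exists y.
have [l1 | l1] := eqVneq l 1%N.
  apply: trivial_connected => // z zK.
  by have := iter_len T10 x z; rewrite Kl // l1.
have checked L : (l, j, L) \in cases -> connected_total u x (torsion_weight w rk m u x) K y =
    connected_total u x (root_weight F m u x) K y.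
  move/(allP cases_checked); case: ifP => // /and3P[wf U L0] chk.
  have [psi0 lab0] := mklab wf.
  have [psi lab mn] := minimal_labeling wf (esym cK) lab0 Ku ux.
  apply: (checked_connected T10 char0 NE pw m Ku Kx ux (esym cK) wf lab rkinj _ yK U L0 chk mn).
  move: l1 k0 k10; case: (l) => [|[|l']] // _ k0 k10; rewrite /= (leq_trans _ k10) //.
  by rewrite leq_pmulr // ; move: k0; rewrite muln_gt0.
have [/andP[/eqP l2 oj] | nodd] := boolP ((l == 2) && odd j).
  have jc : j \in [:: 1; 3; 5]%N.
    by move: k10; rewrite l2 -[10%N]/(2 * 5)%N leq_pmul2l //; move: (j) oj; do 6?case=> //.
  move: (allP odd_cases_checked j jc); case: ifP => // wf chk.
  move: mklab; rewrite l2 => /(_ wf)[psi lab].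
  apply: (odd_connected T10 char0 NE pw m Ku Kx ux _ wf lab oj chk rkinj yK).
  by rewrite -cK l2.
pose listed l j := has (fun c : nat * nat * nat => (c.1.1 == l) && (c.1.2 == j)) cases.
have small : all (fun l => all (fun j => [&& 0 < l * j, l * j <= 10, l != 1 &
    ~~ ((l == 2) && odd j)] ==> listed l j)%N (iota 0 11)) (iota 0 11) by [].
have /andP[l0 j0] : (0 < l)%N && (0 < j)%N by rewrite -muln_gt0.
have l11 : (l < 11)%N by rewrite ltnS; apply: leq_trans k10; exact: leq_pmulr.
have j11 : (j < 11)%N by rewrite ltnS; apply: leq_trans k10; exact: leq_pmull.
have lin : l \in iota 0 11 by rewrite mem_iota.
have jin : j \in iota 0 11 by rewrite mem_iota.
have := allP (allP small l lin) j jin; rewrite k0 k10 l1 nodd /=.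
by case/hasP=> -[[l' j'] L] /[swap] /andP[/= /eqP-> /eqP->]; exact: checked.
Qed.
End Connected.

Lemma prim_root_complex (C : numClosedFieldType) n : (0 < n)%N ->
  exists z : C, n.-primitive_root z.
Proof.
pose p : {poly C} := 'X^n - 1; have [r Dp] := closed_field_poly_normal p.
move=> n_gt0; rewrite (monicP _) ?monicXnsubC // scale1r in Dp.
have rn1: all n.-unity_root r by apply/allP=> z; rewrite -root_prod_XsubC -Dp.
have sz_r: (n < (size r).+1)%N.
  by rewrite -(size_prod_XsubC r id) -Dp size_XnsubC.
have [|z] := hasP (has_prim_root n_gt0 rn1 _ sz_r); last by exists z.
by rewrite -separable_prod_XsubC -Dp separable_Xn_sub_1 // pnatr_eq0 -lt0n.
Qed.

Lemma natural_indicator (F : fieldType) n (chi : drinfeld_double F {perm 'I_n} -> F) m N (w : F) :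
  (forall n : nat, (0 < n)%N -> n%:R != 0 :> F) ->
  N = 2520%N -> N.-primitive_root w -> (n <= 10)%N -> irreducible_character chi ->
  (0 < m)%N -> exists k : nat, FS_indicator m chi = k%:R.
Proof.
move=> char0 NE pw n10 [V [rho [[rho_mod _ _] chiE]]] m0.
rewrite /FS_indicator chiE.
have T10 : (#|'I_n| <= 10)%N by rewrite card_ord.
have wN : w ^+ N = 1 := prim_expr_order pw.
pose rk := @nat_of_ord n; have rkI : injective rk := @ord_inj n.
have st (p : {perm 'I_n}) : stable [set: 'I_n] p by move=> y; rewrite !inE.
have rkT : {in [set: 'I_n] &, injective rk} := in2W rkI.
apply: (indicator_natural char0 rho_mod (L := fun u a x =>
  w ^+ total_exponent m [set: 'I_n] rk u a x) m0).
- move=> u a x y _ /setIP[/cent1P xu /cent1P xa] /setIP[/cent1P yu /cent1P ya].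
  have E := exponentM T10 NE (erefl (nat_of_bin (frac 2))) m (st u) (st a) rkT (st x) xu xa (st
    y) yu ya.
  by have {}E := expw_mod wN E; rewrite exprD in E; exact: E.
- move=> u a x g _ /setIP[/cent1P xu /cent1P xa].
  rewrite -(exponent_conj m [set: 'I_n] rk u a x g).
  have -> : g @: [set: 'I_n] = [set: 'I_n].
    by apply/setP=> y; rewrite inE; apply/imsetP; exists (g^-1%g y); rewrite ?inE ?permKV.
  apply: (expw_mod wN); apply: (exponent_rk T10 NE (erefl (nat_of_bin (frac 2)))) => //.
  - by move=> y z _ _ /rkI /perm_inj.
  - by rewrite /commute -!conjMg xu.
  - by rewrite /commute -!conjMg xa.
move=> u x ux.
have := @eq_total _ T10 F u x _ _ [set: 'I_n] (@local_torsion_weight _ _ w rk m u x)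
  (@local_root_weight _ F m u x) (st u) (st x).
move=> /(_ (fun K y Ku Kx yK => connected_eq T10 char0 NE pw m rkI Ku Kx yK ux)).
have onT a : perm_on [set: 'I_n] a by apply/subsetP=> y; rewrite inE.
rewrite /total => E; transitivity (\sum_(a | perm_on [set: 'I_n] a && (a \in 'C[x])%g)
   \prod_(y in [set: 'I_n]) torsion_weight w rk m u x a y).
  under [RHS]eq_bigr do rewrite prod_torsion_weight.
  rewrite -big_mkcondr; apply: eq_bigl => a; rewrite onT /= -[(a \in _)%g]/(a \in 'C[x]%g).
  rewrite cent1C; congr (_ && _); apply/andP/forall_inP => [[/eqP a1 /eqP b1] y _|H].
    by rewrite torsion_atP // a1 b1 perm1 eqxx.
  split; apply/eqP/permP=> y; have := H y (in_setT y);
    rewrite torsion_atP // perm1 => /andP[/eqP h1 /eqP h2] //.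
rewrite E; under eq_bigr do rewrite prod_root_weight.
rewrite -natr_sum -big_mkcondr sum1_card; congr (_%:R); apply: eq_card => a.
rewrite [in RHS]inE unfold_in onT /=; apply/andP/andP => [[_ /forall_inP H]|[/eqP am /eqP bm]].
  by split; apply/eqP/permP=> y; have := H y (in_setT y);
    rewrite root_atP // => /andP[/eqP ? /eqP ?].
split; last by apply/forall_inP=> y _; rewrite root_atP // am bm eqxx.
by apply/cent1P; rewrite -am; apply: commuteX; exact: commute_refl.
Qed.

Theorem theorem4p0 (R : realType) (n : nat) (hn : (3 <= n <= 10)%N)
    (chi : drinfeld_double R[i] {perm 'I_n} -> R[i])
    (hchi : irreducible_character chi) (m : nat) (hm : (1 <= m)%N) :
  exists k : nat, FS_indicator m chi = k%:R.
Proof.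
have [N NE] : {N | N = 2520%N} by exists 2520%N.
have N0 : (0 < N)%N by rewrite NE.
have [w pw] := prim_root_complex R[i] N0.
have char0 k : (0 < k)%N -> k%:R != 0 :> R[i] by rewrite pnatr_eq0 lt0n.
by apply: (natural_indicator char0 NE pw _ hchi hm); case/andP: hn.
Qed.
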